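(* Let $Z$ be a smooth variety over an algebraically closed field of characteristic zero (or a smooth complex analytic variety), let $a\in Z$, and let $G=\mu_{p_1}\times\cdots\times\mu_{p_r}$ denote a group of automorphisms of $\mathcal O_{Z,a}$ (induced by an action of $G$ on $Z$ with fixed point $a$). Let $I\subset\mathcal O_{Z,a}$ denote a principal product ideal $I=(f)$, where $f=f_1\cdots f_k$ in $\mathcal O_{Z,a}$ and the gradients of the factors $f_1,\ldots,f_k$ at $a$ are linearly independent (i.e., $I$ is normal crossings). Assume that $I$ is $G$-invariant, but that $I$ does not split (nontrivially) into $G$-invariant factors. Furthermore, let $E\subset Z$ denote a simple normal crossings divisor such that the ideal $I_{E_i}\subset\mathcal O_{Z,a}$ of each component $E_i$ of $E$ at $a$ is $G$-invariant, and such that $E$ and $S$ are transverse, where $S$ is the normal crossings locus $S=\{f_1=\cdots=f_k=0\}$. Then $Z$ admits a coordinate system $y=(y_0,\ldots,y_{n-1})$ at $a$, adapted to $E$ (as well as to $S$), with respect to which $G$ is diagonal, such that $I$ is generated by $$\prod_{j=0}^{k-1}\left(y_0+\varepsilon_k^{\beta_{j,1}}y_1+\cdots+\varepsilon_k^{\beta_{j,k-1}}y_{k-1}\right),$$ where the coefficient matrix is given as follows. Let $H=H_0$ be the subgroup of $G$ of elements preserving the ideal $(f_1)$, and for $i\ge1$ let $q_i$ be the smallest positive integer $q$ such that $(\varepsilon^{(i)}_{p_i})^q\in H_{i-1}$ and let $H_i$ be the subgroup generated by $H_{i-1}$ and $\mu_{p_i}^{(i)}$. Then there are $s\le r$ with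 $k=q_1q_2\cdots q_s$, and integers $\gamma_i(\ell_1,\ldots,\ell_{i-1})$ with $0\le\gamma_i(\ell_1,\ldots,\ell_{i-1})<p_i/q_i$, for $i=1,\ldots,s$ and $0\le\ell_{i'}<q_{i'}$ (a single integer $\gamma_1$ if $i=1$), such that, if the rows $j=0,\ldots,k-1$ are indexed by $(m_1,\ldots,m_s)$ and the columns by $(\ell_1,\ldots,\ell_s)$, where $0\le m_i,\ell_i<q_i$, then (up to multiplication of each row by a root of unity) the coefficient in row $(m_1,\ldots,m_s)$ and column $(\ell_1,\ldots,\ell_s)$ is $$\varepsilon_{p_1}^{m_1\gamma_1}\,\varepsilon_{q_1}^{m_1\ell_1}\;\varepsilon_{p_2}^{m_2\gamma_2(\ell_1)}\,\varepsilon_{q_2}^{m_2\ell_2}\cdots\varepsilon_{p_s}^{m_s\gamma_s(\ell_1,\ldots,\ell_{s-1})}\,\varepsilon_{q_s}^{m_s\ell_s}.$$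
   Context: For a positive integer $p$, $\mu_p$ is the multiplicative cyclic group of order $p$, with generator the primitive $p$-th root of unity $\varepsilon_p=e^{2\pi i/p}$ (over a general algebraically closed field of characteristic zero, a compatible choice of primitive roots of unity). $\mu^{(i)}_{p_i}=\{1\}\times\cdots\times\mu_{p_i}\times\cdots\times\{1\}\subset G$ is the $i$-th factor, and $\varepsilon^{(i)}_{p_i}$ is its generator corresponding to $\varepsilon_{p_i}$. An ideal $I\subset\mathcal O_{Z,a}$ is $G$-invariant if $g\cdot I=I$ for every $g\in G$. ''$I=(f)$ does not split into $G$-invariant factors'' means that one cannot write $f=\varphi_1\varphi_2$, neither factor a unit, with both ideals $(\varphi_1)$, $(\varphi_2)$ $G$-invariant. $G$ is diagonal with respect to regular (or analytic) local coordinates $y$ at $a$ if each $\varepsilon^{(i)}_{p_i}\cdot y_j$ equals $\varepsilon_{p_i}^{c_{ij}}y_j$ for some integer $c_{ij}$. Coordinates $y$ at $a$ are adapted to $E$ and $S$ if the ideal of each component of $E$ at $a$ is generated by one of the coordinates, and the ideal of $S$ is generated by some of the coordinates. *)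

(* Defs.v *)
From HB Require Import structures.
From mathcomp Require Import all_boot all_order all_algebra all_fingroup all_solvable.
From mathcomp Require Import boolp classical_sets reals complex mpoly.

Set Implicit Arguments.
Unset Strict Implicit.
Unset Printing Implicit Defensive.

Import GRing.Theory.

Local Open Scope ring_scope.
Local Open Scope classical_set_scope.

Section LocalAlgebra.
Variables (K : closedFieldType) (O : comUnitAlgType K).

Definition ideal_gen (A : set O) : set O :=
  [set z | exists (m : nat) (u v : 'I_m -> O),
     (forall i, A (v i)) /\ z = \sum_i u i * v i].

(* The maximal ideal, when O is local. *)
Definition nonunits : set O := [set z | z \isn't a GRing.unit].

Definition nonunits_sq : set O :=
  ideal_gen [set z | exists x y, [/\ nonunits x, nonunits y & z = x * y]].

(* For functions vanishing at a, the gradient at a is the class in m / m^2. *)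
Definition gradients_free (I : finType) (u : I -> O) : Prop :=
  forall c : I -> K, nonunits_sq (\sum_i c i *: u i) -> forall i, c i = 0.

(* Elements of (m / m^2)^*, written as functionals on O = K + m. *)
Definition tangent (v : {linear O -> K^o}) : Prop :=
  v 1 = 0 /\ forall z, nonunits_sq z -> v z = 0.

(* n is the dimension of O wherever this is used, so that y is a regular
   system of parameters. *)
Definition coordinates (n : nat) (y : 'I_n -> O) : Prop :=
  (forall j, nonunits (y j)) /\ ideal_gen (range y) = nonunits.

(* The components through a are given by the generators of their ideals. *)
Definition snc (n t : nat) (e : 'I_t -> O) : Prop :=
  exists (y : 'I_n -> O) (s : 'I_t -> 'I_n),
    [/\ coordinates y, injective s &
        forall i, ideal_gen [set e i] = ideal_gen [set y (s i)]].

(* S = {f = 0} is transverse to every stratum E_J of E, i.e.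
   T_a S + T_a E_J = T_a Z. *)
Definition transverse (k t : nat) (f : 'I_k -> O) (e : 'I_t -> O) : Prop :=
  forall (J : {set 'I_t}) (v : {linear O -> K^o}), tangent v ->
  exists v1 v2 : {linear O -> K^o},
    [/\ tangent v1 /\ (forall i, v1 (f i) = 0),
        tangent v2 /\ (forall j, j \in J -> v2 (e j) = 0) &
        forall z, v z = v1 z + v2 z].

(* O is the local ring at the point a of a scheme cut out in affine
   (n + c)-space by c equations with independent differentials at a. *)
Definition smooth_algebraic_germ (n : nat) : Prop :=
  exists (c : nat) (g : 'I_c -> {mpoly K[n + c]}) (a : 'I_(n + c) -> K)
         (phi : {lrmorphism {mpoly K[n + c]} -> O}),
  [/\ forall i, (g i).@[a] = 0,
      \rank (\matrix_(i < c, j < n + c) ((g i)^`M(j)).@[a]) = c,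
      forall P, (phi P \is a GRing.unit) = (P.@[a] != 0),
      forall z, exists P Q, Q.@[a] != 0 /\ z * phi Q = phi P &
      forall P, phi P = 0 <->
        exists (Q : {mpoly K[n + c]}) (u : 'I_c -> {mpoly K[n + c]}),
          Q.@[a] != 0 /\ Q * P = \sum_i u i * g i].

(* Absolute convergence of the power series with coefficients b on some
   polydisc around 0. *)
Definition convergent (R : realType) (n : nat) (b : 'X_{1..n} -> R[i]) : Prop :=
  exists rho M : R, 0 < rho /\
    forall d : nat,
      \sum_(m : 'X_{1..n < d}) ComplexField.Normc.normc (b m) * rho ^+ mdeg m <= M.

(* K is identified with the field of complex numbers by iota, and O with the
   ring of convergent power series in n variables by the map coef sending an
   element to its family of Taylor coefficients. *)
Definition smooth_analytic_germ (n : nat) : Prop :=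
  exists (R : realType) (iota : {rmorphism K -> R[i]})
         (coef : O -> 'X_{1..n} -> R[i]),
  [/\ bijective iota,
      injective coef /\ (forall b, convergent b <-> exists z, coef z = b),
      forall (c : K) z m, coef (c *: z) m = iota c * coef z m,
      forall z w m, coef (z + w) m = coef z m + coef w m &
      forall z w m, coef (z * w) m =
        \sum_(h : 'X_{1..n < (mdeg m).+1, (mdeg m).+1} | m == (h.1 + h.2)%MM)
           coef z h.1 * coef w h.2].

Definition smooth_germ (n : nat) : Prop :=
  smooth_algebraic_germ n \/ smooth_analytic_germ n.

Section Action.
Variables (gT : finGroupType) (act : gT -> {lrmorphism O -> O}).

Definition group_action : Prop :=
  (forall z, act 1%g z = z) /\
  (forall g h z, act (g * h)%g z = act g (act h z)).

Definition G_invariant (I : set O) : Prop := forall g, act g @` I = I.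

Definition splits (f : O) : Prop :=
  exists f1 f2 : O,
    [/\ f = f1 * f2, nonunits f1 /\ nonunits f2,
        G_invariant (ideal_gen [set f1]) & G_invariant (ideal_gen [set f2])].

Definition ideal_stab (f : O) : {set gT} :=
  finset (fun g => `[< act g @` ideal_gen [set f] = ideal_gen [set f] >]).

End Action.

End LocalAlgebra.

(* eps p plays the role of exp (2 i pi / p). *)
Definition compatible_roots (K : closedFieldType) (eps : nat -> K) : Prop :=
  (forall p, (0 < p)%N -> p.-primitive_root (eps p)) /\
  (forall p q, (0 < p)%N -> (0 < q)%N -> eps (p * q)%N ^+ q = eps p).

Fixpoint subgroup_chain (gT : finGroupType) (H : {set gT}) (x : nat -> gT)
    (i : nat) : {set gT} :=
  if i is i'.+1 then <<subgroup_chain H x i' :|: <[x i']> >>%g else H.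

Definition least_power_in (gT : finGroupType) (H : {set gT}) (x : gT)
    (q : nat) : Prop :=
  [/\ (0 < q)%N, (x ^+ q)%g \in H &
      forall q', (0 < q')%N -> (x ^+ q')%g \in H -> (q <= q')%N].

(* The tuple (d_0, ..., d_(s-1)), d_i < q_i, with lexicographic rank j,
   for j < q_0 * ... * q_(s-1). *)
Definition digits (q : nat -> nat) (s j : nat) : seq nat :=
  mkseq (fun i => (j %/ \prod_(i.+1 <= i' < s) q i') %% q i)%N s.

Definition crossing_coef (K : closedFieldType) (eps : nat -> K)
    (p q : nat -> nat) (gamma : nat -> seq nat -> nat) (s : nat)
    (m l : seq nat) : K :=
  \prod_(i < s) (eps (p i) ^+ (nth 0 m i * gamma i (take i l))%N *
                 eps (q i) ^+ (nth 0 m i * nth 0 l i)%N).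

(* Main.v *)
Require Import Defs.
From HB Require Import structures.
From mathcomp Require Import all_boot all_order all_algebra all_fingroup all_solvable.
From mathcomp Require Import boolp classical_sets reals complex mpoly.
From mathcomp Require Import ring lra zify.

Set Implicit Arguments.
Unset Strict Implicit.
Unset Printing Implicit Defensive.

Import Order.TTheory GRing.Theory Num.Theory.

Local Open Scope ring_scope.
Local Open Scope classical_set_scope.


(** In the local ring O of Z at a, with maximal ideal m, the quotient m / m^2 has
    dimension n and every element of m outside m^2 is prime.  For analytic germs
    and for localizations of polynomial algebras modulo equations with independent
    differentials, both facts are read off Taylor expansions: after a formal change
    of coordinates an ideal generated by elements with independent gradients is
    generated by variables, hence prime modulo high powers of m, and it is closed
    in the m-adic topology (by Krull's theorem in the algebraic case, by an
    estimate for division by a series of order at most one in the analytic case).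

    Hence G permutes the ideals (f_j), transitively since I does not split.
    Averaging over the stabilizer H of (f_1) makes f_1 an H-eigenvector F.  Climbing
    the tower H = H_0, H_1, ..., H_r = G, each eigenvector of H_(i-1) is decomposed
    into q_i eigenvectors of H_i; at the top F becomes the sum of k eigenvectors y_l
    of G, and applying coset representatives of G / H turns the y_l into generators
    of the ideals (f_j), with the characters of the y_l as coefficients.  The
    gradients of the f_j being independent, so are those of the y_l.  The latter are
    completed by semi-invariant equations of E and by further eigenvectors to a
    basis of m / m^2, hence to coordinates by Nakayama's lemma. *)

(** * Order of vanishing and formal changes of coordinates *)

(** The inverse of a polynomial change of coordinates is in general a power series. Only an inverse
    modulo a given order is constructed, and primality reads: if a product lies in the ideal modulo
    order [d + d], one factor lies in it modulo order [d]. Which factor it is may depend on [d], but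
    if each factor failed at some order, both would fail at the larger one. The exponents [beta]
    come from the index of [H]. Since [G] is abelian and [G / H] has order [k], every [g ^+ k] lies
    in [H], and [H] acts on all the y_l by the single character of F. Hence all entries of a row of
    the coefficient matrix have the same [k]-th power, and dividing the row by its first entry
    leaves powers of [eps k]. No determinant of the matrix of characters is computed: [k]
    independent gradients are combinations of [k] gradients, so the latter are independent too. That
    the equations of [E] are independent of the y_l is transversality in dual form. All [r]
    generators of [G] are kept, so [s] is [r]; a generator that already lies in the preceding
    subgroup has [q i = 1] and contributes a trivial factor. *)

Section OrderOfVanishing.
Variables (K : fieldType) (n : nat).
Implicit Types (p q : {mpoly K[n]}) (d e : nat) (m : 'X_{1..n}).

Definition ord_ge d p : Prop := forall m, (mdeg m < d)%N -> p@_m = 0.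

Lemma mnm_ind (P : 'X_{1..n} -> Prop) :
  P 0%MM -> (forall m i, P m -> P (m + U_(i))%MM) -> forall m, P m.
Proof.
move=> P0 PS m; have [d] := ubnP (mdeg m); elim: d m => // d IH m le_md.
have [->//|/eqP/mnmP m_neq0] := eqVneq m 0%MM.
have /existsP[i mi] : [exists i, m i != 0%N].
  rewrite -negb_forall; apply/forallP => m0.
  by apply: m_neq0 => i; rewrite mnm0E; apply/eqP.
have lem : (U_(i) <= m)%MM by rewrite lep1mP.
rewrite -(submK lem); apply/PS/IH.
by rewrite -(submK lem) mdegD mdeg1 addn1 ltnS in le_md.
Qed.

Lemma ord_ge0 d : ord_ge d 0.
Proof. by move=> m _; rewrite mcoeff0. Qed.

Lemma ord_geD d p q : ord_ge d p -> ord_ge d q -> ord_ge d (p + q).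
Proof. by move=> hp hq m lt_md; rewrite mcoeffD hp ?hq ?addr0. Qed.

Lemma ord_geN d p : ord_ge d p -> ord_ge d (- p).
Proof. by move=> hp m lt_md; rewrite mcoeffN hp ?oppr0. Qed.

Lemma ord_geB d p q : ord_ge d p -> ord_ge d q -> ord_ge d (p - q).
Proof. by move=> hp /ord_geN; apply: ord_geD. Qed.

Lemma ord_geZ d c p : ord_ge d p -> ord_ge d (c *: p).
Proof. by move=> hp m lt_md; rewrite mcoeffZ hp ?mulr0. Qed.

Lemma ord_geW d e p : (d <= e)%N -> ord_ge e p -> ord_ge d p.
Proof. by move=> le_de hp m lt_md; apply/hp/(leq_trans lt_md). Qed.

Lemma ord_ge_sum d (I : Type) (r : seq I) (P : pred I) (F : I -> {mpoly K[n]}) :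
  (forall i, P i -> ord_ge d (F i)) -> ord_ge d (\sum_(i <- r | P i) F i).
Proof.
by move=> hF; apply: big_ind => //; [apply: ord_ge0 | apply: ord_geD].
Qed.

Lemma ord_geM d e p q : ord_ge d p -> ord_ge e q -> ord_ge (d + e) (p * q).
Proof.
move=> hp hq m lt_m; rewrite mcoeffM big1 // => k /eqP Em.
case: (ltnP (mdeg k.1) d) => [/hp->|le_d]; first by rewrite mul0r.
rewrite hq ?mulr0 //; rewrite Em mdegD in lt_m.
by rewrite -(ltn_add2l d); apply: leq_ltn_trans lt_m; rewrite leq_add2r.
Qed.

Lemma ord_geMr d p q : ord_ge d q -> ord_ge d (p * q).
Proof. by rewrite -[d in X in _ -> X]add0n; apply: ord_geM. Qed.

Lemma ord_geMl d p q : ord_ge d p -> ord_ge d (p * q).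
Proof. by rewrite mulrC; apply: ord_geMr. Qed.

Lemma ord_geX m : ord_ge (mdeg m) 'X_[m].
Proof.
by move=> m' lt_m'; rewrite mcoeffX; case: eqP lt_m' => // ->; rewrite ltnn.
Qed.

Lemma ord_geXU i : ord_ge 1 'X_i.
Proof. by rewrite -(mdeg1 i); apply: ord_geX. Qed.

Lemma ord_ge1P p : ord_ge 1 p <-> p@_0 = 0.
Proof.
split=> [|p0 m]; first by apply; rewrite mdeg0.
by rewrite ltnS leqn0 mdeg_eq0 => /eqP ->.
Qed.

(** Compatibility of the monomial order with addition: among the pairs of monomials that contribute
    to a product at the sum of the two lowest ones, only the pair of these two survives. *)
Lemma addm_le_eq m1 m2 m1' m2' :
  (m1 <= m1')%O -> (m2 <= m2')%O -> (m1 + m2 = m1' + m2')%MM ->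
  m1 = m1' /\ m2 = m2'.
Proof.
move=> le1 le2 E; have E1 : m1 = m1'.
  apply/le_anti; rewrite le1 /= leNgt; apply/negP => lt1.
  by have := ltmc_le_add lt1 le2; rewrite E ltxx.
by split=> //; move: E; rewrite E1 => /addmI.
Qed.

(* The lowest monomial of a product is the product of the lowest monomials. *)
Lemma ord_ge_prime d e p q :
  ord_ge (d + e) (p * q) -> ord_ge d p \/ ord_ge e q.
Proof.
move=> hpq; have [->|p0] := eqVneq p 0; first by left; apply: ord_ge0.
have [->|q0] := eqVneq q 0; first by right; apply: ord_ge0.
case: (leqP d (mdeg (mlast p))) => [le_d|lt_d].
  left=> m lt_md; apply: mcoeff_lt_mlast; apply: lt_mdeg_ltmc.
  exact: leq_trans lt_md le_d.
case: (leqP e (mdeg (mlast q))) => [le_e|lt_e].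
  right=> m lt_me; apply: mcoeff_lt_mlast; apply: lt_mdeg_ltmc.
  exact: leq_trans lt_me le_e.
have lt_de : (mdeg (mlast p + mlast q) < d + e)%N.
  by rewrite mdegD -addSn leq_add // ltnW.
(* The coefficient at the sum of the two lowest monomials would vanish, yet it is a product of two
   nonzero coefficients. *)
move: (hpq _ lt_de) => {hpq}.
pose M := mdeg (mlast p + mlast q).
have pl : (mdeg (mlast p) < M.+1)%N by rewrite ltnS /M mdegD leq_addr.
have ql : (mdeg (mlast q) < M.+1)%N by rewrite ltnS /M mdegD leq_addl.
rewrite mcoeffM (bigD1 (BMultinom pl, BMultinom ql)) //= big1 ?addr0.
  move/eqP; rewrite mulf_eq0 !mcoeff_eq0.
  by rewrite !mlast_supp.
case=> [a b] /andP[/eqP /= Eab nab].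
have [/mcoeff_lt_mlast->|le_pa] := ltP (a : 'X_{1..n}) (mlast p).
  by rewrite mul0r.
have [/mcoeff_lt_mlast->|le_qb] := ltP (b : 'X_{1..n}) (mlast q).
  by rewrite mulr0.
have [Ea Eb] := addm_le_eq le_pa le_qb Eab.
case/negP: nab; apply/eqP; congr pair; exact/val_inj/esym.
Qed.

End OrderOfVanishing.

(** * Substitutions of polynomials and their inverses modulo a given order *)

Section Substitution.
Variables (K : fieldType).

Lemma mpoly_lrmorphism_eq n (A : comAlgType K)
    (f g : {lrmorphism {mpoly K[n]} -> A}) :
  (forall i, f 'X_i = g 'X_i) -> f =1 g.
Proof.
move=> fgX p; rewrite (mpolyE p) !raddf_sum; apply: eq_bigr => m _.
rewrite /= !linearZ; congr (_ *: _); elim/mnm_ind: m => [|m i IH].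
  by rewrite mpolyX0 !rmorph1.
by rewrite mpolyXD !rmorphM /= IH fgX.
Qed.

Definition psubst n k (w : 'I_n -> {mpoly K[k]}) : {mpoly K[n]} -> {mpoly K[k]} :=
  comp_mpoly [tuple w i | i < n].

HB.instance Definition _ n k (w : 'I_n -> {mpoly K[k]}) :=
  GRing.LRMorphism.copy (psubst w) (comp_mpoly [tuple w i | i < n]).

Lemma psubstX n k (w : 'I_n -> {mpoly K[k]}) i : psubst w 'X_i = w i.
Proof. by rewrite /psubst comp_mpolyXU -tnth_nth tnth_mktuple. Qed.

Lemma psubstZ n k (w : 'I_n -> {mpoly K[k]}) c p :
  psubst w (c *: p) = c *: psubst w p.
Proof. exact: comp_mpolyZ. Qed.

Lemma psubstB n k (w : 'I_n -> {mpoly K[k]}) p q :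
  psubst w (p - q) = psubst w p - psubst w q.
Proof. exact: comp_mpolyB. Qed.

Lemma psubstD n k (w : 'I_n -> {mpoly K[k]}) p q :
  psubst w (p + q) = psubst w p + psubst w q.
Proof. exact: comp_mpolyD. Qed.

Lemma psubst0 n k (w : 'I_n -> {mpoly K[k]}) : psubst w 0 = 0.
Proof. exact: comp_mpoly0. Qed.

Lemma psubst1 n k (w : 'I_n -> {mpoly K[k]}) : psubst w 1 = 1.
Proof. exact: comp_mpoly1. Qed.

Lemma psubstM n k (w : 'I_n -> {mpoly K[k]}) p q :
  psubst w (p * q) = psubst w p * psubst w q.
Proof. exact: rmorphM. Qed.

Lemma psubst_sum n k (w : 'I_n -> {mpoly K[k]}) (I : Type) (r : seq I)
    (P : pred I) (F : I -> {mpoly K[n]}) :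
  psubst w (\sum_(i <- r | P i) F i) = \sum_(i <- r | P i) psubst w (F i).
Proof. exact: raddf_sum. Qed.

Lemma psubst_id n (p : {mpoly K[n]}) : psubst (fun i => 'X_i) p = p.
Proof. exact: comp_mpoly_id. Qed.

Lemma psubstE n k (w : 'I_n -> {mpoly K[k]}) p :
  psubst w p = \sum_(m <- msupp p) p@_m *: psubst w 'X_[m].
Proof. exact: comp_mpolyEX. Qed.

Lemma psubstC n k (w : 'I_n -> {mpoly K[k]}) (c : K) :
  psubst w c%:MP = c%:MP.
Proof. exact: comp_mpolyC. Qed.

Lemma psubst_comp n k l (w : 'I_n -> {mpoly K[k]}) (v : 'I_k -> {mpoly K[l]}) p :
  psubst v (psubst w p) = psubst (fun i => psubst v (w i)) p.
Proof.
apply: (@mpoly_lrmorphism_eq _ _ (psubst v \o psubst w)) => i /=.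
by rewrite !psubstX.
Qed.

Lemma ord_ge_psubst n k (w : 'I_n -> {mpoly K[k]}) d p :
  (forall i, ord_ge 1 (w i)) -> ord_ge d p -> ord_ge d (psubst w p).
Proof.
move=> w1 hp; rewrite psubstE big_seq.
apply: ord_ge_sum => m; rewrite mcoeff_msupp => pm.
apply/ord_geZ/(@ord_geW _ _ _ (mdeg m)); last first.
  elim/mnm_ind: m {pm} => [|m i IH]; first by rewrite mdeg0.
  by rewrite mpolyXD rmorphM mdegD mdeg1; apply: ord_geM => //=; rewrite psubstX.
by rewrite leqNgt; apply: contra pm => /hp ->.
Qed.

Lemma psubst_congr n k (w v : 'I_n -> {mpoly K[k]}) d p :
  (forall i, ord_ge d (w i - v i)) -> ord_ge d (psubst w p - psubst v p).
Proof.
move=> wv; rewrite !(psubstE _ p) -sumrB; apply: ord_ge_sum => m _.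
rewrite -scalerBr; apply: ord_geZ.
elim/mnm_ind: m => [|m i IH].
  by rewrite mpolyX0 !rmorph1 subrr; apply: ord_ge0.
rewrite mpolyXD !rmorphM /= !psubstX.
set a := psubst w _ in IH *; set b := psubst v _ in IH *.
have -> : a * w i - b * v i = (a - b) * w i + b * (w i - v i).
  by rewrite mulrBl mulrBr addrA subrK.
by apply: ord_geD; [apply: ord_geMl | apply: ord_geMr].
Qed.

(** Substitutions with the same linear part agree on leading forms, which gains one order. This gain
    drives the successive approximation below. *)
Lemma psubst_congr_lead n k (w v : 'I_n -> {mpoly K[k]}) d p :
  (forall i, ord_ge 1 (w i)) -> (forall i, ord_ge 1 (v i)) ->
  (forall i, ord_ge 2 (w i - v i)) ->
  ord_ge d p -> ord_ge d.+1 (psubst w p - psubst v p).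
Proof.
move=> w1 v1 wv hp; rewrite !(psubstE _ p) -sumrB big_seq.
apply: ord_ge_sum => m; rewrite mcoeff_msupp => pm.
rewrite -scalerBr; apply/ord_geZ/(@ord_geW _ _ _ (mdeg m).+1).
  by rewrite ltnS leqNgt; apply: contra pm => /hp ->.
elim/mnm_ind: m {pm} => [|m i IH].
  by rewrite mpolyX0 !rmorph1 subrr; apply: ord_ge0.
have vm : ord_ge (mdeg m) (psubst v 'X_[m]).
  by apply: ord_ge_psubst => //; apply: ord_geX.
rewrite mpolyXD !rmorphM /= !psubstX mdegD mdeg1.
set a := psubst w _ in IH *; set b := psubst v _ in IH vm *.
have -> : a * w i - b * v i = (a - b) * w i + b * (w i - v i).
  by rewrite mulrBl mulrBr addrA subrK.
apply: ord_geD; first by rewrite -addSn; apply: ord_geM.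
by rewrite -addnS; apply: ord_geM.
Qed.

Lemma linear_part n (p : {mpoly K[n]}) :
  ord_ge 2 (p - (p@_0)%:MP - \sum_i p@_U_(i) *: 'X_i).
Proof.
move=> m; rewrite ltnS !mcoeffB mcoeffC raddf_sum /=.
have -> : \sum_i (p@_U_(i) *: 'X_i)@_m = \sum_i p@_U_(i) * (U_(i)%MM == m)%:R.
  by apply: eq_bigr => i _; rewrite mcoeffZ mcoeffX.
rewrite leq_eqVlt => /predU1P[/eqP/mdeg1P[i /eqP ->]|].
  rewrite (bigD1 i) //= big1 => [|j ne_ji]; last first.
    by rewrite eq_mnm1 (negPf ne_ji) mulr0.
  by rewrite mnm1_eq0 eqxx mulr0 mulr1 subr0 addr0 subrr.
rewrite ltnS leqn0 mdeg_eq0 => /eqP ->.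
rewrite eqxx mulr1 subrr big1 ?subr0 // => i _.
by rewrite mnm1_eq0 mulr0.
Qed.

Definition jac n c (w : 'I_c -> {mpoly K[n]}) : 'M[K]_(c, n) :=
  \matrix_(i, j) (w i)@_U_(j).

(** The chain rule at the origin. *)
Lemma jac_psubst n c k (p : 'I_c -> {mpoly K[n]}) (w : 'I_n -> {mpoly K[k]}) :
  (forall i, ord_ge 1 (w i)) ->
  jac (fun i => psubst w (p i)) = jac p *m jac w.
Proof.
move=> w1; apply/matrixP => i j; rewrite !mxE.
have := ord_ge_psubst w1 (linear_part (p i)) => /(_ U_(j)%MM).
rewrite mdeg1 !psubstB => /(_ isT)/eqP.
rewrite /= !mcoeffB subr_eq0.
have -> : psubst w ((p i)@_0)%:MP = ((p i)@_0)%:MP by rewrite psubstC.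
rewrite mcoeffC mnm1_eq0 mulr0 subr0 => /eqP ->.
rewrite psubst_sum raddf_sum; apply: eq_bigr => l _.
by rewrite /= psubstZ mcoeffZ psubstX !mxE.
Qed.

(** Successive approximation: subtracting from [v i] its error [E] leaves the error
    [E - psubst w E], of one order more because [w] is tangent to the identity. *)
Lemma psubst_linv1 n (w : 'I_n -> {mpoly K[n]}) d :
  (forall i, ord_ge 2 (w i - 'X_i)) ->
  exists2 v : 'I_n -> {mpoly K[n]}, forall i, ord_ge 1 (v i) &
    forall i, ord_ge d (psubst w (v i) - 'X_i).
Proof.
move=> wX; have w1 i : ord_ge 1 (w i).
  rewrite -(subrK 'X_i (w i)); apply: ord_geD; last exact: ord_geXU.
  exact: ord_geW (wX i).
elim: d => [|d [v v1 IH]]; first by exists (fun i => 'X_i) => // i; apply: ord_geXU.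
exists (fun i => v i - (psubst w (v i) - 'X_i)) => i.
  apply: ord_geB; first exact: v1.
  by apply: ord_geB; [apply: ord_ge_psubst | apply: ord_geXU].
have := psubst_congr_lead w1 (@ord_geXU _ _) wX (IH i).
rewrite psubst_id; set E := psubst w (v i) - 'X_i => /ord_geN.
have -> : psubst w (v i - E) - 'X_i = E - psubst w E by rewrite psubstB addrAC.
by rewrite opprB.
Qed.

(** Composition with the inverse [l] of the linear part reduces to a substitution tangent to the
    identity. *)
Lemma psubst_linv n (w : 'I_n -> {mpoly K[n]}) d :
  (forall i, ord_ge 1 (w i)) -> jac w \in unitmx ->
  exists2 v : 'I_n -> {mpoly K[n]}, forall i, ord_ge 1 (v i) &
    forall i, ord_ge d (psubst w (v i) - 'X_i).
Proof.
move=> w1 wU; pose l i : {mpoly K[n]} := \sum_j (invmx (jac w)) i j *: 'X_j.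
have l1 i : ord_ge 1 (l i).
  by apply: ord_ge_sum => j _; apply/ord_geZ/ord_geXU.
have jl : jac l = invmx (jac w).
  apply/matrixP => i j; rewrite !mxE raddf_sum /= (bigD1 j) //= big1 => [|k ne_kj].
    by rewrite mcoeffZ mcoeffXU eqxx mulr1 addr0.
  by rewrite mcoeffZ mcoeffXU (negPf ne_kj) mulr0.
have wl1 i : ord_ge 1 (psubst w (l i)) by apply: ord_ge_psubst.
have [|v v1 hv] := @psubst_linv1 n (fun i => psubst w (l i)) d.
  move=> i; have := linear_part (psubst w (l i)).
  rewrite (_ : (psubst w (l i))@_0 = 0) ?mpolyC0 ?subr0; last exact/ord_ge1P.
  suff -> : \sum_j (psubst w (l i))@_U_(j) *: 'X_j = 'X_i by [].
  have /matrixP/(_ i) jE := jac_psubst l w1; rewrite jl mulVmx // in jE.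
  rewrite (bigD1 i) //= big1 => [|j ne_ji]; have := jE.
    by move=> /(_ i); rewrite !mxE eqxx => ->; rewrite scale1r addr0.
  by move=> /(_ j); rewrite !mxE eq_sym (negPf ne_ji) => ->; rewrite scale0r.
exists (fun i => psubst l (v i)) => i; first exact: ord_ge_psubst.
by rewrite psubst_comp.
Qed.

Lemma psubst_inv n (w : 'I_n -> {mpoly K[n]}) d :
  (forall i, ord_ge 1 (w i)) -> jac w \in unitmx ->
  exists v : 'I_n -> {mpoly K[n]}, [/\ forall i, ord_ge 1 (v i),
    forall i, ord_ge d (psubst w (v i) - 'X_i) &
    forall i, ord_ge d (psubst v (w i) - 'X_i)].
Proof.
(* Two extra orders make the congruence determine linear coefficients even for [d = 0]. By the chain
   rule the Jacobian of [v] is then invertible, so [v] has a left inverse [u] in turn. *)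
move=> w1 wU; have [v v1 vw] := psubst_linv d.+2 w1 wU.
have vU : jac v \in unitmx.
  suff : jac v *m jac w = 1%:M by move/mulmx1_unit=> [].
  rewrite -jac_psubst //; apply/matrixP => i j; rewrite !mxE.
  have := vw i U_(j)%MM; rewrite mdeg1 => /(_ isT)/eqP.
  by rewrite mcoeffB subr_eq0 mcoeffXU => /eqP.
have [u u1 uv] := psubst_linv d.+2 v1 vU.
have le_d : (d <= d.+2)%N by rewrite !leqW.
exists v; split=> // i; first exact: ord_geW le_d (vw i).
apply: (ord_geW le_d).
(* Modulo order d.+2: u = u o (v o w) = (u o v) o w = w. *)
have uw : ord_ge d.+2 (w i - u i).
  have := ord_ge_psubst w1 (uv i); rewrite psubstB psubst_comp psubstX.
  move/ord_geN; rewrite opprB => E.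
  have := ord_geD E (psubst_congr (u i) vw).
  by rewrite psubst_id subrKA.
have := ord_geD (ord_ge_psubst v1 uw) (uv i).
by rewrite psubstB subrKA.
Qed.

End Substitution.

(** * Primality, modulo a given order, of ideals generated by independent elements *)

Section PolyPrime.
Variables (K : fieldType) (n : nat).
Implicit Types (p q : {mpoly K[n]}).

(** The ideal of the variables in [C] is the kernel of setting them to zero; the image is again made
    of polynomials, where orders add up. *)
Lemma psubst_kill (C : pred 'I_n) p :
  exists h : 'I_n -> {mpoly K[n]},
    p - psubst (fun i => if C i then 0 else 'X_i) p = \sum_(i | C i) h i * 'X_i.
Proof.
set k := psubst _; elim/mpolyind: p => [|c m p _ _ [h hp]].
  by exists (fun=> 0); rewrite /k psubst0 subr0 big1 // => i _; rewrite mul0r.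
have [g hg] : exists g : 'I_n -> {mpoly K[n]},
    'X_[m] - k 'X_[m] = \sum_(i | C i) g i * 'X_i.
  elim/mnm_ind: m => [|m j [g hg]].
    exists (fun=> 0); rewrite /k mpolyX0 psubst1 subrr big1 // => i _.
    by rewrite mul0r.
  exists (fun i => g i * k 'X_j + 'X_[m] *+ (C j && (i == j))).
  have -> : \sum_(i | C i) (g i * k 'X_j + 'X_[m] *+ (C j && (i == j))) * 'X_i
    = ('X_[m] - k 'X_[m]) * k 'X_j + 'X_[m] * 'X_j *+ C j.
    under eq_bigr do rewrite mulrDl; rewrite big_split /= hg mulr_suml.
    congr (_ + _); first by apply: eq_bigr => i _; rewrite mulrAC.
    case: (boolP (C j)) => Cj /=; last by rewrite big1 // => i _; rewrite mul0r.
    rewrite (bigD1 j) //= eqxx mulr1n big1 ?addr0 // => i /andP[_ /negPf->].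
    by rewrite mul0r.
  have -> : k 'X_[m + U_(j)] = k 'X_[m] * k 'X_j by rewrite mpolyXD /k psubstM.
  rewrite mpolyXD mulrBl.
  have -> : k 'X_j = if C j then 0 else 'X_j by apply: psubstX.
  by case: (C j); rewrite ?mulr0 ?subr0 ?add0r ?addr0.
exists (fun i => c *: g i + h i).
have -> : k (c *: 'X_[m] + p) = c *: k 'X_[m] + k p.
  by rewrite /k psubstD psubstZ.
rewrite opprD addrACA hp -scalerBr hg scaler_sumr -big_split.
by apply: eq_bigr => i _; rewrite mulrDl scalerAl.
Qed.

(* Modulo order d + d, the w i can be taken as the variables. *)
Lemma coordinate_ideal_prime (w : 'I_n -> {mpoly K[n]}) (C : pred 'I_n) d p q :
  (forall i, ord_ge 1 (w i)) -> jac w \in unitmx ->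
  (exists h, ord_ge (d + d) (p * q - \sum_(i | C i) h i * w i)) ->
  (exists h, ord_ge d (p - \sum_(i | C i) h i * w i)) \/
  (exists h, ord_ge d (q - \sum_(i | C i) h i * w i)).
Proof.
move=> w1 wU [h0 pqE]; have [v [v1 vw wv]] := psubst_inv (d + d) w1 wU.
pose k : {mpoly K[n]} -> {mpoly K[n]} := psubst (fun i => if C i then 0 else 'X_i).
have k1 i : ord_ge 1 (if C i then 0 else 'X_i : {mpoly K[n]}).
  by case: ifP => _; [apply: ord_ge0 | apply: ord_geXU].
have back r : ord_ge d (k (psubst v r)) ->
    exists h, ord_ge d (r - \sum_(i | C i) h i * w i).
  move=> kr; have [h hE] := psubst_kill C (psubst v r).
  exists (fun i => psubst w (h i)).
  have := ord_ge_psubst w1 kr; rewrite /k.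
  set kk := psubst (fun i => if C i then _ else _) _ in hE *.
  have -> : kk = psubst v r - \sum_(i | C i) h i * 'X_i by rewrite -hE opprB addrC subrK.
  rewrite psubstB [psubst w (\sum_(i | _) _)]psubst_sum.
  have -> : \sum_(i | C i) psubst w (h i * 'X_i) = \sum_(i | C i) psubst w (h i) * w i.
    by apply: eq_bigr => i _; rewrite psubstM psubstX.
  rewrite psubst_comp; have := psubst_congr r vw; rewrite psubst_id.
  move=> /(ord_geW (leq_addl d d))/ord_geN /ord_geD E /E.
  by rewrite opprB addrA subrK.
(* In the new coordinates, with the variables of [C] set to zero, the product has order [d + d], so
   one of the factors has order [d]. *)
suff : ord_ge (d + d) (k (psubst v p) * k (psubst v q)).
  by case/ord_ge_prime => /back; [left | right].
rewrite -!psubstM; move: (ord_ge_psubst k1 (ord_ge_psubst v1 pqE)).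
rewrite !psubstB [psubst v (\sum_(i | _) _)]psubst_sum.
rewrite [psubst _ (\sum_(i | _) _)]psubst_sum.
set S := \sum_(i | C i) _ => E; rewrite -[psubst _ _](subrK S).
apply: (ord_geD E); apply: ord_ge_sum => i Ci; rewrite !psubstM; apply: ord_geMr.
move: (ord_ge_psubst k1 (wv i)).
by rewrite psubstB psubstX Ci subr0.
Qed.

(** The elements are completed to a coordinate system. Changing generators by [invmx U] makes the
    Jacobian of the [w'] the first [c] rows of the invertible matrix [V], and the linear forms given
    by the other rows of [V] are added. *)
Lemma independent_ideal_prime c (w : 'I_c -> {mpoly K[n]}) d p q :
  (forall i, ord_ge 1 (w i)) -> row_free (jac w) ->
  (exists h, ord_ge (d + d) (p * q - \sum_i h i * w i)) ->
  (exists h, ord_ge d (p - \sum_i h i * w i)) \/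
  (exists h, ord_ge d (q - \sum_i h i * w i)).
Proof.
move=> w1 wF.
pose U := col_ebase (jac w); pose V := row_ebase (jac w).
have UU : U \in unitmx by apply: col_ebase_unit.
have VU : V \in unitmx by apply: row_ebase_unit.
have le_cn : (c <= n)%N by rewrite -(eqP wF) rank_leq_col.
have jE : invmx U *m jac w = pid_mx c *m V.
  by rewrite -(mulmx_ebase (jac w)) -/U -/V (eqP wF) -!mulmxA mulKmx.
pose w' i := \sum_j (invmx U) i j *: w j.
have w'1 i : ord_ge 1 (w' i) by apply: ord_ge_sum => j _; apply: ord_geZ.
have jw' : jac w' = invmx U *m jac w.
  apply/matrixP => i j; rewrite !mxE raddf_sum; apply: eq_bigr => l _ /=.
  by rewrite mcoeffZ !mxE.
pose W (i : 'I_n) : {mpoly K[n]} :=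
  if insub (i : nat) is Some i' then w' i' else \sum_j V i j *: 'X_j.
have W1 i : ord_ge 1 (W i).
  rewrite /W; case: insubP => [u _ _ //|_].
  by apply: ord_ge_sum => j _; apply/ord_geZ/ord_geXU.
have jW : jac W = V.
  apply/matrixP => i j; rewrite mxE /W; case: insubP => [u _ iu|_].
    have /matrixP/(_ u j) := jw'; rewrite mxE => ->; rewrite jE mxE (bigD1 i) //=.
    rewrite mxE -iu eqxx ltn_ord mul1r big1 ?addr0 // => l ne_li.
    rewrite mxE iu eq_sym; case: eqP => [/val_inj E|_]; last by rewrite mul0r.
    by rewrite E eqxx in ne_li.
  rewrite raddf_sum /= (bigD1 j) //= big1 => [|l ne_lj].
    by rewrite mcoeffZ mcoeffXU eqxx mulr1 addr0.
  by rewrite mcoeffZ mcoeffXU (negPf ne_lj) mulr0.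
pose C (i : 'I_n) := (i < c)%N.
have WE (h : 'I_n -> {mpoly K[n]}) :
    \sum_(i | C i) h i * W i = \sum_(i < c) h (widen_ord le_cn i) * w' i.
  rewrite (big_ord_narrow le_cn); apply: eq_bigr => i _; congr (_ * _).
  rewrite /W; case: insubP => [u _ iu|/negP[]]; last exact: (ltn_ord i).
  by congr w'; apply: val_inj.
have w'E (h : 'I_c -> {mpoly K[n]}) :
    \sum_i h i * w' i = \sum_j (\sum_i (invmx U) i j *: h i) * w j.
  under eq_bigr do rewrite mulr_sumr.
  rewrite exchange_big; apply: eq_bigr => j _ /=; rewrite mulr_suml.
  by apply: eq_bigr => i _; rewrite -scalerAl scalerAr.
have wE (h : 'I_c -> {mpoly K[n]}) :
    \sum_j h j * w j = \sum_i (\sum_j U j i *: h j) * w' i.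
  rewrite w'E; apply: eq_bigr => j _; congr (_ * _).
  under [RHS]eq_bigr do rewrite scaler_sumr.
  rewrite exchange_big /= (bigD1 j) //= [X in _ + X]big1 ?addr0 => [|l ne_lj].
    have /matrixP/(_ j j) := mulmxV UU; rewrite !mxE eqxx mulr1n => E.
    rewrite -[LHS]scale1r -E scaler_suml; apply: eq_bigr => i _.
    by rewrite scalerA mulrC.
  have /matrixP/(_ l j) := mulmxV UU; rewrite !mxE (negPf ne_lj) mulr0n => E.
  rewrite -[RHS](scale0r (h l)) -E scaler_suml; apply: eq_bigr => i _.
  by rewrite scalerA mulrC.
have WC (r : {mpoly K[n]}) : (exists h, ord_ge d (r - \sum_(i | C i) h i * W i)) ->
    exists h, ord_ge d (r - \sum_i h i * w i).
  by case=> h; rewrite WE w'E => hr; eexists; apply: hr.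
case=> h hpq; have [||/WC|/WC] := @coordinate_ideal_prime W C d p q W1; [| |by left|by right].
  by rewrite jW.
exists (fun i : 'I_n => if insub (i : nat) is Some i' then \sum_j U j i' *: h j else 0).
rewrite WE; move: hpq; rewrite wE; congr (ord_ge _ (_ - _)).
apply: eq_bigr => i _; congr (_ * _); case: insubP => [u _ iu|/negP[]]; last exact: (ltn_ord i).
by rewrite (val_inj (iu : val u = val i)).
Qed.

End PolyPrime.

(** * Krull's intersection theorem *)

Section Noetherian.

(** The subsequence runs through minima of successive tails: [a N] is a position where [f] takes its
    least value from [N] on. *)
Lemma nondecreasing_subseq (f : nat -> nat) :
  exists2 phi : nat -> nat, {homo phi : i j / (i < j)%N} &
    forall i j, (i < j)%N -> (f (phi i) <= f (phi j))%N.
Proof.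
have /choice[a ha] (N : nat) :
    exists m, (N <= m)%N /\ forall m', (N <= m')%N -> (f m <= f m')%N.
  have ex : exists v, `[< exists2 m, (N <= m)%N & f m = v >].
    by exists (f N); apply/asboolP; exists N.
  case: (ex_minnP ex) => v /asboolP[m le_Nm <-] min_m.
  by exists m; split=> // m' le_Nm'; apply/min_m/asboolP; exists m'.
pose b k := iter k (fun N => (a N).+1) 0%N.
have b_homo : {homo (a \o b) : i j / (i < j)%N}.
  apply: homo_ltn => [|i /=]; first exact: ltn_trans.
  by have [le_b _] := ha (b i.+1); apply: leq_trans le_b.
exists (a \o b) => // i j /b_homo /= lt_ab.
have [_ min_i] := ha (b i); apply: min_i.
by have [le_b _] := ha (b i); apply/(leq_trans le_b)/ltnW.
Qed.

(** Subsequences are extracted for one exponent after another; the first two terms of the last one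
    already compare. *)
Lemma dickson n (s : nat -> 'X_{1..n}) :
  exists i j, (i < j)%N /\ (s i <= s j)%MM.
Proof.
suff [phi phi_homo le_phi] : exists2 phi : nat -> nat,
    {homo phi : i j / (i < j)%N} &
    forall c i j, c \in enum 'I_n -> (i < j)%N -> (s (phi i) c <= s (phi j) c)%N.
  exists (phi 0%N), (phi 1%N); split; first exact: phi_homo.
  by apply/mnm_lepP => c; apply: le_phi; rewrite ?mem_enum.
elim: (enum 'I_n) => [|c0 r [phi phi_homo le_phi]]; first by exists id.
have [psi psi_homo le_psi] := nondecreasing_subseq (fun k => s (phi k) c0).
exists (phi \o psi) => [i j lt_ij|c i j]; first exact/phi_homo/psi_homo.
rewrite inE => /predU1P[->|cr] lt_ij; first exact: le_psi.
exact/le_phi/psi_homo.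
Qed.

Definition is_ideal (A : comNzRingType) (I : set A) : Prop :=
  [/\ I 0, forall x y, I x -> I y -> I (x + y) & forall a x, I x -> I (a * x)].

(** One stationary step is asked of each chain. Applied to subchains this is the usual condition,
    and one step is what the arguments below consume. *)
Definition acc (A : comNzRingType) : Prop :=
  forall I : nat -> set A, (forall k, is_ideal (I k)) ->
    (forall k, I k `<=` I k.+1) -> exists k, I k.+1 `<=` I k.

Lemma idealB (A : comNzRingType) (I : set A) x y :
  is_ideal I -> I x -> I y -> I (x - y).
Proof. by case=> _ ID IM Ix Iy; apply: ID => //; rewrite -mulN1r; apply: IM. Qed.

Lemma idealMr (A : comNzRingType) (I : set A) a x :
  is_ideal I -> I x -> I (x * a).
Proof. by case=> _ _ IM; rewrite mulrC; apply: IM. Qed.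

(* Hilbert's basis theorem, by reduction of leading terms: the leading
   monomials of elements b_k of I_(k+1) \ I_k, chosen minimal, would
   contradict Dickson's lemma. *)
Lemma acc_mpoly (K : fieldType) n : acc {mpoly K[n]}.
Proof.
move=> I Iid Iinc; apply: contrapT => /forallNP noacc.
have Imono i j : (i <= j)%N -> I i `<=` I j.
  elim: j => [|j IH]; first by rewrite leqn0 => /eqP->.
  rewrite leq_eqVlt => /predU1P[->//|]; rewrite ltnS => /IH IHj.
  exact: subset_trans IHj (Iinc j).
have /choice[b hb] (k : nat) : exists b, [/\ I k.+1 b, ~ I k b &
    forall b', I k.+1 b' -> ~ I k b' -> (mlead b <= mlead b')%O].
  have [b0 Ib0 nIb0] : exists2 b, I k.+1 b & ~ I k b.
    apply: contrapT => h; apply: (noacc k) => b Ib; apply: contrapT => nIb.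
    by apply: h; exists b.
  move: {2}(mlead b0) (erefl (mlead b0)) => m; move: b0 Ib0 nIb0.
  elim/(@ltmwf n): m => m IH b0 Ib0 nIb0 Em; apply: contrapT => nmin; apply: nmin.
  have [[b' [Ib' nIb' lt_b']]|h] :=
      pselect (exists b', [/\ I k.+1 b', ~ I k b' & (mlead b' < m)%O]).
    exact: (IH _ lt_b' b').
  exists b0; split=> // b' Ib' nIb'; rewrite leNgt; apply/negP => lt_b'.
  by apply: h; exists b'; rewrite -Em.
have [i [j [lt_ij le_ij]]] := dickson (fun k => mlead (b k)).
have [Ibi nIbi _] := hb i; have [Ibj nIbj min_j] := hb j.
have b_neq0 k : b k != 0.
  by have [_ nIb _] := hb k; apply/eqP => b0; case: (Iid k) => I0 _ _; rewrite b0 in nIb.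
pose c := mleadc (b j) / mleadc (b i).
have c_neq0 : c * mleadc (b i) != 0 by rewrite divfK mleadc_eq0 ?b_neq0.
pose m := (mlead (b j) - mlead (b i))%MM.
(* As a multiple of [b i], [t] lies in [I j]. Subtracting it cancels the leading term of [b j] and
   keeps [r] outside [I j], against the minimality of [b j]. *)
pose t := c *: (b i * 'X_[m]); pose r := b j - t.
have tE k : t@_k = c * (b i * 'X_[m])@_k by rewrite mcoeffZ.
have It : I j t.
  rewrite /t -mul_mpolyC; case: (Iid j) => _ _ IM; apply: (IM); rewrite mulrC; apply: IM.
  exact: Imono lt_ij _ Ibi.
have Ir : I j.+1 r by apply: idealB => //; apply: Iinc.
have nIr : ~ I j r.
  move=> Ir'; apply: nIbj; rewrite -(subrK t (b j)).
  by case: (Iid j) => _ ID _; apply: ID.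
have r_neq0 : r != 0.
  by apply/eqP => r0; case: (Iid j) => I0 _ _; rewrite r0 in nIr.
suff : (mlead r < mlead (b j))%O by rewrite ltNge min_j.
have mE : (m + mlead (b i) = mlead (b j))%MM by rewrite submK.
have lt : mlead t = mlead (b j).
  have bX : mlead (b i * 'X_[m]) = mlead (b j).
    rewrite mleadM_proper mleadXm ?mcoeffX ?eqxx ?mulr1 ?mleadc_eq0 //.
    by rewrite addmC.
  by rewrite /t mleadZ_proper bX // -mE mcoeffMX.
rewrite lt_neqAle; apply/andP; split; last first.
  by apply: le_trans (mleadB_le _ _) _; rewrite lt joinxx.
apply: contraTneq (mlead_supp r_neq0) => ->.
rewrite mcoeff_msupp negbK mcoeffB tE -mE mcoeffMX /c mE divfK ?subrr //.
by rewrite mleadc_eq0.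
Qed.

(** An ideal of [O] is determined by its preimage in [A], since every element is a numerator up to a
    unit. *)
Lemma acc_localization (A : comNzRingType) (O : comUnitRingType)
    (phi : {rmorphism A -> O}) :
  (forall z, exists P Q, phi Q \is a GRing.unit /\ z * phi Q = phi P) ->
  acc A -> acc O.
Proof.
move=> frac accA I Iid Iinc.
have [k hk] : exists k, (fun k => phi @^-1` I k) k.+1 `<=` (fun k => phi @^-1` I k) k.
  apply: accA => k.
    case: (Iid k) => I0 ID IM; split=> [|x y|a x] /=; rewrite ?rmorph0 //.
      by rewrite rmorphD; apply: ID.
    by rewrite rmorphM; apply: IM.
  by move=> P; apply: Iinc.
exists k => z Iz; have [P [Q [uQ zQ]]] := frac z.
have := hk P; rewrite /= -zQ => h; rewrite -(mulrK uQ z) mulrC.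
case: (Iid k) => _ _ IM; apply/IM/h.
by case: (Iid k.+1) => _ _ IM'; rewrite mulrC; apply: IM'.
Qed.

(** Otherwise choice would produce a strictly increasing chain in [F]. *)
Lemma acc_maximal (A : comNzRingType) (F : set (set A)) :
  acc A -> (forall L, F L -> is_ideal L) -> F !=set0 ->
  exists2 L, F L & forall L', F L' -> L `<=` L' -> L' `<=` L.
Proof.
move=> accA Fid [L0 FL0]; apply: contrapT => nmax.
have /choice[g hg] (s : {L | F L}) :
    exists s' : {L | F L}, sval s `<=` sval s' /\ ~ sval s' `<=` sval s.
  apply: contrapT => h; apply: nmax; exists (sval s); first exact: svalP.
  move=> L' FL' LL'; apply: contrapT => nL'L; apply: h.
  by exists (exist _ L' FL').
pose I k := sval (iter k g (exist _ L0 FL0)).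
have [k hk] : exists k, I k.+1 `<=` I k.
  apply: accA => k; first exact/Fid/svalP.
  by have [] := hg (iter k g (exist _ L0 FL0)).
by have [_] := hg (iter k g (exist _ L0 FL0)); apply.
Qed.

(* An ideal L maximal among those that contain J and the x_i b but not b
   contains a power of each x_i: the chain of the (L : x_i^k) stops, and then
   b is not in L + (x_i^k). *)
Lemma krull (O : comUnitRingType) N (x : 'I_N -> O) (J : set O) (b : O) :
  acc O ->
  (forall z w : O, z \isn't a GRing.unit -> w \isn't a GRing.unit ->
     z + w \isn't a GRing.unit) ->
  (forall i, x i \isn't a GRing.unit) -> is_ideal J ->
  (forall d (L : set O), is_ideal L -> J `<=` L ->
     (forall m, (d <= mdeg m)%N -> L (mmap1 x m)) -> L b) ->
  J b.
Proof.
move=> accO nunitD xm Jid hb; apply: contrapT => nJb.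
have [J0 JD JM] := Jid.
have nunitM (a z : O) : z \isn't a GRing.unit -> a * z \isn't a GRing.unit.
  by apply: contra; rewrite unitrM => /andP[].
pose F (L : set O) :=
  [/\ is_ideal L, J `<=` L, forall i, L (x i * b) & ~ L b].
have [||L [Lid JL Lx nLb] maxL] := @acc_maximal O F accO.
- by move=> L [].
(* This is J + m b. If it contained [b], then [(1 - a) * b] would be in [J] with [1 - a] a unit. *)
- exists [set z | exists j a, [/\ J j, a \isn't a GRing.unit & z = j + a * b]].
  split.
  + split.
    * by exists 0, 0; rewrite unitr0 mul0r addr0.
    * move=> _ _ [j [a [Jj an ->]]] [j' [a' [Jj' an' ->]]].
      exists (j + j'), (a + a'); split; [exact: JD | exact: nunitD |].
      by rewrite mulrDl addrACA.
    * move=> c _ [j [a [Jj an ->]]]; exists (c * j), (c * a).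
      by split; [exact: JM | exact: nunitM | rewrite mulrDr mulrA].
  + by move=> j Jj; exists j, 0; rewrite unitr0 mul0r addr0.
  + by move=> i; exists 0, (x i); rewrite add0r.
  + case=> j [a [Jj an E]]; apply: nJb.
    have u1 : 1 - a \is a GRing.unit.
      apply: contraT => n1; have := nunitD _ _ n1 an.
      by rewrite subrK unitr1.
    rewrite -(mulKr u1 b); apply: JM.
    by rewrite mulrBl mul1r {1}E addrK.
have [L0 LD LM] := Lid.
have /choice[k hk] i : exists k, L (x i ^+ k).
  have [k hk] : exists k, (fun k => [set z | L (x i ^+ k * z)]) k.+1
      `<=` (fun k => [set z | L (x i ^+ k * z)]) k.
    apply: accO => k; last by move=> z /= Lz; rewrite exprS -mulrA; apply: LM.
    split=> /= [|z w Lz Lw|a z Lz]; first by rewrite mulr0.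
      by rewrite mulrDr; apply: LD.
    by rewrite mulrCA; apply: LM.
  exists k; pose L' := [set z | exists l a, L l /\ z = l + x i ^+ k * a].
  have L'id : is_ideal L'.
    split.
    - by exists 0, 0; rewrite mulr0 addr0.
    - move=> _ _ [l [a [Ll ->]]] [l' [a' [Ll' ->]]].
      by exists (l + l'), (a + a'); split; [exact: LD | rewrite mulrDr addrACA].
    - move=> c _ [l [a [Ll ->]]]; exists (c * l), (c * a).
      by split; [exact: LM | rewrite mulrDr mulrCA].
  have LL' : L `<=` L' by move=> l Ll; exists l, 0; rewrite mulr0 addr0.
  (* By maximality it is enough that [b] is not in [L']. If [b = l + x i ^+ k * a], multiplication
     by [x i] puts [x i ^+ k.+1 * a] in [L], hence [x i ^+ k * a] by stationarity, hence [b]. *)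
  apply: (maxL L') => //; last by exists 0, 1; rewrite add0r mulr1.
  split=> //; first exact: subset_trans LL'.
    by move=> j; apply: LL'.
  case=> l [a [Ll bE]]; apply: nLb; rewrite bE; apply: LD => //; apply: hk => /=.
  have -> : x i ^+ k.+1 * a = x i * b - x i * l.
    by rewrite bE mulrDr addrAC subrr add0r exprS mulrA.
  by apply: idealB => //; apply: LM.
(* Pigeonhole: a monomial of degree greater than the sum of the [k i] is divisible by some
   [x i ^+ k i]. *)
apply: nLb; apply: (hb (\sum_i k i).+1) => // m lt_m.
have [i lt_k] : exists i, (k i <= m i)%N.
  apply: contrapT => /forallNP h; move: lt_m; rewrite mdegE ltnNge leq_sum //.
  by move=> i _; rewrite leqNgt; apply/negP => /ltnW /h.
rewrite /mmap1 (bigD1 i) //= -(subnK lt_k) exprD -mulrA mulrCA.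
exact: idealMr.
Qed.

End Noetherian.

(** * Algebraic germs *)

Section Ideals.
Variables (K : closedFieldType) (O : comUnitAlgType K).
Implicit Types (A I : set O) (z w u : O).

Lemma ideal_sum I (T : Type) (r : seq T) (P : pred T) (F : T -> O) :
  is_ideal I -> (forall i, P i -> I (F i)) -> I (\sum_(i <- r | P i) F i).
Proof. by case=> I0 ID _ IF; apply: big_ind. Qed.

Lemma idealZ I (c : K) z : is_ideal I -> I z -> I (c *: z).
Proof. by case=> _ _ IM Iz; rewrite -mulr_algl; apply: IM. Qed.

Lemma sub_ideal_gen A : A `<=` ideal_gen A.
Proof.
by move=> z Az; exists 1%N, (fun=> 1), (fun=> z); rewrite big_ord1 mul1r.
Qed.

Lemma ideal_gen_min A I : is_ideal I -> A `<=` I -> ideal_gen A `<=` I.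
Proof.
move=> Iid AI _ [m [a [v [Av ->]]]]; apply: ideal_sum => // i _.
by case: (Iid) => _ _ IM; apply/IM/AI.
Qed.

Lemma ideal_gen_ideal A : is_ideal (ideal_gen A).
Proof.
split=> [|_ _ [m [a [v [Av ->]]]] [m' [a' [v' [Av' ->]]]]|c _ [m [a [v [Av ->]]]]].
- by exists 0%N, (fun=> 0), (fun=> 0); split=> [[]//|]; rewrite big_ord0.
- exists (m + m')%N, (fun i => match split i with inl j => a j | inr j => a' j end),
    (fun i => match split i with inl j => v j | inr j => v' j end).
  split=> [i|]; first by case: (split i).
  rewrite big_split_ord; congr (_ + _); apply: eq_bigr => i _.
    by rewrite (unsplitK (inl i)).
  by rewrite (unsplitK (inr i)).
- exists m, (fun i => c * a i), v; split=> //.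
  by rewrite mulr_sumr; apply: eq_bigr => i _; rewrite mulrA.
Qed.

Lemma ideal_gen1P u z : ideal_gen [set u] z <-> exists a, z = a * u.
Proof.
split=> [[m [a [v [Av ->]]]]|[a ->]].
  exists (\sum_i a i); rewrite mulr_suml; apply: eq_bigr => i _.
  by rewrite (Av i).
by have [_ _ IM] := ideal_gen_ideal [set u]; apply/IM/sub_ideal_gen.
Qed.

Lemma ideal_gen_rangeP (T : finType) (y : T -> O) z :
  ideal_gen (range y) z <-> exists a, z = \sum_i a i * y i.
Proof.
split=> [|[a ->]]; last first.
  apply: ideal_sum; first exact: ideal_gen_ideal.
  move=> i _; have [_ _ IM] := ideal_gen_ideal (range y).
  by apply/IM/sub_ideal_gen; exists i.
apply: (@ideal_gen_min _ [set z | exists a, z = \sum_i a i * y i]) z.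
  split=> [|_ _ [a ->] [b ->]|c _ [a ->]].
  - by exists (fun=> 0); rewrite big1 // => i _; rewrite mul0r.
  - exists (fun i => a i + b i); rewrite -big_split.
    by apply: eq_bigr => i _; rewrite mulrDl.
  - exists (fun i => c * a i); rewrite mulr_sumr.
    by apply: eq_bigr => i _; rewrite mulrA.
move=> _ [i _ <-]; exists (fun j => (j == i)%:R).
by rewrite (bigD1 i) //= eqxx mul1r big1 ?addr0 // => j /negPf->; rewrite mul0r.
Qed.

Lemma nonunitsM a z : nonunits z -> nonunits (a * z).
Proof. by apply: contra; rewrite unitrM => /andP[]. Qed.

Lemma nonunits_sq_ideal : is_ideal (@nonunits_sq K O).
Proof. exact: ideal_gen_ideal. Qed.

Lemma nonunits_sqM z w : nonunits z -> nonunits w -> nonunits_sq (z * w).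
Proof. by move=> nz nw; apply: sub_ideal_gen; exists z, w. Qed.

(** The residue field is [K] itself, so that characters and gradients have values in [K]. *)
Definition local_alg : Prop :=
  (forall z w, nonunits z -> nonunits w -> nonunits (z + w)) /\
  (forall z, exists c : K, nonunits (z - c%:A)).

Lemma nonunits_ideal : local_alg -> is_ideal (@nonunits K O).
Proof.
case=> nD _; split=> [|//|a z]; last exact: nonunitsM.
by rewrite /nonunits /= unitr0.
Qed.

Lemma nonunits_sq_sub : local_alg -> @nonunits_sq K O `<=` @nonunits K O.
Proof.
move=> /nonunits_ideal mid; apply: ideal_gen_min => // _ [z [w [nz nw ->]]].
exact: nonunitsM.
Qed.

(* What is used of smoothness: n generators of the maximal ideal m are independent
   modulo m^2, and the elements of m outside m^2 are prime. *)
Definition regular_germ (n : nat) : Prop :=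
  local_alg /\ forall y : 'I_n -> O, coordinates y ->
  gradients_free y /\
  forall u a b, nonunits u -> ~ nonunits_sq u -> (exists q, a * b = u * q) ->
    (exists q, a = u * q) \/ (exists q, b = u * q).

End Ideals.

Section AlgebraicGerm.
Variables (K : closedFieldType).

Section Translation.
Variables (n : nat) (a : 'I_n -> K).

Definition translate : {mpoly K[n]} -> {mpoly K[n]} :=
  psubst (fun i => 'X_i + (a i)%:MP).

HB.instance Definition _ := GRing.LRMorphism.copy translate
  (psubst (fun i => 'X_i + (a i)%:MP)).

Lemma translate_coef0 p : (translate p)@_0 = p.@[a].
Proof.
rewrite /translate psubstE raddf_sum /= mevalE; apply: eq_bigr => m _.
rewrite mcoeffZ; congr (_ * _); elim/mnm_ind: m => [|m i IH].
  rewrite mpolyX0 psubst1 mcoeff1 eqxx big1 // => i _.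
  by rewrite mnm0E expr0.
rewrite mpolyXD psubstM psubstX rmorphM /= IH mcoeffD mcoeffX mcoeffC mnm1_eq0.
rewrite eqxx add0r mulr1 [RHS](bigD1 i) //= [in LHS](bigD1 i) //=.
rewrite mnmDE mnm1E eqxx addn1 exprSr mulrAC; congr (_ * _).
apply: eq_bigr => j ne_ji; rewrite mnmDE mnm1E eq_sym (negPf ne_ji).
by rewrite addn0.
Qed.

Lemma mcoeffM_0 (p q : {mpoly K[n]}) : (p * q)@_0 = p@_0 * q@_0.
Proof. exact: rmorphM. Qed.

Lemma mcoeffM_U (p q : {mpoly K[n]}) j :
  (p * q)@_U_(j) = p@_0 * q@_U_(j) + p@_U_(j) * q@_0.
Proof.
have dE (r : {mpoly K[n]}) : r^`M(j)@_0 = r@_U_(j).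
  by rewrite mcoeff_deriv add0m mnm0E mulr1n.
by rewrite -!dE mderivM mcoeffD !rmorphM /= addrC.
Qed.

Lemma translate_coefU j p : (translate p)@_U_(j) = (p^`M(j)).@[a].
Proof.
rewrite /translate psubstE [in RHS](mpolyE p) (raddf_sum (mcoeff _)).
rewrite (raddf_sum (mderiv j)) (raddf_sum (meval a)) /=.
apply: eq_bigr => m _; rewrite mcoeffZ mderivZ mevalZ; congr (_ * _) => {p}.
elim/mnm_ind: m => [|m i IH].
  by rewrite mpolyX0 psubst1 mcoeff1 mnm1_eq0 -mpolyC1 mderivC meval0.
have XE : ('X_i^`M(j)).@[a] = (i == j)%:R.
  rewrite mderivX mnm1E mevalZ; case: eqP => [->|_]; last by rewrite mul0r.
  by rewrite -{1}[U_(j)%MM]add0m addmK mpolyX0 meval1 mulr1.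
have e0 : ('X_i + (a i)%:MP)@_0 = a i.
  by rewrite mcoeffD mcoeffX mcoeffC mnm1_eq0 eqxx add0r mulr1.
have eU : ('X_i + (a i)%:MP)@_U_(j) = (i == j)%:R.
  by rewrite mcoeffD mcoeffXU mcoeffC mnm1_eq0 mulr0 addr0.
have := translate_coef0 'X_[m]; rewrite /translate => Em.
by rewrite mpolyXD psubstM psubstX mcoeffM_U IH mderivM mevalD !mevalM XE mevalXU
  e0 eU addrC Em.
Qed.

Lemma translateK p :
  psubst (fun i => 'X_i - (a i)%:MP) (translate p) = p.
Proof.
rewrite /translate psubst_comp -[RHS]psubst_id.
apply: mpoly_lrmorphism_eq => i /=.
by rewrite !psubstX psubstD psubstX psubstC subrK.
Qed.

Lemma translateVK p :
  translate (psubst (fun i => 'X_i - (a i)%:MP) p) = p.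
Proof.
rewrite /translate psubst_comp -[RHS]psubst_id.
apply: mpoly_lrmorphism_eq => i /=.
by rewrite !psubstX psubstB psubstX psubstC addrK.
Qed.

End Translation.

Variables (O : comUnitAlgType K) (N c : nat).

(** The data of [smooth_algebraic_germ] with the point moved to the origin. [N] stands for [n + c];
    the equality enters only in the count of dimensions. *)
Definition germ_at_origin (g : 'I_c -> {mpoly K[N]})
    (phi : {lrmorphism {mpoly K[N]} -> O}) : Prop :=
  [/\ forall i, ord_ge 1 (g i), row_free (jac g),
      forall P, (phi P \is a GRing.unit) = (P@_0 != 0),
      forall z, exists P Q, Q@_0 != 0 /\ z * phi Q = phi P &
      forall P, phi P = 0 <->
        exists (Q : {mpoly K[N]}) (u : 'I_c -> {mpoly K[N]}),
          Q@_0 != 0 /\ Q * P = \sum_i u i * g i].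

Section AtOrigin.
Variables (g : 'I_c -> {mpoly K[N]}) (phi : {lrmorphism {mpoly K[N]} -> O}).
Hypothesis gphi : germ_at_origin g phi.
Implicit Types (P Q : {mpoly K[N]}) (z w u : O).

Let unitP P : (phi P \is a GRing.unit) = (P@_0 != 0). Proof. by case: gphi. Qed.

Let nonunitP P : nonunits (phi P) <-> P@_0 = 0.
Proof. by rewrite /nonunits /= unitP negbK; split=> [/eqP|->]. Qed.

Let frac z : exists P Q, [/\ Q@_0 != 0, z * phi Q = phi P & nonunits z <-> P@_0 = 0].
Proof.
have [_ _ _ h _] := gphi; have [P [Q [Q0 zQ]]] := h z.
exists P, Q; split=> //; rewrite -nonunitP -zQ /nonunits /=.
by rewrite unitrM unitP Q0 andbT.
Qed.

Let phi_g i : phi (g i) = 0.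
Proof.
have [_ _ _ _ ker] := gphi; apply/ker; exists 1, (fun j => (j == i)%:R).
rewrite mcoeff1 eqxx oner_neq0; split=> //.
rewrite mul1r (bigD1 i) //= eqxx mul1r big1 ?addr0 // => j /negPf ->.
by rewrite mul0r.
Qed.

Lemma algebraic_local : local_alg O.
Proof.
split=> [z w|z].
  have [P [Q [Q0 zQ ->]]] := frac z; have [P' [Q' [Q0' wQ ->]]] := frac w.
  move=> P0 P0'; have : nonunits ((z + w) * phi (Q * Q')).
    have -> : (z + w) * phi (Q * Q') = phi (P * Q' + P' * Q).
      by rewrite rmorphD !rmorphM /= -zQ -wQ mulrDl !mulrA mulrAC [w * _ * _]mulrAC.
    by rewrite nonunitP mcoeffD !rmorphM /= P0 P0' !mul0r addr0.
  by rewrite /nonunits /= unitrM unitP rmorphM mulf_neq0 // andbT.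
have [P [Q [Q0 zQ _]]] := frac z; exists (P@_0 / Q@_0).
have : nonunits ((z - (P@_0 / Q@_0)%:A) * phi Q).
  rewrite mulrBl zQ mulr_algl -linearZ -raddfB nonunitP mcoeffB mcoeffZ.
  by rewrite divfK ?subrr.
by rewrite /nonunits /= unitrM unitP Q0 andbT.
Qed.

Definition lin (P : {mpoly K[N]}) : 'rV[K]_N := \row_j P@_U_(j).

(** The cotangent space of the germ is that of affine space modulo the differentials of the
    equations. Fractions with numerator of order two form an ideal [S] containing m^2, and the
    combination of rows is read off the linear coefficients of
    [Q * (P * B - A) = \sum_i u i * g i]. *)
Lemma lin_nonunits_sq P : P@_0 = 0 -> nonunits_sq (phi P) -> (lin P <= jac g)%MS.
Proof.
move=> P0 sqP.
pose S := [set z | exists P Q, [/\ Q@_0 != 0, z * phi Q = phi P & ord_ge 2 P]].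
have Sid : is_ideal S.
  split.
  - exists 0, 1; rewrite mcoeff1 eqxx oner_neq0 mul0r raddf0.
    by split=> //; apply: ord_ge0.
  - move=> z w [A [B [B0 zB A2]]] [A' [B' [B0' wB A2']]].
    exists (A * B' + A' * B), (B * B'); rewrite rmorphM mulf_neq0 //.
    split=> //; last by apply: ord_geD; apply: ord_geMl.
    by rewrite rmorphD !rmorphM /= -zB -wB mulrDl !mulrA [w * _ * _]mulrAC.
  - move=> b z [A [B [B0 zB A2]]]; have [C [D [D0 bD _]]] := frac b.
    exists (C * A), (D * B); rewrite rmorphM mulf_neq0 //; split=> //.
      by rewrite !rmorphM /= -zB -bD mulrACA.
    exact: ord_geMr.
have [A [B [B0 PB A2]]] : S (phi P).
  apply: (ideal_gen_min Sid) sqP => _ [z [w [nz nw ->]]].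
  have [A [B [B0 zB zA]]] := frac z; have [C [D [D0 wD wC]]] := frac w.
  exists (A * C), (B * D); rewrite rmorphM mulf_neq0 //; split=> //.
    by rewrite !rmorphM /= -zB -wD mulrACA.
  rewrite -[2%N]/(1 + 1)%N; apply: ord_geM; apply/ord_ge1P; [exact/zA | exact/wC].
have [g1 _ _ _ ker] := gphi.
have /ker[Q [u [Q0 E]]] : phi (P * B - A) = 0 by rewrite raddfB /= rmorphM /= PB subrr.
have linE j : Q@_0 * B@_0 * P@_U_(j) = \sum_i (u i)@_0 * (g i)@_U_(j).
  have := congr1 (mcoeff U_(j)%MM) E; rewrite mcoeffM_U (raddf_sum (mcoeff _)) /=.
  rewrite !mcoeffB mcoeffM_0 mcoeffM_U P0 (A2 0%MM) ?(A2 U_(j)%MM) ?mdeg0 ?mdeg1 //.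
  rewrite !mul0r !subr0 add0r mulr0 addr0 [P@__ * _]mulrC mulrA => ->.
  apply: eq_bigr => i _; by rewrite mcoeffM_U (g1 i 0%MM) ?mdeg0 // mulr0 addr0.
have : (\row_i (u i)@_0 *m jac g <= jac g)%MS by apply: submxMl.
have -> : \row_i (u i)@_0 *m jac g = (Q@_0 * B@_0) *: lin P.
  apply/rowP => j; rewrite !mxE linE; apply: eq_bigr => i _.
  by rewrite !mxE.
by rewrite eqmx_scale ?mulf_neq0.
Qed.

Lemma phi_ord2 P : ord_ge 2 P -> nonunits_sq (phi P).
Proof.
move=> P2; rewrite (mpolyE P) raddf_sum big_seq.
apply: ideal_sum => [|m]; first exact: nonunits_sq_ideal.
rewrite mcoeff_msupp /= linearZ => Pm; apply: idealZ; first exact: nonunits_sq_ideal.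
have : (1 < mdeg m)%N by rewrite ltnNge; apply: contra Pm => ?; rewrite P2.
elim/mnm_ind: m {Pm} => [|m i _]; first by rewrite mdeg0.
rewrite mdegD mdeg1 addn1 ltnS mpolyXD rmorphM => m_gt0.
apply: nonunits_sqM; apply/nonunitP; rewrite mcoeffX ?mnm1_eq0 //.
by case: eqP m_gt0 => // ->; rewrite mdeg0.
Qed.

(** The linear parts of lifts [P i] of the [y i] and of the [c] equations span all linear forms in
    [N = n + c] variables, hence form a basis. *)
Lemma algebraic_dim n (y : 'I_n -> O) : N = (n + c)%N ->
  coordinates y -> gradients_free y.
Proof.
move=> EN [ny ygen].
(* Replacing the denominator by its value at the origin changes [y i] only by an element of m^2. *)
have /choice[P hP] (i : 'I_n) : exists P, P@_0 = 0 /\ nonunits_sq (y i - phi P).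
  have [P [Q [Q0 yQ yP]]] := frac (y i); exists ((Q@_0)^-1 *: P).
  rewrite mcoeffZ (yP.1 (ny i)) mulr0; split=> //.
  rewrite linearZ /= -yQ scalerAr -{1}[y i]mulr1 -mulrBr.
  apply: nonunits_sqM => //; rewrite -(rmorph1 phi) -linearZ -raddfB nonunitP.
  by rewrite mcoeffB mcoeffZ mcoeff1 eqxx mulVf ?subrr.
have P0 i := (hP i).1; have yP i := (hP i).2.
have sq_id := @nonunits_sq_ideal K O; have [_ sqD _] := sq_id.
pose M := col_mx (jac P) (jac g).
have full : row_full M.
  rewrite -sub1mx; apply/row_subP => j; rewrite row1.
  have : nonunits (phi 'X_j) by apply/nonunitP; rewrite mcoeffX mnm1_eq0.
  rewrite -ygen => /ideal_gen_rangeP[al alE].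
  have /choice[b hb] i := algebraic_local.2 (al i).
  pose R := 'X_j - \sum_i b i *: P i.
  have R0 : R@_0 = 0.
    rewrite mcoeffB mcoeffX mnm1_eq0 raddf_sum /= big1 ?subr0 // => i _.
    by rewrite mcoeffZ P0 mulr0.
  have sqR : nonunits_sq (phi R).
    rewrite raddfB raddf_sum /= alE -sumrB; apply: ideal_sum => // i _.
    have -> : al i * y i - phi (b i *: P i) =
        (al i - (b i)%:A) * y i + b i *: (y i - phi (P i)).
      by rewrite linearZ mulrBl mulr_algl scalerBr addrA subrK.
    by apply: sqD; [apply: nonunits_sqM | apply: idealZ].
  have -> : delta_mx 0 j = lin R + \row_i b i *m jac P.
    apply/rowP => l; rewrite !mxE mcoeffB mcoeffXU raddf_sum /= eq_sym.
    rewrite [X in _ = _ - X + _](_ : _ = \sum_i b i * (P i)@_U_(l)); last first.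
      by apply: eq_bigr => i _; rewrite mcoeffZ.
    rewrite [X in _ = _ + X](_ : _ = \sum_i b i * (P i)@_U_(l)) ?subrK //.
    by apply: eq_bigr => i _; rewrite !mxE.
  rewrite addmx_sub // -addsmxE.
    exact: submx_trans (lin_nonunits_sq R0 sqR) (addsmxSr _ _).
  exact: submx_trans (submxMl _ _) (addsmxSl _ _).
move=> d sqd i.
have sqP : nonunits_sq (phi (\sum_i d i *: P i)).
  have -> : phi (\sum_i d i *: P i) =
      \sum_i d i *: y i - \sum_i d i *: (y i - phi (P i)).
    rewrite -sumrB raddf_sum; apply: eq_bigr => j _ /=.
    by rewrite linearZ scalerBr opprB addrC subrK.
  apply: idealB => //; apply: ideal_sum => // j _; exact: idealZ.
have dP0 : (\sum_i d i *: P i)@_0 = 0.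
  by rewrite raddf_sum /= big1 // => j _; rewrite mcoeffZ P0 mulr0.
have /submxP[e eE] := lin_nonunits_sq dP0 sqP.
have Mfree : row_free M by rewrite /row_free (eqP full) EN.
have : row_mx (\row_i d i) (- e) *m M = 0.
  rewrite mul_row_col mulNmx -eE; apply/rowP => j; rewrite !mxE raddf_sum.
  apply/eqP; rewrite subr_eq0; apply/eqP/eq_bigr => l _.
  by rewrite !mxE /= mcoeffZ.
move/eqP; rewrite (mulmx_free_eq0 _ Mfree) row_mx_eq0 => /andP[/eqP/rowP/(_ i) + _].
by rewrite !mxE.
Qed.

(** The numerator [P] of [u] joins the equations as one more element with independent linear part,
    because [u] is not in m^2. Primality modulo every order then passes to [O] by Krull's theorem
    for the ideal of [u]. *)
Lemma algebraic_prime u a b : nonunits u -> ~ nonunits_sq u ->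
  (exists q, a * b = u * q) -> (exists q, a = u * q) \/ (exists q, b = u * q).
Proof.
move=> nu nsu [q abE].
have [P [Qu [Qu0 uQ uP]]] := frac u; have P0 := uP.1 nu.
have uU : phi Qu \is a GRing.unit by rewrite unitP.
pose w (i : 'I_(1 + c)) := match split i with inl _ => P | inr j => g j end.
have [g1 gfree _ _ ker] := gphi.
have nsP : ~ (lin P <= jac g)%MS.
  case/submxP => e eE; apply: nsu.
  suff : nonunits_sq (phi P).
    move=> sqP; rewrite -(mulrK uU u) uQ.
    exact: idealMr (@nonunits_sq_ideal K O) sqP.
  pose R := P - \sum_i e 0 i *: g i.
  have -> : phi P = phi R.
    rewrite raddfB raddf_sum /= big1 ?subr0 // => i _.
    by rewrite linearZ /= phi_g scaler0.
  have R0 : R@_0 = 0.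
    rewrite mcoeffB P0 raddf_sum big1 ?subr0 // => i _ /=.
    by rewrite mcoeffZ (g1 i) ?mulr0 // mdeg0.
  have RU j : R@_U_(j) = 0.
    have /rowP/(_ j) := eE; rewrite !mxE mcoeffB => ->.
    rewrite raddf_sum /= -sumrB big1 // => i _.
    by rewrite mcoeffZ !mxE subrr.
  apply: phi_ord2; have := linear_part R; rewrite R0 mpolyC0 subr0.
  by rewrite big1 ?subr0 // => j _; rewrite RU scale0r.
have w1 i : ord_ge 1 (w i) by rewrite /w; case: (split i) => // _; apply/ord_ge1P.
have jw : jac w = col_mx (lin P) (jac g).
  apply/matrixP => i j; rewrite !mxE /w; case: (split i) => l; rewrite !mxE //.
have wfree : row_free (jac w).
  rewrite jw; apply: inj_row_free => v; rewrite -[v]hsubmxK mul_row_col.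
  set al := lsubmx v; set be := rsubmx v => E.
  have al0 : al = 0.
    apply/rowP => i; rewrite ord1 [RHS]mxE; apply: contra_notP nsP => /eqP al0.
    have -> : lin P = - (al 0 0)^-1 *: be *m jac g.
      apply: (scalerI al0); rewrite -scalemxAl scalerA mulrN divff // scaleN1r.
      have E' : al 0 0 *: lin P + be *m jac g = 0.
        by rewrite -mul_scalar_mx -mx11_scalar E.
      by apply/eqP; rewrite -subr_eq0 opprK E'.
    exact: submxMl.
  move/eqP: E; rewrite al0 mul0mx add0r (mulmx_free_eq0 _ gfree) => /eqP ->.
  by rewrite row_mx0.
have krullO (z : {mpoly K[N]}) : (forall d, exists h : 'I_(1 + c) -> {mpoly K[N]},
    ord_ge d (z - \sum_i h i * w i)) -> exists q, phi z = u * q.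
  move=> zJ; apply: (@krull O N (fun i => phi 'X_i) [set v | exists q, v = u * q]).
  - apply: (acc_localization (phi := phi)) (@acc_mpoly K N) => v.
    by have [A [B [B0 vB _]]] := frac v; exists A, B; split=> //; exact: etrans (unitP B) B0.
  - exact: algebraic_local.1.
  - by move=> i; apply/nonunitP; rewrite mcoeffX mnm1_eq0.
  - split; first by exists 0; rewrite mulr0.
      by move=> _ _ [q1 ->] [q2 ->]; exists (q1 + q2); rewrite mulrDr.
    by move=> v _ [q1 ->]; exists (v * q1); rewrite mulrCA.
  move=> d L Lid JL XL; have [h hd] := zJ d; have [L0 LD LM] := Lid.
  rewrite -(subrK (\sum_i h i * w i) z) rmorphD; apply: LD.
    set r := z - _ in hd *; rewrite (mpolyE r) raddf_sum big_seq.
    apply: ideal_sum => // m; rewrite mcoeff_msupp /= linearZ /= => rm.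
    apply: idealZ => //; have -> : phi 'X_[m] = mmap1 (fun i => phi 'X_i) m.
      rewrite mpolyXE_id rmorph_prod; apply: eq_bigr => i _.
      by rewrite rmorphXn.
    by apply: XL; rewrite leqNgt; apply: contra rm => /hd ->.
  rewrite raddf_sum; apply: ideal_sum => // i _ /=; rewrite rmorphM /=; apply: LM.
  rewrite /w; case: (split i) => j; last first.
    by rewrite phi_g.
  by apply: JL; exists (phi Qu); rewrite uQ.
have [A [Qa [Qa0 aQ _]]] := frac a; have [B [Qb [Qb0 bQ _]]] := frac b.
have [C [Qq [Qq0 qQ _]]] := frac q.
have /ker[Q [h [Q0 E]]] : phi (A * B * (Qu * Qq) - P * C * (Qa * Qb)) = 0.
  rewrite raddfB /= !rmorphM /= -aQ -bQ -uQ -qQ.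
  have -> : a * phi Qa * (b * phi Qb) = a * b * (phi Qa * phi Qb) by rewrite mulrACA.
  rewrite abE; apply/eqP; rewrite subr_eq0; apply/eqP.
  ring.
(* The factors coming from denominators are absorbed, so that the relation becomes an identity of
   polynomials. *)
pose A' := A * (Q * (Qu * Qq)).
have pq d : exists h : 'I_(1 + c) -> {mpoly K[N]},
    ord_ge (d + d) (A' * B - \sum_i h i * w i).
  pose H (i : 'I_(1 + c)) : {mpoly K[N]} :=
    match split i with inl _ => Q * (C * (Qa * Qb)) | inr j => h j end.
  exists H; suff -> : A' * B = \sum_i H i * w i by rewrite subrr; apply: ord_ge0.
  rewrite big_split_ord big_ord1 /= {1}/H /w (unsplitK (inl 0)).
  have -> : \sum_(i < c) H (rshift 1 i) * w (rshift 1 i) = \sum_i h i * g i.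
    by apply: eq_bigr => i _; rewrite /H /w (unsplitK (inr i)).
  by rewrite -E /A'; ring.
(* If [A'] failed at order [d1] and [B] at order [d2], both would fail at the larger of the two. *)
have : (forall d, exists h : 'I_(1 + c) -> {mpoly K[N]}, ord_ge d (A' - \sum_i h i * w i))
    \/ (forall d, exists h : 'I_(1 + c) -> {mpoly K[N]}, ord_ge d (B - \sum_i h i * w i)).
  apply: contrapT => /not_orP[/existsNP[d1 n1] /existsNP[d2 n2]].
  have [[h1 h1E]|[h2 h2E]] := independent_ideal_prime w1 wfree (pq (maxn d1 d2)).
    by apply: n1; exists h1; apply: ord_geW h1E; rewrite leq_maxl.
  by apply: n2; exists h2; apply: ord_geW h2E; rewrite leq_maxr.
case=> /krullO[v vE]; [left | right].
  have uA : phi (Q * (Qu * Qq)) * phi Qa \is a GRing.unit.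
    by rewrite unitrM !unitP !mcoeffM_0 !mulf_neq0.
  exists (v / (phi (Q * (Qu * Qq)) * phi Qa)); rewrite mulrA -vE rmorphM /= -aQ.
  by rewrite -[_ * phi (Q * _)]mulrA [phi Qa * _]mulrC mulrK.
by exists (v / phi Qb); rewrite mulrA -vE -bQ mulrK // unitP.
Qed.

End AtOrigin.

Lemma algebraic_regular n (g : 'I_c -> {mpoly K[N]})
    (phi : {lrmorphism {mpoly K[N]} -> O}) : N = (n + c)%N ->
  germ_at_origin g phi -> regular_germ O n.
Proof.
move=> EN gphi; split; first exact: algebraic_local gphi.
move=> y ycoord; split; first exact (algebraic_dim gphi EN ycoord).
exact: (algebraic_prime gphi).
Qed.

End AlgebraicGerm.

Lemma smooth_algebraic_regular (K : closedFieldType) (O : comUnitAlgType K) n :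
  smooth_algebraic_germ O n -> regular_germ O n.
Proof.
case=> c [g [a [phi [ga rk unitP frac ker]]]].
pose g' i := translate a (g i).
pose back := psubst (fun i : 'I_(n + c) => 'X_i - (a i)%:MP).
pose phi' : {lrmorphism {mpoly K[n + c]} -> O} := phi \o back.
have phi'T P : phi' (translate a P) = phi P by rewrite /= /back translateK.
apply: (@algebraic_regular _ _ _ _ n g' phi') => //; split.
- by move=> i; apply/ord_ge1P; rewrite translate_coef0.
- rewrite /row_free (_ : jac g' = \matrix_(i, j) ((g i)^`M(j)).@[a]) ?rk //.
  by apply/matrixP => i j; rewrite !mxE translate_coefU.
- by move=> P; rewrite -(translateVK a P) phi'T unitP translate_coef0.
- move=> z; have [P [Q [Qa zQ]]] := frac z.
  by exists (translate a P), (translate a Q); rewrite translate_coef0 !phi'T.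
move=> P; rewrite -(translateVK a P) phi'T ker; set P' := psubst _ P.
split=> [[Q [u [Q0 E]]]|[Q [u [Q0 E]]]].
  exists (translate a Q), (fun i => translate a (u i)); rewrite translate_coef0.
  split=> //; rewrite -rmorphM E raddf_sum /=.
  by apply: eq_bigr => i _; rewrite rmorphM.
exists (back Q), (fun i => back (u i)); rewrite -translate_coef0 /back translateVK.
split=> //; rewrite -(translateK a P') -psubstM E psubst_sum.
by apply: eq_bigr => i _; rewrite psubstM translateK.
Qed.

(** * Analytic germs *)

Section FiniteSums.
Variables (R : realFieldType) (I J : finType) (h : I -> J) (F : J -> R).
Hypothesis h_inj : injective h.

(** The monomials of degree less than [d] form a different type for each [d]; sums over them are
    compared along injections of the index types. *)
Lemma sum_imset_split :
  \sum_j F j = \sum_i F (h i) + \sum_(j | j \notin imset h (mem predT)) F j.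
Proof.
rewrite (bigID (fun j => j \in imset h (mem predT))) /= big_imset // => x y _ _.
exact: h_inj.
Qed.

Lemma sum_inj_le : (forall j, 0 <= F j) -> \sum_i F (h i) <= \sum_j F j.
Proof. by move=> F0; rewrite sum_imset_split lerDl sumr_ge0. Qed.

Lemma sum_inj_eq : (forall j, (forall i, h i != j) -> F j = 0) ->
  \sum_i F (h i) = \sum_j F j.
Proof.
move=> F0; rewrite sum_imset_split [X in _ + X]big1 ?addr0 // => j /imsetP hj; apply: F0 => i.
by apply/eqP => hij; apply: hj; exists i; rewrite ?inE.
Qed.

End FiniteSums.

(** * Convergent power series: weighted norms and division *)

Section ConvergentSeries.
Variables (K : closedFieldType) (O : comUnitAlgType K) (n : nat).
Variables (R : realFieldType) (nrm : K -> R) (cf : O -> 'X_{1..n} -> K).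

Hypothesis nrm0 : nrm 0 = 0.
Hypothesis nrm_ge0 : forall c, 0 <= nrm c.
Hypothesis nrm_eq0 : forall c, nrm c = 0 -> c = 0.
Hypothesis nrmD : forall a b, nrm (a + b) <= nrm a + nrm b.
Hypothesis nrmM : forall a b, nrm (a * b) = nrm a * nrm b.

Definition conv (b : 'X_{1..n} -> K) : Prop :=
  exists rho M : R, 0 < rho /\
    forall d : nat, \sum_(m : 'X_{1..n < d}) nrm (b m) * rho ^+ mdeg m <= M.

Hypothesis cf_inj : forall z w, (forall m, cf z m = cf w m) -> z = w.
Hypothesis cf_conv : forall z, conv (cf z).
Hypothesis cf_surj : forall b, conv b -> exists z, forall m, cf z m = b m.
Hypothesis cfZ : forall c z m, cf (c *: z) m = c * cf z m.
Hypothesis cfD : forall z w m, cf (z + w) m = cf z m + cf w m.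
Hypothesis cfM : forall z w m, cf (z * w) m =
  \sum_(h : 'X_{1..n < (mdeg m).+1, (mdeg m).+1} | m == (h.1 + h.2)%MM)
     cf z h.1 * cf w h.2.

(** The Taylor polynomial, through which results on polynomials modulo a given order apply to
    series. *)
Definition trunc d z : {mpoly K[n]} := \sum_(m : 'X_{1..n < d}) cf z m *: 'X_[m].

Lemma truncE d z m : (mdeg m < d)%N -> (trunc d z)@_m = cf z m.
Proof. exact: mcoeff_mpoly. Qed.

Lemma trunc_eq0 d z m : (d <= mdeg m)%N -> (trunc d z)@_m = 0.
Proof.
move=> le_dm; rewrite /trunc raddf_sum big1 // => -[k lt_kd] _ /=.
rewrite mcoeffZ mcoeffX; case: eqP => [Ek|_]; last by rewrite mulr0.
by rewrite Ek ltnNge le_dm in lt_kd.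
Qed.

Lemma cfM_trunc d z w m : (mdeg m < d)%N -> cf (z * w) m = (trunc d z * trunc d w)@_m.
Proof.
move=> lt_md; rewrite cfM mcoeffM; apply: eq_bigr => -[[k lt_k] [l lt_l]] _ /=.
by rewrite !truncE //; [apply: leq_trans lt_l lt_md | apply: leq_trans lt_k lt_md].
Qed.

Lemma cf0 m : cf 0 m = 0.
Proof. by rewrite -(scale0r (0 : O)) cfZ mul0r. Qed.

Lemma cfN z m : cf (- z) m = - cf z m.
Proof. by rewrite -scaleN1r cfZ mulN1r. Qed.

Lemma cfB z w m : cf (z - w) m = cf z m - cf w m.
Proof. by rewrite cfD cfN. Qed.

Lemma cf_sum (I : Type) (r : seq I) (P : pred I) (F : I -> O) m :
  cf (\sum_(i <- r | P i) F i) m = \sum_(i <- r | P i) cf (F i) m.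
Proof.
apply: (big_morph (fun z => cf z m)) => [z w|]; [exact: cfD | exact: cf0].
Qed.

Definition vord d z : Prop := forall m, (mdeg m < d)%N -> cf z m = 0.

Lemma vordP d e z : (d <= e)%N -> vord d z <-> ord_ge d (trunc e z).
Proof.
move=> le_de; split=> hz m lt_md.
  by rewrite truncE ?hz // (leq_trans lt_md).
by rewrite -(@truncE e) ?hz // (leq_trans lt_md).
Qed.

Lemma vordM d e z w : vord d z -> vord e w -> vord (d + e) (z * w).
Proof.
move=> hz hw m lt_m; rewrite (cfM_trunc _ _ lt_m).
by apply: (@ord_geM _ _ d e) => //; apply/vordP; rewrite ?leq_addr ?leq_addl.
Qed.

Lemma vordB d z w : vord d z -> vord d w -> vord d (z - w).
Proof. by move=> hz hw m lt_m; rewrite cfB hz ?hw ?subr0. Qed.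

Lemma vordW d e z : (d <= e)%N -> vord e z -> vord d z.
Proof. by move=> le_de hz m lt_m; apply/hz/(leq_trans lt_m). Qed.

Lemma nrmN c : nrm (- c) = nrm c.
Proof.
have nrm1 : nrm 1 = 1.
  have n1 : nrm 1 != 0 by apply/eqP => /nrm_eq0/eqP; rewrite oner_eq0.
  by apply: (mulfI n1); rewrite -nrmM !mulr1.
have nrmN1 : nrm (-1) = 1.
  have := nrmM (-1) (-1); rewrite mulrNN mulr1 nrm1 => /esym/eqP.
  by rewrite -expr2 sqrf_eq1 => /orP[/eqP//|/eqP N1]; have := nrm_ge0 (-1); rewrite N1; lra.
by rewrite -mulN1r nrmM nrmN1 mul1r.
Qed.

Lemma nrm_sum (I : Type) (r : seq I) (P : pred I) (F : I -> K) :
  nrm (\sum_(i <- r | P i) F i) <= \sum_(i <- r | P i) nrm (F i).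
Proof.
elim/big_rec2: _ => [|i x y _ le_yx]; first by rewrite nrm0.
by apply: le_trans (nrmD _ _) _; rewrite lerD2l.
Qed.

Definition wt (w : 'I_n -> R) (m : 'X_{1..n}) : R := \prod_i w i ^+ m i.

Lemma wtD w m1 m2 : wt w (m1 + m2) = wt w m1 * wt w m2.
Proof.
by rewrite -big_split; apply: eq_bigr => i _; rewrite mnmDE exprD.
Qed.

Lemma wt_const rho m : wt (fun=> rho) m = rho ^+ mdeg m.
Proof. by rewrite /wt mdegE expr_sum. Qed.

Lemma wt_gt0 w m : (forall i, 0 < w i) -> 0 < wt w m.
Proof. by move=> w0; apply: prodr_gt0 => i _; rewrite exprn_gt0. Qed.

Lemma wt_le w v m : (forall i, 0 < w i) -> (forall i, w i <= v i) -> wt w m <= wt v m.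
Proof.
move=> w0 wv; apply: ler_prod => i _; apply/andP; split; first exact/exprn_ge0/ltW.
by apply: lerXn2r => //; rewrite nnegrE ltW // (lt_le_trans (w0 i)).
Qed.

(** A weighted l^1 norm cut off below degree [d]: only finite sums occur, and convergence is a bound
    uniform in [d]. The radii may differ from one variable to another. *)
Definition bnd_norm (w : 'I_n -> R) (d : nat) (b : 'X_{1..n} -> K) : R :=
  \sum_(m : 'X_{1..n < d}) nrm (b m) * wt w m.

Lemma eq_bnd_norm w d b b' : (forall m, (mdeg m < d)%N -> b m = b' m) ->
  bnd_norm w d b = bnd_norm w d b'.
Proof. by move=> bb'; apply: eq_bigr => -[m lt_m] _ /=; rewrite bb'. Qed.

Section Norm.
Variable w : 'I_n -> R.
Hypothesis w_gt0 : forall i, 0 < w i.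

Let term_ge0 b m : 0 <= nrm (b m) * wt w m.
Proof. by rewrite mulr_ge0 // ltW // wt_gt0. Qed.

Lemma bnd_norm_ge0 d b : 0 <= bnd_norm w d b.
Proof. by apply: sumr_ge0. Qed.

Lemma bnd_norm_le0 d b : bnd_norm w d b <= 0 -> forall m, (mdeg m < d)%N -> b m = 0.
Proof.
move=> b0 m lt_md; have /eqP : bnd_norm w d b == 0 by rewrite eq_le b0 bnd_norm_ge0.
rewrite /bnd_norm => s0; have /eqP : nrm (b m) * wt w m = 0.
  exact: (@psumr_eq0P _ _ predT (fun k : 'X_{1..n < d} => nrm (b k) * wt w k)
    (fun k _ => term_ge0 b k) s0 (BMultinom lt_md) isT).
by rewrite mulf_eq0 (gt_eqF (wt_gt0 m w_gt0)) orbF => /eqP/nrm_eq0.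
Qed.

Let widen d e (m : 'X_{1..n < d}) : 'X_{1..n < d + e} :=
  BMultinom (leq_trans (bmdeg m) (leq_addr e d)).

Let widen_inj d e : injective (@widen d e).
Proof. by move=> m m' /(congr1 (@bmnm _ _)) /= /val_inj. Qed.

Lemma bnd_norm_widen d e b : bnd_norm w d b <= bnd_norm w (d + e) b.
Proof.
apply: (@sum_inj_le _ _ _ (@widen d e) (fun m => nrm (b m) * wt w m)) => //.
exact: widen_inj.
Qed.

Lemma bnd_norm_stable d e b : (forall m, (d <= mdeg m)%N -> b m = 0) ->
  bnd_norm w (d + e) b = bnd_norm w d b.
Proof.
move=> b0; apply/esym.
apply: (@sum_inj_eq _ _ _ (@widen d e) (fun m => nrm (b m) * wt w m)) => [|m hm].
  exact: widen_inj.
rewrite b0 ?nrm0 ?mul0r // leqNgt; apply/negP => lt_md.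
by case/eqP: (hm (BMultinom lt_md)); apply: val_inj.
Qed.

Lemma bnd_norm_shift d m0 b b' : (forall m, b' (m0 + m)%MM = b m) ->
  wt w m0 * bnd_norm w d b <= bnd_norm w (mdeg m0 + d) b'.
Proof.
move=> bb'; have sh (m : 'X_{1..n < d}) : (mdeg (m0 + m) < mdeg m0 + d)%N.
  by rewrite mdegD ltn_add2l bmdeg.
rewrite mulr_sumr.
have -> : \sum_(m : 'X_{1..n < d}) wt w m0 * (nrm (b m) * wt w m) =
    \sum_(m : 'X_{1..n < d}) nrm (b' (BMultinom (sh m))) * wt w (BMultinom (sh m)).
  by apply: eq_bigr => m _ /=; rewrite bb' wtD mulrCA.
apply: (@sum_inj_le _ _ _ (fun m => BMultinom (sh m)) (fun m => nrm (b' m) * wt w m)) => //.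
by move=> m m' /(congr1 (@bmnm _ _)) /= /addmI/val_inj.
Qed.

Lemma bnd_normD d b b' :
  bnd_norm w d (fun m => b m + b' m) <= bnd_norm w d b + bnd_norm w d b'.
Proof.
rewrite -big_split; apply: ler_sum => m _ /=.
by rewrite -mulrDl ler_wpM2r // ltW // wt_gt0.
Qed.

(** The product of the norms expands into nonnegative terms [G], one for each pair of monomials; the
    pairs of total degree less than [d] already bound the left side. *)
Lemma bnd_normM d z z' :
  bnd_norm w d (cf (z * z')) <= bnd_norm w d (cf z) * bnd_norm w d (cf z').
Proof.
pose G (h : 'X_{1..n < d, d}) := nrm (cf z h.1) * wt w h.1 * (nrm (cf z' h.2) * wt w h.2).
have G0 h : 0 <= G h by rewrite mulr_ge0.
have -> : bnd_norm w d (cf z) * bnd_norm w d (cf z') = \sum_h G h.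
  by rewrite mulr_suml -(pair_bigA _ (fun i j => G (i, j))); apply: eq_bigr => i _; rewrite mulr_sumr.
apply: (@le_trans _ _ (\sum_(m : 'X_{1..n < d})
    \sum_(h : 'X_{1..n < d, d} | (m : 'X_{1..n}) == (h.1 + h.2)%MM) G h)).
  apply: ler_sum => m _; rewrite (@cfM_trunc d) ?bmdeg //.
  have -> : (trunc d z * trunc d z')@_m = \sum_(h : 'X_{1..n < d, d} | (m : 'X_{1..n}) == (h.1 + h.2)%MM)
      (trunc d z)@_h.1 * (trunc d z')@_h.2 by exact: mcoeff_poly_mul (bmdeg m).
  apply: (@le_trans _ _ ((\sum_(h : 'X_{1..n < d, d} | (m : 'X_{1..n}) == (h.1 + h.2)%MM)
      nrm ((trunc d z)@_h.1 * (trunc d z')@_h.2)) * wt w m)).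
    by rewrite ler_wpM2r ?nrm_sum // ltW // wt_gt0.
  rewrite mulr_suml; apply: ler_sum => h /eqP Em.
  by rewrite Em wtD nrmM !truncE ?bmdeg // mulrACA.
rewrite (exchange_big_dep predT) //=; apply: ler_sum => h _.
case: (ltnP (mdeg (h.1 + h.2)) d) => [lt_d|le_d].
  by rewrite (big_pred1 (BMultinom lt_d)) // => m /=; rewrite bmeqP.
rewrite big1 // => m /eqP Em; have := bmdeg m.
by rewrite Em ltnNge le_d.
Qed.

End Norm.

Lemma conv_bnd b : conv b <->
  exists rho M : R, 0 < rho /\ forall d, bnd_norm (fun=> rho) d b <= M.
Proof.
have E rho d : bnd_norm (fun=> rho) d b =
    \sum_(m : 'X_{1..n < d}) nrm (b m) * rho ^+ mdeg m.
  by apply: eq_bigr => m _; rewrite wt_const.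
by split=> -[rho [M [rho0 hM]]]; exists rho, M; split=> // d; rewrite ?E // -E.
Qed.

Lemma lift_poly (P : {mpoly K[n]}) : exists z, forall m, cf z m = P@_m.
Proof.
apply: cf_surj; apply/conv_bnd.
exists 1, (bnd_norm (fun=> 1) (msize P) (fun m => P@_m)); split=> [|d]; first exact: ltr01.
apply: (le_trans (@bnd_norm_widen _ (fun=> ltr01) d (msize P) _)).
rewrite addnC bnd_norm_stable // => m le_m.
by apply/memN_msupp_eq0/msize_mdeg_ge.
Qed.

(* Division by u = c X^m0 + u' with u' small: in the weighted norm, truncated so
   that all sums are finite, u z is at least half as large as c X^m0 z. *)
Section Division.
Variables (u xi u' : O) (m0 : 'X_{1..n}) (w : 'I_n -> R).
Hypothesis w_gt0 : forall i, 0 < w i.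
Hypothesis xiE : forall m, cf xi m = (m0 == m)%:R.
Hypothesis uE : u = cf u m0 *: xi + u'.
Hypothesis u_neq0 : cf u m0 != 0.
Hypothesis u_vord : vord (mdeg m0) u.
Hypothesis u'_small : forall d, bnd_norm w d (cf u') <= nrm (cf u m0) * wt w m0 / 2.

Let kappa := nrm (cf u m0) * wt w m0 / 2.

Let kappa_gt0 : 0 < kappa.
Proof.
rewrite /kappa divr_gt0 ?ltr0n // mulr_gt0 ?wt_gt0 // lt_neqAle nrm_ge0 andbT.
by rewrite eq_sym; apply: contra_neq u_neq0 => /nrm_eq0.
Qed.

Let cf_xi z m : cf (xi * z) (m0 + m)%MM = cf z m.
Proof.
pose d := (mdeg (m0 + m)).+1.
have T : trunc d xi = 'X_[m0].
  apply/mpolyP => k; rewrite mcoeffX; case: (ltnP (mdeg k) d) => [lt_k|le_k].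
    by rewrite truncE ?xiE.
  rewrite trunc_eq0 //; case: eqP le_k => // <-.
  by rewrite /d mdegD ltnNge leq_addr.
rewrite (@cfM_trunc d) // T mulrC mcoeffMX truncE // /d mdegD.
by rewrite ltnS leq_addl.
Qed.

(** [z] is replaced by its Taylor polynomial [z']. As [u] has order at least [mdeg m0], this changes
    nothing in [u * z] below degree [D], and no term of [xi * z'] is cut off there. The triangle
    inequality then bounds twice [kappa * |z|] by [|u * z'| + kappa * |z|]. *)
Lemma division_bound d z :
  bnd_norm w d (cf z) * kappa <= bnd_norm w (mdeg m0 + d) (cf (u * z)).
Proof.
have [z' z'E] := lift_poly (trunc d z).
set D := (mdeg m0 + d)%N.
have zz' : vord d (z - z') by move=> m lt_m; rewrite cfB z'E truncE ?subrr.
have -> : bnd_norm w D (cf (u * z)) = bnd_norm w D (cf (u * z')).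
  apply: eq_bnd_norm => m lt_m; apply/eqP; rewrite -subr_eq0 -cfB -mulrBr.
  by rewrite (vordM u_vord zz').
have Nz' : bnd_norm w D (cf z') = bnd_norm w d (cf z).
  rewrite /D addnC bnd_norm_stable => [|m le_m]; last by rewrite z'E trunc_eq0.
  by apply: eq_bnd_norm => m lt_m; rewrite z'E truncE.
have Nu' : bnd_norm w D (cf (- u' * z')) <= kappa * bnd_norm w d (cf z).
  apply: le_trans (bnd_normM w_gt0 _ _ _) _; rewrite Nz' ler_wpM2r ?bnd_norm_ge0 //.
  rewrite (_ : bnd_norm w D (cf (- u')) = bnd_norm w D (cf u')) //.
  by apply: eq_bigr => m _; rewrite cfN nrmN.
have Nxi : (kappa + kappa) * bnd_norm w d (cf z)
    <= bnd_norm w D (cf (cf u m0 *: (xi * z'))).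
  have -> : bnd_norm w D (cf (cf u m0 *: (xi * z'))) =
      nrm (cf u m0) * bnd_norm w D (cf (xi * z')).
    by rewrite mulr_sumr; apply: eq_bigr => m _; rewrite cfZ nrmM mulrA.
  have -> : kappa + kappa = nrm (cf u m0) * wt w m0 by rewrite /kappa; lra.
  rewrite -mulrA ler_wpM2l //.
  have -> : bnd_norm w d (cf z) = bnd_norm w d (cf z').
    by apply: eq_bnd_norm => m lt_m; rewrite z'E truncE.
  by apply: bnd_norm_shift => // m; rewrite cf_xi.
have E : cf (cf u m0 *: (xi * z')) =1 (fun m => cf (u * z') m + cf (- u' * z') m).
  by move=> m; rewrite -cfD -mulrDl scalerAl {2}uE addrK.
have := bnd_normD w_gt0 D (cf (u * z')) (cf (- u' * z')).
rewrite -(@eq_bnd_norm w D _ _ (fun m _ => E m)) => Nsum.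
have := le_trans Nxi (le_trans Nsum (lerD (lexx _) Nu')); lra.
Qed.

(** The bound, applied to differences of approximate quotients, shows that these agree to increasing
    order. Their common coefficients [b] have norm at most [M / kappa], hence converge on the
    polydisc of radius [sigma]. *)
Lemma division_closed sigma rho M a : 0 < sigma -> (forall i, sigma <= w i) ->
  (forall i, w i <= rho) -> (forall d, bnd_norm (fun=> rho) d (cf a) <= M) ->
  (forall d, exists q, vord d (a - u * q)) -> exists q, a = u * q.
Proof.
move=> sigma0 sigma_le le_rho aM adiv; pose e := mdeg m0.
have /choice[q hq] d : exists q, vord (e + d) (a - u * q) by exact: adiv.
have coh d d' : (d <= d')%N -> vord d (q d - q d').
  move=> le_d; apply: (@bnd_norm_le0 w) => //.
  rewrite -(ler_pM2r kappa_gt0) mul0r; apply: le_trans (division_bound _ _) _.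
  rewrite /bnd_norm big1 // => -[m lt_m] _ /=; suff -> : cf (u * (q d - q d')) m = 0.
    by rewrite nrm0 mul0r.
  have -> : u * (q d - q d') = (a - u * q d') - (a - u * q d).
    by rewrite mulrBr opprB [RHS]addrC addrA subrK.
  by apply: (vordB _ (hq d)) => //; apply: vordW (hq d'); rewrite leq_add2l.
pose b m := cf (q (mdeg m).+1) m.
have bq d m : (mdeg m < d)%N -> b m = cf (q d) m.
  by move=> lt_m; apply/eqP; rewrite -subr_eq0 -cfB (coh _ _ lt_m).
have [q0 q0E] : exists z, forall m, cf z m = b m.
  apply: cf_surj; apply/conv_bnd; exists sigma, (M / kappa); split=> // d.
  rewrite ler_pdivlMr // (eq_bnd_norm _ (bq d)).
  apply: (@le_trans _ _ (bnd_norm w d (cf (q d)) * kappa)).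
    apply: ler_wpM2r; first exact: ltW.
    by apply: ler_sum => m _; rewrite ler_wpM2l // wt_le.
  apply: le_trans (division_bound _ _) _.
  have -> : bnd_norm w (mdeg m0 + d) (cf (u * q d)) = bnd_norm w (mdeg m0 + d) (cf a).
    apply: eq_bnd_norm => m lt_m; apply/esym/eqP.
    by rewrite -subr_eq0 -cfB (hq d).
  apply: le_trans (aM (mdeg m0 + d)%N); apply: ler_sum => m _.
  by rewrite ler_wpM2l // wt_le.
exists q0; apply/eqP; rewrite -subr_eq0; apply/eqP/cf_inj => m; rewrite cf0.
set d := (mdeg m).+1.
have -> : a - u * q0 = (a - u * q d) - u * (q0 - q d).
  by rewrite mulrBr opprB addrA subrK.
apply: (@vordB d) => //; first by apply: vordW (hq d); rewrite leq_addl.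
rewrite -[d]add0n; apply: vordM => // k lt_k.
by rewrite cfB q0E (bq d) ?subrr.
Qed.

End Division.

(** Each term of the rest, times [M], is at most [kappa] times the corresponding term of [u] in
    radius [rho], and the latter terms sum to at most [M]. *)
Lemma small_rest u xi m0 w rho M : 0 < M -> 0 < rho ->
  (forall d, bnd_norm (fun=> rho) d (cf u) <= M) -> (forall i, 0 < w i) ->
  (forall m, cf xi m = (m0 == m)%:R) ->
  (forall m, m != m0 -> cf u m != 0 ->
     wt w m * M <= nrm (cf u m0) * wt w m0 / 2 * rho ^+ mdeg m) ->
  forall d, bnd_norm w d (cf (u - cf u m0 *: xi)) <= nrm (cf u m0) * wt w m0 / 2.
Proof.
move=> M0 rho0 uM w0 xiE wM d; set kappa := nrm _ * _ / 2 in wM *.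
have kappa0 : 0 <= kappa by rewrite divr_ge0 // mulr_ge0 // ltW // wt_gt0.
rewrite -(ler_pM2r M0); apply: le_trans (ler_wpM2l kappa0 (uM d)).
rewrite mulr_suml mulr_sumr; apply: ler_sum => m _.
rewrite cfB cfZ xiE wt_const; have [<-|ne_m] := eqVneq m0 (m : 'X_{1..n}).
  rewrite mulr1 subrr nrm0 !mul0r mulr_ge0 // mulr_ge0 //.
  by rewrite exprn_ge0 // ltW.
rewrite mulr0 subr0; have [->|um] := eqVneq (cf u m) 0; first by rewrite nrm0 !mul0r mulr0.
rewrite -mulrA [X in _ <= X]mulrCA ler_wpM2l //; apply: wM => //.
by rewrite eq_sym.
Qed.

Lemma conv_pos b : conv b -> exists rho M : R,
  [/\ 0 < rho, 0 < M & forall d, bnd_norm (fun=> rho) d b <= M].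
Proof.
move=> /conv_bnd[rho [M [rho0 hM]]]; exists rho, (M + 1).
have M0 : 0 <= M.
  by apply: le_trans (hM 0%N); apply: bnd_norm_ge0.
split=> // [|d]; first by lra.
by apply: le_trans (hM d) _; lra.
Qed.

Lemma division_unit u a : cf u 0%MM != 0 ->
  (forall d, exists q, vord d (a - u * q)) -> exists q, a = u * q.
Proof.
move=> u0 adiv.
have [rho [M [rho0 M0 uM]]] := conv_pos (cf_conv u).
have [rho' [M' [rho'0 M'0 aM]]] := conv_pos (cf_conv a).
have [xi xiE] := lift_poly 'X_[0%MM].
have {}xiE m : cf xi m = (0%MM == m)%:R by rewrite xiE mcoeffX.
set c := nrm (cf u 0%MM).
have c0 : 0 < c.
  by rewrite lt_neqAle nrm_ge0 andbT eq_sym; apply: contra_neq u0 => /nrm_eq0.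
(* With this radius a monomial of degree [k.+1] has weight at most [rho ^+ k.+1 * c / (2 * M)], as
   [small_rest] asks for [m0 = 0]. *)
pose s := Num.min rho' (Num.min rho (rho * c / (2 * M))).
have s0 : 0 < s by rewrite !lt_min rho'0 rho0 divr_gt0 ?mulr_gt0.
have [s1 s2 s3] : [/\ s <= rho', s <= rho & s <= rho * c / (2 * M)].
  by have : s <= s by []; rewrite {2}/s !le_min => /and3P[].
apply: (@division_closed u xi (u - cf u 0%MM *: xi) 0%MM (fun=> s) _ _ _ _ _ _ s rho' M') => //.
- by rewrite addrC subrK.
- by move=> m; rewrite mdeg0.
apply: (@small_rest _ _ _ _ rho M) => // m m_neq0 _.
rewrite !wt_const mdeg0 expr0 mulr1 -/c.
have := m_neq0; rewrite -mdeg_eq0; case: (mdeg m) => // k _.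
rewrite !exprS [X in _ <= X]mulrCA.
have sk : s ^+ k <= rho ^+ k by apply: lerXn2r => //; rewrite nnegrE ltW.
have sM : s * M <= rho * (c / 2).
  move: s3; rewrite ler_pdivlMr ?mulr_gt0 //; lra.
have k0 : 0 <= s ^+ k by rewrite exprn_ge0 // ltW.
rewrite mulrAC mulrA; apply: ler_pM => //; rewrite mulr_ge0 // ltW //.
Qed.

Lemma division_param u i a : cf u 0%MM = 0 -> cf u U_(i)%MM != 0 ->
  (forall d, exists q, vord d (a - u * q)) -> exists q, a = u * q.
Proof.
move=> u0 ui adiv.
have [rho [M [rho0 M0 uM]]] := conv_pos (cf_conv u).
have [rho' [M' [rho'0 M'0 aM]]] := conv_pos (cf_conv a).
have [xi xiE] := lift_poly 'X_i.
have {}xiE m : cf xi m = (U_(i)%MM == m)%:R by rewrite xiE mcoeffX.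
set c := nrm (cf u U_(i)%MM).
have c0 : 0 < c.
  by rewrite lt_neqAle nrm_ge0 andbT eq_sym; apply: contra_neq ui => /nrm_eq0.
(* Variable [i] gets weight [s], the others [s * t]: the factor [t] makes the other linear terms
   small against the one in variable [i], and [s] does the same for the terms of degree at least
   two. *)
pose t := Num.min 1 (rho * c / (2 * M)).
pose s := Num.min rho' (Num.min rho (rho ^+ 2 * c / (2 * M))).
have t0 : 0 < t by rewrite !lt_min ltr01 divr_gt0 ?mulr_gt0.
have [t1 t2] : t <= 1 /\ t <= rho * c / (2 * M).
  by have : t <= t by []; rewrite {2}/t !le_min => /andP[].
have s0 : 0 < s by rewrite !lt_min rho'0 rho0 divr_gt0 ?mulr_gt0 ?exprn_gt0.
have [s1 s2 s3] : [/\ s <= rho', s <= rho & s <= rho ^+ 2 * c / (2 * M)].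
  by have : s <= s by []; rewrite {2}/s !le_min => /and3P[].
pose w j := if j == i then s else s * t.
have st : s * t <= s by rewrite ler_piMr // ltW.
have w0 j : 0 < w j by rewrite /w; case: ifP => _ //; rewrite mulr_gt0.
have ws j : w j <= s by rewrite /w; case: ifP.
have wU j : wt w U_(j) = w j.
  rewrite /wt (bigD1 j) //= big1 => [|l ne_l]; first by rewrite mnm1E eqxx mulr1.
  by rewrite mnm1E eq_sym (negPf ne_l).
apply: (@division_closed u xi (u - cf u U_(i)%MM *: xi) U_(i)%MM w _ _ _ _ _ _ (s * t) rho' M') => //.
- by rewrite addrC subrK.
- move=> m; rewrite mdeg1 ltnS leqn0 mdeg_eq0 => /eqP -> //.
- apply: (@small_rest _ _ _ _ rho M) => // m m_neq um.
  rewrite wU {2}/w eqxx -/c; case Em : (mdeg m) => [|[|k]].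
  + by move/eqP: Em um; rewrite mdeg_eq0 => /eqP ->; rewrite u0 eqxx.
  + move/eqP/mdeg1P: Em m_neq => [j /eqP ->]; rewrite eq_mnm1 => ne_ji.
    rewrite wU /w (negPf ne_ji) expr1.
    have tM : t * M <= rho * (c / 2).
      by move: t2; rewrite ler_pdivlMr ?mulr_gt0 //; lra.
    have := ler_wpM2l (ltW s0) tM; lra.
  apply: (@le_trans _ _ (s ^+ k.+2 * M)).
    rewrite ler_wpM2r ?(ltW M0) //; apply: le_trans (wt_le m w0 ws) _.
    by rewrite wt_const Em.
  have sk : s ^+ k <= rho ^+ k by apply: lerXn2r => //; rewrite nnegrE ltW.
  have sM : s * M <= rho ^+ 2 * (c / 2).
    by move: s3; rewrite ler_pdivlMr ?mulr_gt0 //; lra.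
  have := ler_pM (mulr_ge0 (ltW s0) (ltW M0)) (exprn_ge0 k (ltW s0)) sM sk.
  move=> /(ler_wpM2l (ltW s0)); rewrite !exprS; lra.
- by rewrite mulr_gt0.
- by move=> j; rewrite /w; case: ifP.
- by move=> j; apply: le_trans (ws j) s1.
Qed.

(** The expansion of 1 is forced by the product formula: the element [o] with the coefficients of
    the constant polynomial 1 satisfies [o * 1 = 1]. *)
Lemma cf1 m : cf 1 m = (m == 0%MM)%:R.
Proof.
have [o oE] := lift_poly 1.
suff <- : o = 1 by rewrite oE mcoeff1.
rewrite -[LHS]mulr1; apply: cf_inj => k; set d := (mdeg k).+1.
rewrite (@cfM_trunc d) // (_ : trunc d o = 1) ?mul1r ?truncE //.
apply/mpolyP => l; case: (ltnP (mdeg l) d) => [lt_l|le_l]; first by rewrite truncE ?oE.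
by rewrite trunc_eq0 // mcoeff1; case: eqP le_l => // ->; rewrite mdeg0.
Qed.

Lemma cfM_0 z z' : cf (z * z') 0%MM = cf z 0%MM * cf z' 0%MM.
Proof.
by rewrite (@cfM_trunc 1) ?mdeg0 // mcoeffM_0 !truncE ?mdeg0.
Qed.

Lemma cfM_U z z' j : cf (z * z') U_(j)%MM =
  cf z 0%MM * cf z' U_(j)%MM + cf z U_(j)%MM * cf z' 0%MM.
Proof.
by rewrite (@cfM_trunc 2) ?mdeg1 // mcoeffM_U !truncE ?mdeg0 ?mdeg1.
Qed.

(** A geometric sum inverts a series with nonzero constant term up to any given order, and
    [division_unit] turns this into an inverse. *)
Lemma cf_nonunits z : nonunits z <-> cf z 0%MM = 0.
Proof.
split=> [nz|z0]; last first.
  apply/negP => uz; have := congr1 (cf^~ 0%MM) (mulrV uz).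
  rewrite /= cfM_0 z0 mul0r cf1 eqxx => /esym/eqP.
  by rewrite oner_eq0.
have [//|z0] := eqVneq (cf z 0%MM) 0; case/negP: nz; apply/unitrPr.
have [|q qE] := @division_unit z 1 z0; last by exists q.
move=> d; pose c := (cf z 0%MM)^-1; pose h := 1 - c *: z.
exists (c *: \sum_(i < d) h ^+ i).
have -> : 1 - z * (c *: \sum_(i < d) h ^+ i) = h ^+ d.
  rewrite -scalerAr scalerAl.
  have -> : c *: z = - (h - 1) by rewrite /h !opprB addrC subrK.
  by rewrite mulNr -subrX1 opprK addrC subrK.
have h1 : vord 1 h.
  move=> m; rewrite ltnS leqn0 mdeg_eq0 => /eqP ->.
  by rewrite cfB cfZ cf1 eqxx mulVf ?subrr.
elim: d => [|d IH]; first by [].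
by rewrite exprS -add1n; apply: vordM.
Qed.

Lemma analytic_local : local_alg O.
Proof.
split=> [z z'|z].
  by move=> /cf_nonunits z0 /cf_nonunits z0'; apply/cf_nonunits; rewrite cfD z0 z0' addr0.
exists (cf z 0%MM); apply/cf_nonunits.
by rewrite cfB cfZ cf1 eqxx mulr1 subrr.
Qed.

Lemma cf_nonunits_sq z : nonunits_sq z -> forall j, cf z U_(j)%MM = 0.
Proof.
move=> sqz j; suff : vord 2 z by apply; rewrite mdeg1.
apply: (@ideal_gen_min _ _ _ [set z | vord 2 z]) sqz.
  split=> [m _|x y x2 y2 m lt_m|a x x2] /=; first exact: cf0.
    by rewrite cfD x2 ?y2 ?addr0.
  by rewrite -[2%N]add0n; apply: vordM.
move=> _ [x [y [/cf_nonunits x0 /cf_nonunits y0 ->]]].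
rewrite -[2%N]/(1 + 1)%N; apply: vordM => m;
  by rewrite ltnS leqn0 mdeg_eq0 => /eqP ->.
Qed.

Lemma analytic_lin (y : 'I_n -> O) : coordinates y ->
  (\matrix_(i, j) cf (y i) U_(j)%MM) \in unitmx.
Proof.
move=> [ny ygen]; rewrite -row_full_unit -sub1mx; apply/row_subP => j; rewrite row1.
have [x xE] := lift_poly 'X_j.
have : nonunits x by apply/cf_nonunits; rewrite xE mcoeffX mnm1_eq0.
rewrite -ygen => /ideal_gen_rangeP[al alE].
apply/submxP; exists (\row_i cf (al i) 0%MM); apply/rowP => l.
rewrite !mxE eqxx /= eq_sym -(@mcoeffXU n K) -xE alE cf_sum; apply: eq_bigr => i _.
by rewrite cfM_U (cf_nonunits (y i)).1 // mulr0 addr0 !mxE.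
Qed.

Lemma analytic_dim (y : 'I_n -> O) : coordinates y -> gradients_free y.
Proof.
move=> ycoord; have Yu := analytic_lin ycoord; set Y := \matrix_(_, _) _ in Yu.
move=> d /cf_nonunits_sq sqd i.
have : \row_i d i *m Y = 0.
  apply/rowP => j; rewrite !mxE -[RHS](sqd j) cf_sum; apply: eq_bigr => l _.
  by rewrite !mxE cfZ.
move/(congr1 (mulmx^~ (invmx Y))); rewrite mulmxK // mul0mx => /rowP/(_ i).
by rewrite !mxE.
Qed.

Lemma analytic_prime (y : 'I_n -> O) (u a b : O) : coordinates y ->
  nonunits u -> ~ nonunits_sq u ->
  (exists q, a * b = u * q) -> (exists q, a = u * q) \/ (exists q, b = u * q).
Proof.
move=> ycoord nu nsu [q abE]; have u0 := (cf_nonunits u).1 nu.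
(* If all linear coefficients of [u] were zero, its coefficients on the coordinates [y] would vanish
   at the point, and [u] would be in m^2. *)
have [i ui] : exists i, cf u U_(i)%MM != 0.
  apply: contrapT => /forallNP uU; apply: nsu; have := nu.
  have [ny ygen] := ycoord; rewrite -ygen => /ideal_gen_rangeP[al alE].
  have : \row_i cf (al i) 0%MM *m \matrix_(i, j) cf (y i) U_(j)%MM = 0.
    apply/rowP => j; rewrite !mxE; have /negP := uU j; rewrite negbK => /eqP uj.
    rewrite -[RHS]uj alE cf_sum; apply: eq_bigr => l _.
    by rewrite cfM_U (cf_nonunits (y l)).1 // mulr0 addr0 !mxE.
  move/(congr1 (mulmx^~ (invmx (\matrix_(i, j) cf (y i) U_(j)%MM)))).
  rewrite mulmxK ?analytic_lin // mul0mx => /rowP al0.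
  rewrite alE; apply: ideal_sum => [|l _]; first exact: nonunits_sq_ideal.
  apply: nonunits_sqM => //; apply/cf_nonunits.
  by have := al0 l; rewrite !mxE.
have close z : (forall d, exists h, vord d (z - u * h)) -> exists q, z = u * q.
  exact: division_param u0 ui.
suff : (forall d, exists h, vord d (a - u * h)) \/ (forall d, exists h, vord d (b - u * h)).
  by case=> /close; [left | right].
apply: contrapT => /not_orP[/existsNP[d1 n1] /existsNP[d2 n2]].
(* The two extra degrees keep the linear coefficients of [u] in its truncation even for [d = 0]. *)
pose d := maxn d1 d2; pose D := (d + d).+2.
pose w (_ : 'I_1) := trunc D u.
have w1 j : ord_ge 1 (w j) by apply/ord_ge1P; rewrite truncE // mdeg0.
have wfree : row_free (jac w).
  apply: inj_row_free => v /rowP/(_ i); rewrite !mxE big_ord1 mxE truncE ?mdeg1 // => /eqP.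
  rewrite mulf_eq0 (negPf ui) orbF => /eqP v0.
  by apply/rowP => j; rewrite ord1 v0 mxE.
have lt_dD m : (mdeg m < d + d)%N -> (mdeg m < D)%N by move=> h; rewrite !ltnS ltnW // ltnW.
have pq : exists h : 'I_1 -> {mpoly K[n]},
    ord_ge (d + d) (trunc D a * trunc D b - \sum_i h i * w i).
  exists (fun=> trunc D q) => m /lt_dD lt_m; rewrite big_ord1 mulrC mcoeffB.
  rewrite mulrC -cfM_trunc // abE mulrC (@cfM_trunc D) // subrr //.
have back z : (exists h : 'I_1 -> {mpoly K[n]}, ord_ge d (trunc D z - \sum_i h i * w i)) ->
    exists h, vord d (z - u * h).
  case=> h; rewrite big_ord1 => hd; have [g gE] := lift_poly (h ord0).
  exists g => m lt_m; have lt_mD : (mdeg m < D)%N.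
    by apply: lt_dD; apply: leq_trans lt_m _; rewrite leq_addr.
  have := hd m lt_m; rewrite mcoeffB truncE // => <-.
  rewrite cfB; congr (_ - _); rewrite mulrC (@cfM_trunc D) //.
  rewrite !mcoeffM; apply: eq_bigr => -[[k lt_k] [l lt_l]] _ /=; congr (_ * _).
  by rewrite truncE ?gE // (leq_trans lt_k).
case: (independent_ideal_prime w1 wfree pq) => /back[h hd].
  by apply: n1; exists h; apply: vordW hd; rewrite leq_maxl.
by apply: n2; exists h; apply: vordW hd; rewrite leq_maxr.
Qed.

Lemma analytic_regular : regular_germ O n.
Proof.
split=> [|y ycoord]; first exact: analytic_local.
split; first exact: analytic_dim.
by move=> u a b; apply: analytic_prime ycoord.
Qed.

End ConvergentSeries.

(** Taylor coefficients are pulled back along [iota], so that they lie in the field over which [O]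
    is an algebra; the absolute value is that of the image. *)
Lemma smooth_analytic_regular (K : closedFieldType) (O : comUnitAlgType K) n :
  smooth_analytic_germ O n -> regular_germ O n.
Proof.
case=> R [iota [coef [iota_bij [coef_inj coef_conv] coefZ coefD coefM]]].
have [iotaV iotaK iotaVK] := iota_bij.
pose nrm c := ComplexField.Normc.normc (iota c).
pose cf z m := iotaV (coef z m).
have iota_cf z m : iota (cf z m) = coef z m by rewrite /cf iotaVK.
have iota_inj : injective iota := bij_inj iota_bij.
apply: (@analytic_regular _ _ _ R nrm cf).
- by rewrite /nrm rmorph0 ComplexField.Normc.normc0.
- by move=> c; rewrite /nrm; case: (iota c) => x y; apply: sqrtr_ge0.
- by move=> c /ComplexField.Normc.eq0_normc/eqP; rewrite fmorph_eq0 => /eqP.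
- by move=> a b; rewrite /nrm rmorphD; apply: le_normcD.
- by move=> a b; rewrite /nrm rmorphM ComplexField.Normc.normcM.
- move=> z w zw; apply: coef_inj; apply/funext => m.
  by rewrite -!iota_cf zw.
- move=> z; have /coef_conv[rho [M [rho0 hM]]] : exists z', coef z' = coef z by exists z.
  exists rho, M; split=> // d; apply: le_trans (hM d); apply: ler_sum => m _.
  by rewrite /nrm iota_cf.
- move=> b [rho [M [rho0 hM]]].
  have /coef_conv[z zE] : convergent (fun m => iota (b m)) by exists rho, M.
  by exists z => m; apply: iota_inj; rewrite iota_cf zE.
- by move=> c z m; apply: iota_inj; rewrite rmorphM !iota_cf coefZ.
- by move=> z w m; apply: iota_inj; rewrite rmorphD !iota_cf coefD.
- move=> z w m; apply: iota_inj; rewrite iota_cf coefM rmorph_sum.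
  by apply: eq_bigr => h _; rewrite rmorphM !iota_cf.
Qed.

Lemma smooth_germ_regular (K : closedFieldType) (O : comUnitAlgType K) n :
  smooth_germ O n -> regular_germ O n.
Proof. by case=> [/smooth_algebraic_regular|/smooth_analytic_regular]. Qed.

(** * Gradients *)

(** With [I] the maximal ideal, this shows that a matrix congruent to the identity is invertible. *)
Lemma det_congr (A : comNzRingType) (I : set A) n (M N : 'M[A]_n) : is_ideal I ->
  (forall i j, I (M i j - N i j)) -> I (\det M - \det N).
Proof.
move=> Iid MN; have [I0 ID IM] := Iid; rewrite -sumrB; apply: big_ind => // s _.
rewrite -mulrBr; apply: (IM).
elim/big_rec2: _ => [|i x y _ xy]; first by rewrite subrr.
have -> : M i (s i) * y - N i (s i) * x
    = M i (s i) * (y - x) + x * (M i (s i) - N i (s i)) by ring.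
by apply: ID; apply: (IM).
Qed.

Section LocalAlgebra.
Variables (K : closedFieldType) (O : comUnitAlgType K).
Hypothesis Oloc : local_alg O.
Implicit Types (z w u a b : O).

Let m_ideal : is_ideal (@nonunits K O) := nonunits_ideal Oloc.

Lemma nonunitsZ (c : K) z : nonunits z -> nonunits (c *: z).
Proof. exact: idealZ. Qed.

Lemma scalar_nonunits (c : K) : nonunits (c%:A : O) -> c = 0.
Proof.
move=> nc; apply: contrapT => /eqP c0; case/negP: nc.
by rewrite -in_algE rmorph_unit // unitfE.
Qed.

Lemma unit_residue u (c : K) : nonunits (u - c%:A) -> u \is a GRing.unit <-> c != 0.
Proof.
move=> nu; split=> [uu|c0].
  by apply: contraTneq uu => c0; rewrite c0 scale0r subr0 in nu.
apply: contraT => nnu; case/eqP: c0; apply: scalar_nonunits.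
by rewrite -[c%:A](subKr u); apply: idealB.
Qed.

Lemma nonunits1B a : nonunits a -> 1 - a \is a GRing.unit.
Proof.
move=> na; apply/(@unit_residue _ 1); last exact: oner_neq0.
by rewrite scale1r addrAC subrr add0r -mulN1r; apply: nonunitsM.
Qed.

Lemma assoc_ideal a u : u \is a GRing.unit -> ideal_gen [set u * a] = ideal_gen [set a].
Proof.
move=> uu; apply/seteqP; split; apply: ideal_gen_min; try exact: ideal_gen_ideal.
  by move=> _ ->; apply/ideal_gen1P; exists u.
by move=> _ ->; apply/ideal_gen1P; exists u^-1; rewrite mulrA mulVr // mul1r.
Qed.

(** From [a = u * b] and [b = v * a], a nonunit [u] would make [1 - v * u] a unit annihilating
    [b]. *)
Lemma ideal_assoc a b : b != 0 -> ideal_gen [set a] = ideal_gen [set b] ->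
  exists2 u, u \is a GRing.unit & a = u * b.
Proof.
move=> b0 ab; have /ideal_gen1P[u aE] : ideal_gen [set b] a.
  by rewrite -ab; apply: sub_ideal_gen.
have /ideal_gen1P[v bE] : ideal_gen [set a] b by rewrite ab; apply: sub_ideal_gen.
exists u => //; apply: contraNT b0 => nu.
have /nonunits1B uvU : nonunits (v * u) by apply: nonunitsM.
by rewrite -(mulKr uvU b) mulrBl mul1r -mulrA -aE -bE subrr mulr0.
Qed.

(** Modulo m^2, every [z] is a constant plus a combination of the [y j] over [K], and the
    coefficients are unique because the gradients of the [y j] are independent. The gradient is
    defined on all of [O], where it kills constants. *)
Lemma linear_gradient n (y : 'I_n -> O) : coordinates y -> gradients_free y ->
  exists lin : {linear O -> 'rV[K]_n}, [/\ lin 1 = 0,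
    forall z, nonunits_sq z -> lin z = 0,
    forall z, nonunits z -> lin z = 0 -> nonunits_sq z &
    forall j, lin (y j) = delta_mx 0 j].
Proof.
move=> [ny ygen] yfree; have sq_id := @nonunits_sq_ideal K O.
have /choice[lin hlin] z : exists c : 'rV[K]_n, exists c0 : K,
    nonunits_sq (z - c0%:A - \sum_j c 0 j *: y j).
  have [c0 nz] := Oloc.2 z; have := nz; rewrite -ygen => /ideal_gen_rangeP[al alE].
  have /choice[c hc] j := Oloc.2 (al j).
  exists (\row_j c j), c0; rewrite alE -sumrB; apply: ideal_sum => // j _.
  by rewrite mxE -mulr_algl -mulrBl; apply: nonunits_sqM.
have uniq z (c : 'rV[K]_n) (c0 : K) :
    nonunits_sq (z - c0%:A - \sum_j c 0 j *: y j) -> lin z = c.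
  move=> hc; have [c0' hc'] := hlin z.
  have ysum_n (d : 'rV[K]_n) : nonunits (\sum_j d 0 j *: y j).
    by apply: ideal_sum => // j _; apply: nonunitsZ.
  have sqB := idealB sq_id hc hc'.
  have Ec0 : c0' - c0 = 0.
    apply: scalar_nonunits; rewrite scalerBl.
    have := nonunits_sq_sub Oloc sqB.
    set A := c0'%:A; set B := c0%:A; set S := \sum_j _; set S' := \sum_j _ => h.
    have -> : A - B = z - B - S - (z - A - S') + (S - S') by ring.
    case: m_ideal => _ mD _; apply: mD; first exact: h.
    by apply: (idealB m_ideal); apply: ysum_n.
  apply/eqP; rewrite -subr_eq0; apply/eqP/rowP => j; rewrite [RHS]mxE.
  move: j; apply: yfree.
  have -> : \sum_j (lin z - c) 0 j *: y j =
      (z - c0%:A - \sum_j c 0 j *: y j) - (z - c0'%:A - \sum_j lin z 0 j *: y j).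
    move/eqP: Ec0; rewrite subr_eq0 => /eqP ->.
    rewrite (_ : \sum_j _ = \sum_j lin z 0 j *: y j - \sum_j c 0 j *: y j); first by ring.
    by rewrite -sumrB; apply: eq_bigr => j _; rewrite !mxE scalerBl.
  exact: sqB.
have lin_linear : linear lin.
  move=> a z w; have [c0 hz] := hlin z; have [d0 hw] := hlin w.
  apply: (uniq _ _ (a * c0 + d0)).
  have := idealZ a sq_id hz; case: sq_id => _ sqD _ => /sqD/(_ hw).
  congr nonunits_sq; rewrite !scalerBr scaler_sumr scalerA scalerDl.
  have -> : \sum_j (a *: lin z + lin w) 0 j *: y j =
      \sum_j a *: (lin z 0 j *: y j) + \sum_j lin w 0 j *: y j.
    by rewrite -big_split; apply: eq_bigr => j _; rewrite !mxE scalerDl scalerA.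
  by ring.
pose L : {linear O -> 'rV[K]_n} := HB.pack lin (GRing.isLinear.Build _ _ _ _ _ lin_linear).
exists L; split=> /=.
- apply: (uniq _ _ 1); rewrite scale1r subrr sub0r big1 ?oppr0; first by case: sq_id.
  by move=> j _; rewrite mxE scale0r.
- move=> z sqz; apply: (uniq _ _ 0); rewrite scale0r subr0 big1 ?subr0 // => j _.
  by rewrite mxE scale0r.
- move=> z nz z0; have [c0] := hlin z; rewrite z0 big1 ?subr0 => [sqz|j _]; last first.
    by rewrite mxE scale0r.
  suff c00 : c0 = 0 by rewrite c00 scale0r subr0 in sqz.
  apply: scalar_nonunits; rewrite -[c0%:A](subKr z).
  by apply: idealB => //; apply: nonunits_sq_sub.
move=> j; apply: (uniq _ _ 0); rewrite scale0r subr0 (bigD1 j) //= big1 => [|l ne_lj].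
  by rewrite mxE !eqxx scale1r addr0 subrr; case: sq_id.
by rewrite mxE (negPf ne_lj) scale0r.
Qed.

Lemma gradient_mul n (lin : {linear O -> 'rV[K]_n}) a z (c : K) :
  (forall z, nonunits_sq z -> lin z = 0) -> nonunits z -> nonunits (a - c%:A) ->
  lin (a * z) = c *: lin z.
Proof.
move=> lin_sq nz na; apply/eqP; rewrite -subr_eq0 -linearZ -raddfB; apply/eqP/lin_sq.
by rewrite -mulr_algl -mulrBl; apply: nonunits_sqM.
Qed.

Lemma nakayama n (y z : 'I_n -> O) (lin : {linear O -> 'rV[K]_n}) :
  coordinates y -> (forall z, nonunits_sq z -> lin z = 0) ->
  (forall z, nonunits z -> lin z = 0 -> nonunits_sq z) ->
  (forall j, nonunits (z j)) -> (\matrix_i lin (z i)) \in unitmx -> coordinates z.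
Proof.
move=> [ny ygen] lin_sq sq_lin nz; set Z := \matrix_i _ => Zu; split=> //.
have zid := ideal_gen_ideal (range z); have [z0 zD zM] := zid.
apply/seteqP; split.
  by apply: ideal_gen_min => // _ [j _ <-].
suff yz j : ideal_gen (range z) (y j).
  by rewrite -ygen; apply: ideal_gen_min => // _ [j _ <-].
(* y = B z + N y with N in m, and 1 - N is invertible *)
have /choice[B hB] i : exists B : 'I_n -> K, nonunits_sq (y i - \sum_j B j *: z j).
  exists (fun j => (lin (y i) *m invmx Z) 0 j); apply: sq_lin.
    by apply: idealB => //; apply: ideal_sum => // l _; apply: nonunitsZ.
  rewrite raddfB raddf_sum /=; apply/eqP; rewrite subr_eq0; apply/eqP.
  rewrite -[LHS](mulmxKV Zu) mulmx_sum_row; apply: eq_bigr => l _.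
  by rewrite linearZ /= rowK.
have sq_y w : nonunits_sq w -> exists N : 'I_n -> O,
    (forall j, nonunits (N j)) /\ w = \sum_j N j * y j.
  apply: (@ideal_gen_min _ _ _ [set w | exists N : 'I_n -> O,
    (forall j, nonunits (N j)) /\ w = \sum_j N j * y j]).
    split=> [|_ _ [N [nN ->]] [N' [nN' ->]]|c _ [N [nN ->]]].
    - exists (fun=> 0); split=> [l|]; first by rewrite /nonunits /= unitr0.
      by rewrite big1 // => l _; rewrite mul0r.
    - exists (fun j => N j + N' j); split=> [l|]; first exact: Oloc.1.
      by rewrite -big_split; apply: eq_bigr => l _; rewrite mulrDl.
    - exists (fun j => c * N j); split=> [l|]; first exact: nonunitsM.
      by rewrite mulr_sumr; apply: eq_bigr => l _; rewrite mulrA.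
  move=> _ [v [v' [nv nv' ->]]]; have /ideal_gen_rangeP[al ->] : ideal_gen (range y) v' by rewrite ygen.
  exists (fun l => al l * v); split=> [l|]; first exact: nonunitsM.
  by rewrite mulr_sumr; apply: eq_bigr => l _; rewrite mulrA [v * _]mulrC.
have /choice[N hN] i := sq_y _ (hB i).
pose P : 'M[O]_n := 1%:M - \matrix_(i, j) N i j.
(* [P] is the identity modulo m, so its determinant has residue 1. *)
have Pu : P \in unitmx.
  rewrite unitmxE; apply/(@unit_residue _ 1); last exact: oner_neq0.
  rewrite scale1r -(det1 O n); apply: (det_congr m_ideal) => i l.
  rewrite !mxE [_ - _ - _]addrAC subrr sub0r -mulN1r.
  by apply: nonunitsM; case: (hN i).
have PY : P *m \col_i y i = \col_i \sum_l B i l *: z l.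
  apply/colP => i; rewrite mulmxBl mul1mx !mxE; have [_ E] := hN i.
  rewrite (_ : \sum_l _ = \sum_l N i l * y l); first by rewrite -E opprB addrC subrK.
  by apply: eq_bigr => l _; rewrite !mxE.
have /colP/(_ j) := mulKmx Pu (\col_i y i); rewrite PY !mxE => <-.
apply: ideal_sum => // l _; apply: zM; rewrite mxE; apply: ideal_sum => // i _.
by apply: idealZ => //; apply: sub_ideal_gen; exists i.
Qed.

End LocalAlgebra.

(** * Eigenvectors *)

Section CompatibleRoots.
Variables (K : closedFieldType) (eps : nat -> K).
Hypothesis heps : compatible_roots eps.

Lemma eps_prim p : (0 < p)%N -> p.-primitive_root (eps p).
Proof. by case: heps => h _; apply: h. Qed.

Lemma eps_neq0 p : (0 < p)%N -> eps p != 0.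
Proof.
move=> p0; apply/eqP => e0; have := prim_expr_order (eps_prim p0).
by rewrite e0 expr0n gtn_eqF // => /esym/eqP; rewrite oner_eq0.
Qed.

End CompatibleRoots.

Section Eigenvectors.
Variables (K : closedFieldType) (charK : [pchar K] =i pred0).
Variables (O : comUnitAlgType K) (gT : finGroupType).
Variables (act : gT -> {lrmorphism O -> O}) (hact : group_action act).
Implicit Types (g h : gT) (z e : O) (I : set O).

Lemma natf_neq0_char0 m : (0 < m)%N -> m%:R != 0 :> K.
Proof. by rewrite lt0n; have /pcharf0P -> := charK. Qed.

Let act1 z : act 1%g z = z. Proof. by case: hact. Qed.

Let actM g h z : act (g * h)%g z = act g (act h z).
Proof. by case: hact => _; apply. Qed.

Lemma actK g z : act g^-1%g (act g z) = z.
Proof. by rewrite -actM mulVg act1. Qed.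

Lemma actVK g z : act g (act g^-1%g z) = z.
Proof. by rewrite -actM mulgV act1. Qed.

Lemma act_unit g z : (act g z \is a GRing.unit) = (z \is a GRing.unit).
Proof.
apply/idP/idP => [uz|]; last exact: rmorph_unit.
by rewrite -(actK g z); apply: rmorph_unit.
Qed.

Lemma act_nonunits g z : nonunits (act g z) <-> nonunits z.
Proof. by rewrite /nonunits /= act_unit. Qed.

Lemma act_ideal_gen g (A : set O) : act g @` ideal_gen A = ideal_gen (act g @` A).
Proof.
apply/seteqP; split=> [_ [_ [m [u [v [Av ->]]]] <-]|_ [m [u [v [Av ->]]]]].
  exists m, (act g \o u), (act g \o v); split=> [i|]; first by exists (v i).
  by rewrite raddf_sum; apply: eq_bigr => i _; rewrite /= rmorphM.
exists (\sum_i act g^-1%g (u i) * act g^-1%g (v i)).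
  apply: ideal_sum => [|i _]; first exact: ideal_gen_ideal.
  have [_ _ IM] := ideal_gen_ideal A; apply/IM/sub_ideal_gen.
  by have [z Az <-] := Av i; rewrite actK.
by rewrite raddf_sum; apply: eq_bigr => i _; rewrite /= rmorphM /= !actVK.
Qed.

Lemma act_ideal1 g (a : O) : act g @` ideal_gen [set a] = ideal_gen [set act g a].
Proof. by rewrite act_ideal_gen image_set1. Qed.

Lemma act_nonunits_sq g z : nonunits_sq z -> nonunits_sq (act g z).
Proof.
move=> sqz; have : (act g @` @nonunits_sq K O) (act g z) by exists z.
rewrite act_ideal_gen; apply: ideal_gen_min; first exact: nonunits_sq_ideal.
move=> _ [_ [a [b [na nb ->]] <-]]; rewrite rmorphM.
by apply: nonunits_sqM; apply/act_nonunits.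
Qed.

(** Write [act g e = u g * e]. The residues [c g] of the [u g] form a character of [A], and the sum
    of the [(c g)^-1 *: act g e] is an eigenvector. It is [e] times an element of residue [#|A|], a
    unit in characteristic zero. *)
Lemma semi_invariant (A : {group gT}) e : local_alg O -> e != 0 ->
  (forall g, g \in A -> ideal_gen [set act g e] = ideal_gen [set e]) ->
  exists w (chi : gT -> K), w \is a GRing.unit /\
    forall g, g \in A -> act g (w * e) = chi g *: (w * e).
Proof.
move=> Oloc e0 Ae; have mid := nonunits_ideal Oloc.
have /choice[u hu] g : exists u, g \in A -> u \is a GRing.unit /\ act g e = u * e.
  have [gA|gA] := boolP (g \in A); last by exists 0.
  by have [u uu E] := ideal_assoc Oloc e0 (Ae g gA); exists u.
have uU g : g \in A -> u g \is a GRing.unit by move=> /hu[].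
have uE g : g \in A -> act g e = u g * e by move=> /hu[].
have /choice[c hc] g := Oloc.2 (u g).
have c0 g : g \in A -> c g != 0 by move=> gA; apply/(unit_residue Oloc (hc g))/uU.
have cM g h : g \in A -> h \in A -> c (h * g)%g = c h * c g.
  move=> gA hA; apply/eqP; rewrite -subr_eq0; apply/eqP.
  apply: (@scalar_nonunits _ O).
  (* The cocycle relation is known only after multiplication by [e]. As [e] is nonzero, the
     difference of its two sides is a nonunit, which suffices for residues. *)
  have n1 : nonunits (u (h * g)%g - act h (u g) * u h).
    apply/negP => uU'; case/eqP: e0; apply: (mulrI uU').
    by rewrite mulr0 mulrBl -mulrA -!uE ?groupM // actM uE // rmorphM /= subrr.
  have n2 : nonunits (act h (u g) - (c g)%:A).
    have /(act_nonunits h) := hc g; congr nonunits.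
    by rewrite raddfB /= linearZ /= rmorph1.
  have n3 : nonunits (act h (u g) * u h - (c h * c g)%:A).
    have -> : act h (u g) * u h - (c h * c g)%:A =
        u h * (act h (u g) - (c g)%:A) + (c g)%:A * (u h - (c h)%:A).
      by rewrite mulrBr mulrBr !mulr_algl !mulr_algr scalerA [c g * _]mulrC; ring.
    by apply: Oloc.1; apply: nonunitsM.
  have := idealB mid (Oloc.1 _ _ n1 n3) (hc (h * g)%g).
  by congr nonunits; rewrite scalerBl; ring.
exists (\sum_(g in A) (c g)^-1 *: u g), c; split.
  apply/(@unit_residue _ _ Oloc _ #|A|%:R); last exact/natf_neq0_char0/cardG_gt0.
  rewrite -sum1_card natr_sum scaler_suml -sumrB; apply: ideal_sum => // g gA.
  have -> : (c g)^-1 *: u g - 1%:A = (c g)^-1 *: (u g - (c g)%:A).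
    by rewrite scalerBr scalerA mulVf ?c0.
  exact: nonunitsZ.
move=> h hA.
have E : (\sum_(g in A) (c g)^-1 *: u g) * e = \sum_(g in A) (c g)^-1 *: act g e.
  by rewrite mulr_suml; apply: eq_bigr => g gA; rewrite -scalerAl uE.
rewrite E raddf_sum scaler_sumr [RHS](reindex_inj (mulgI h)) /=.
apply: eq_big => [g|g gA]; first by rewrite groupMl.
by rewrite linearZ /= actM scalerA cM // invfM mulrA divff ?c0 // mul1r.
Qed.

(** On vectors where [y ^+ q] acts as [theta ^+ q], this is the projector onto the
    [theta]-eigenspace of [y]; the order of [y] may be larger than [q]. *)
Definition eigproj (y : gT) (q : nat) (theta : K) z : O :=
  q%:R^-1 *: \sum_(b < q) theta^-1 ^+ b *: act (y ^+ b)%g z.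

Lemma eigprojE y q theta z : (0 < q)%N -> theta != 0 ->
  act (y ^+ q)%g z = theta ^+ q *: z ->
  act y (eigproj y q theta z) = theta *: eigproj y q theta z.
Proof.
case: q => // q _ th0 yq; rewrite linearZ scalerA mulrC -scalerA; congr (_ *: _).
rewrite raddf_sum scaler_sumr big_ord_recr /= big_ord_recl /= expr0 scale1r.
rewrite expg0 act1 linearZ /= -actM -expgS yq scalerA addrC; congr (_ + _).
  by rewrite exprVn exprS mulrCA mulVf ?expf_neq0 // mulr1.
apply: eq_bigr => i _; rewrite linearZ /= -actM -expgS scalerA; congr (_ *: _).
by rewrite exprS mulrA divff // mul1r.
Qed.

Lemma eigproj_comm y q theta z g lam : commute g y -> act g z = lam *: z ->
  act g (eigproj y q theta z) = lam *: eigproj y q theta z.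
Proof.
move=> gy gz; rewrite linearZ scalerA mulrC -scalerA; congr (_ *: _).
rewrite raddf_sum scaler_sumr; apply: eq_bigr => i _.
rewrite [LHS]linearZ /= -actM (commuteX i gy) actM gz [act _ _]linearZ /=.
by rewrite !scalerA mulrC.
Qed.

Lemma eigproj_ideal y q theta z I : is_ideal I -> (forall g w, I w -> I (act g w)) ->
  I z -> I (eigproj y q theta z).
Proof.
move=> Iid Iact Iz; apply: idealZ => //; apply: ideal_sum => // b _.
by apply: idealZ => //; apply: Iact.
Qed.

(** Orthogonality of characters: summation over [a] leaves only the term [b = 0]. *)
Lemma eigproj_sum y q theta zeta z : (0 < q)%N -> q.-primitive_root zeta ->
  \sum_(a < q) eigproj y q (theta * zeta ^+ a) z = z.
Proof.
move=> q0 prim; rewrite -scaler_sumr exchange_big /=.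
have z0 : zeta != 0.
  apply/eqP => e0; have := prim_expr_order prim.
  by rewrite e0 expr0n gtn_eqF // => /esym/eqP; rewrite oner_eq0.
rewrite (bigD1 (Ordinal q0)) //= [X in _ + X]big1 => [|b b0].
  under eq_bigr do rewrite expr0 scale1r expg0 act1.
  rewrite sumr_const card_ord addr0 -scaler_nat scalerA mulVf ?scale1r //.
  exact: natf_neq0_char0.
rewrite -scaler_suml; apply/eqP; rewrite scaler_eq0; apply/orP; left.
have E (a : nat) : (theta * zeta ^+ a)^-1 ^+ b = theta^-1 ^+ b * (zeta ^+ b)^-1 ^+ a.
  by rewrite invfM exprMn; congr (_ * _); rewrite !exprVn -!exprM mulnC.
under eq_bigr do rewrite E.
rewrite -mulr_sumr mulf_eq0; apply/orP; right.
have zb : (zeta ^+ b)^-1 != 1.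
  rewrite invr_eq1 -(prim_order_dvd prim) /dvdn modn_small; last exact: (ltn_ord b).
  by move: b0; apply: contra_neq => bE; apply: val_inj.
have : ((zeta ^+ b)^-1 - 1) * \sum_(a < q) (zeta ^+ b)^-1 ^+ a = 0.
  rewrite -subrX1 exprVn -exprM mulnC exprM (prim_expr_order prim) expr1n.
  by rewrite invr1 subrr.
by move/eqP; rewrite mulf_eq0 subr_eq0 (negPf zb).
Qed.

Section Decomposition.
Variables (eps : nat -> K) (heps : compatible_roots eps).
Variables (r : nat) (p : nat -> nat) (x : nat -> gT).
Hypothesis p_gt0 : forall i, (i < r)%N -> (0 < p i)%N.
Hypothesis ord_x : forall i, (i < r)%N -> #[x i]%g = p i.
Hypothesis comm_x : forall i j, (i < r)%N -> (j < r)%N -> commute (x i) (x j).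

Definition eigenvector z : Prop :=
  forall i, (i < r)%N -> exists lam : K, act (x i) z = lam *: z.

Lemma eigenvalue_root i z lam : (i < r)%N -> act (x i) z = lam *: z ->
  exists c : nat, act (x i) z = eps (p i) ^+ c *: z.
Proof.
move=> lt_ir xz; have [->|z0] := eqVneq z 0.
  by exists 0%N; rewrite scaler0 raddf0.
have actX b : act (x i ^+ b)%g z = lam ^+ b *: z.
  elim: b => [|b IH]; first by rewrite expg0 act1 scale1r.
  by rewrite expgS actM IH linearZ /= xz scalerA exprSr.
have lam1 : lam ^+ p i = 1.
  have := actX (p i); rewrite -(ord_x lt_ir) expg_order act1 => /eqP.
  rewrite -{1}[z]scale1r -subr_eq0 -scalerBl scaler_eq0 (negPf z0) orbF subr_eq0.
  by move=> /eqP.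
have [c cE] := prim_rootP (eps_prim heps (p_gt0 lt_ir)) lam1.
by exists c; rewrite -cE.
Qed.

(** The projectors of the commuting generators are applied in turn, with all [p j]-th roots of unity
    as eigenvalues. Hence eigenvectors span m / m^2. *)
Lemma eigen_decomposition z : local_alg O -> nonunits z ->
  exists s : seq O, z = \sum_(w <- s) w /\
    forall w, w \in s -> nonunits w /\ eigenvector w.
Proof.
move=> Oloc nz; have mid := nonunits_ideal Oloc.
suff: forall j, (j <= r)%N -> exists s : seq O, z = \sum_(w <- s) w /\
    forall w, w \in s -> nonunits w /\
      forall i, (i < j)%N -> exists lam : K, act (x i) w = lam *: w.
  by move=> /(_ r (leqnn r)).
elim=> [|j IH] lt_jr; first by exists [:: z]; rewrite big_seq1; split=> // w; rewrite inE => /eqP->.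
have [s [zE hs]] := IH (ltnW lt_jr).
pose pr a w := eigproj (x j) (p j) (1 * eps (p j) ^+ a) w.
exists [seq pr a w | w <- s, a <- index_iota 0 (p j)]; split.
  rewrite big_allpairs_dep /= zE; apply: eq_bigr => w _.
  rewrite big_mkord eigproj_sum ?p_gt0 //.
  exact/eps_prim/p_gt0.
move=> _ /allpairsPdep[w [a [ws _ ->]]]; have [nw hw] := hs w ws; split.
  by apply: eigproj_ideal => // g v /act_nonunits.
move=> i; rewrite ltnS leq_eqVlt => /predU1P[->|lt_ij].
  exists (1 * eps (p j) ^+ a); apply: eigprojE; first exact: p_gt0.
    by rewrite mul1r expf_neq0 // eps_neq0 // p_gt0.
  rewrite -{1}(ord_x lt_jr) expg_order act1 mul1r exprAC.
  by rewrite (prim_expr_order (eps_prim heps (p_gt0 lt_jr))) expr1n scale1r.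
have [lam xw] := hw i lt_ij; exists lam; apply: eigproj_comm => //.
by apply: comm_x => //; apply: ltn_trans lt_jr.
Qed.

End Decomposition.

End Eigenvectors.

(** * The action on the factors *)

Section FactorPermutation.
Variables (K : closedFieldType) (O : comUnitAlgType K).
Hypothesis Oloc : local_alg O.
Hypothesis Oprime : forall u a b : O, nonunits u -> ~ nonunits_sq u ->
  (exists q, a * b = u * q) -> (exists q, a = u * q) \/ (exists q, b = u * q).
Variables (gT : finGroupType) (act : gT -> {lrmorphism O -> O}).
Hypothesis hact : group_action act.
Variables (k : nat) (f : 'I_k -> O).
Hypothesis f_vanish : forall j, nonunits (f j).
Hypothesis f_free : gradients_free f.
Hypothesis I_inv : G_invariant act (ideal_gen [set \prod_j f j]).

Let act1 z : act 1%g z = z. Proof. by case: hact. Qed.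
Let actM g h z : act (g * h)%g z = act g (act h z).
Proof. by case: hact => _; apply. Qed.

Lemma free_not_nonunits_sq j : ~ nonunits_sq (f j).
Proof.
move=> sqf; have : nonunits_sq (\sum_i (i == j)%:R *: f i).
  rewrite (bigD1 j) //= eqxx scale1r big1 ?addr0 // => i /negPf ->.
  by rewrite scale0r.
by move=> /(f_free (c := fun i => (i == j)%:R))/(_ j)/eqP; rewrite eqxx oner_eq0.
Qed.

Lemma free_neq0 j : f j != 0.
Proof.
apply/eqP => f0; apply: (@free_not_nonunits_sq j); rewrite f0.
by case: (@nonunits_sq_ideal K O).
Qed.

(** Associated elements have proportional gradients. *)
Lemma free_ideal_inj j l : ideal_gen [set f j] = ideal_gen [set f l] -> j = l.
Proof.
move=> jl; apply: contrapT => /eqP ne_jl.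
have [u uu fE] := ideal_assoc Oloc (free_neq0 l) jl.
have [c nu] := Oloc.2 u.
have /(f_free (c := fun i => if i == j then 1 else if i == l then - c else 0)) :
    nonunits_sq (\sum_i (if i == j then 1 else if i == l then - c else 0) *: f i).
  have lj : (l == j) = false by rewrite eq_sym (negPf ne_jl).
  rewrite (bigD1 j) //= eqxx scale1r (bigD1 l) ?lj //= eqxx big1 ?addr0 => [|i /andP[/negPf -> /negPf ->]].
    rewrite {1}fE scaleNr -[c *: _]mulr_algl -mulrBl.
    exact: nonunits_sqM.
  by rewrite scale0r.
by move=> /(_ j)/eqP; rewrite eqxx oner_eq0.
Qed.

Lemma act_nonunits_sqE g z : nonunits_sq (act g z) <-> nonunits_sq z.
Proof.
split; last exact: act_nonunits_sq.
by move/(act_nonunits_sq hact (g^-1)%g); rewrite actK.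
Qed.

Lemma prime_prod (I : Type) (s : seq I) (P : pred I) (F : I -> O) u :
  nonunits u -> ~ nonunits_sq u -> (exists q, \prod_(i <- s | P i) F i = u * q) ->
  exists2 i, P i & exists q, F i = u * q.
Proof.
move=> nu nsu; elim: s => [|i s IH]; rewrite ?big_nil ?big_cons.
  case=> q E; case/negP: nu; have : u * q \is a GRing.unit by rewrite -E unitr1.
  by rewrite unitrM => /andP[].
case: ifP => Pi //; case/(Oprime nu nsu) => //.
by exists i.
Qed.

(** [act g (f j)] is prime and divides the product of the factors, hence some [f l]; the cofactor is
    a unit since [f l] is not in m^2. *)
Lemma act_factor g j : exists l,
  ideal_gen [set act g (f j)] = ideal_gen [set f l].
Proof.
have nu : nonunits (act g (f j)) by apply/(act_nonunits hact).
have nsu : ~ nonunits_sq (act g (f j)) by move/act_nonunits_sqE; apply: free_not_nonunits_sq.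
have : ideal_gen [set act g (\prod_j f j)] (\prod_j f j).
  by rewrite -act_ideal1 // I_inv; apply: sub_ideal_gen.
case/ideal_gen1P => a E.
have [|l _ [w fE]] := @prime_prod _ (index_enum 'I_k) predT f _ nu nsu.
  exists (a * \prod_(i | i != j) act g (f i)).
  by rewrite E rmorph_prod (bigD1 j) //= mulrCA.
exists l; rewrite fE [_ * w]mulrC assoc_ideal //; apply: contraT => nw.
by case: (@free_not_nonunits_sq l); rewrite fE; apply: nonunits_sqM.
Qed.

Definition fperm g j : 'I_k := projT1 (cid (act_factor g j)).

Lemma fpermE g j : ideal_gen [set act g (f j)] = ideal_gen [set f (fperm g j)].
Proof. exact: projT2 (cid (act_factor g j)). Qed.

Lemma fpermP g j l : fperm g j = l <-> ideal_gen [set act g (f j)] = ideal_gen [set f l].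
Proof. by split=> [<-|]; [exact: fpermE | rewrite fpermE; apply: free_ideal_inj]. Qed.

Lemma fperm1 j : fperm 1%g j = j.
Proof. by apply/fpermP; rewrite act1. Qed.

Lemma fpermM g h j : fperm (g * h)%g j = fperm g (fperm h j).
Proof.
apply/fpermP; rewrite actM -(act_ideal1 hact) fpermE (act_ideal1 hact).
exact: fpermE.
Qed.

Lemma fperm_inj g : injective (fperm g).
Proof.
by move=> j l /(congr1 (fperm g^-1%g)); rewrite -!fpermM mulVg !fperm1.
Qed.

Lemma fperm_stab g j : (g \in ideal_stab act (f j)) = (fperm g j == j).
Proof.
rewrite inE; apply/asboolP/eqP => [|/fpermP]; first by rewrite act_ideal1 // => /fpermP.
by rewrite act_ideal1.
Qed.

Lemma fperm_unit g j : exists2 u : O, u \is a GRing.unit & act g (f j) = u * f (fperm g j).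
Proof. by have := ideal_assoc Oloc (free_neq0 _) (fpermE g j). Qed.

(** The products over the orbit [B] of [j] and over its complement generate invariant ideals, so an
    [l] outside [B] would give a splitting. *)
Lemma fperm_transitive : ~ splits act (\prod_j f j) ->
  forall j l, exists g, fperm g j = l.
Proof.
move=> nosplit j l; apply: contrapT => nl; apply: nosplit.
pose B i := `[< exists g, fperm g j = i >].
have BP g i : B (fperm g i) = B i.
  apply/asboolP/asboolP => [[h hi]|[h <-]]; last by exists (g * h)%g; rewrite fpermM.
  by exists (g^-1 * h)%g; rewrite fpermM hi -fpermM mulVg fperm1.
have inv (C : pred 'I_k) : (forall g i, C (fperm g i) = C i) ->
    G_invariant act (ideal_gen [set \prod_(i | C i) f i]).
  move=> Cinv g; rewrite act_ideal1 // rmorph_prod.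
  have /choice[u hu] i : exists u, u \is a GRing.unit /\ act g (f i) = u * f (fperm g i).
    by have [u uu E] := fperm_unit g i; exists u.
  rewrite (eq_bigr (fun i => u i * f (fperm g i))); last by move=> i _; case: (hu i).
  rewrite big_split /= assoc_ideal; last first.
    by apply: rpred_prod => i _; case: (hu i).
  congr (ideal_gen [set _]); rewrite [RHS](reindex_inj (@fperm_inj g)).
  by apply: eq_bigl => i; rewrite Cinv.
exists (\prod_(i | B i) f i), (\prod_(i | ~~ B i) f i); split.
- by rewrite (bigID B).
- split.
    rewrite (bigD1 j) /=; last by apply/asboolP; exists 1%g; apply: fperm1.
    by rewrite mulrC; apply: nonunitsM.
  rewrite (bigD1 l) /=; last by apply/negP => /asboolP.
  by rewrite mulrC; apply: nonunitsM.
- exact: inv.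
- by apply: inv => g i; rewrite BP.
Qed.

End FactorPermutation.

(** * Mixed-radix digits *)

Section Digits.
Variable q : nat -> nat.

Lemma size_digits s j : size (digits q s j) = s.
Proof. exact: size_mkseq. Qed.

(** The last digit varies fastest, so dropping it is division by [q s]; the inductions below run on
    this. *)
Lemma digitsS s j : digits q s.+1 j = rcons (digits q s (j %/ q s)) (j %% q s)%N.
Proof.
apply: (@eq_from_nth _ 0%N) => [|i]; rewrite ?size_rcons !size_digits //.
move=> lt_i; rewrite nth_mkseq // nth_rcons size_digits.
move: lt_i; rewrite ltnS leq_eqVlt => /predU1P[->|lt_is].
  by rewrite ltnn eqxx big_geq // divn1.
rewrite lt_is nth_mkseq // big_nat_recr //= mulnC divnMA //.
Qed.

Lemma digits_lt s j i : (forall i, (i < s)%N -> (0 < q i)%N) -> (i < s)%N ->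
  (nth 0%N (digits q s j) i < q i)%N.
Proof. by move=> q0 lt_is; rewrite nth_mkseq // ltn_mod q0. Qed.

Lemma digits_surj s m : size m = s -> (forall i, (i < s)%N -> (nth 0%N m i < q i)%N) ->
  exists2 j, (j < \prod_(i < s) q i)%N & digits q s j = m.
Proof.
elim: s m => [|s IH] m; first by case: m => // _ _; exists 0%N; rewrite ?big_ord0.
case/lastP: m => // m a; rewrite size_rcons => -[sz_m] lt_m.
have [|j lt_j jE] := IH m sz_m.
  move=> i lt_i; have := lt_m i (ltnW lt_i); rewrite nth_rcons sz_m lt_i; apply.
have lt_a : (a < q s)%N by have := lt_m s (leqnn _); rewrite nth_rcons sz_m ltnn eqxx.
exists (j * q s + a)%N.
  rewrite big_ord_recr /=; apply: (@leq_trans (j * q s + q s)); first by rewrite ltn_add2l.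
  by rewrite addnC -mulSn leq_mul2r lt_j orbT.
rewrite digitsS divnMDl ?(leq_ltn_trans _ lt_a) // divn_small // addn0 jE.
by rewrite modnMDl modn_small.
Qed.

Lemma digits_inj s j l : (j < \prod_(i < s) q i)%N -> (l < \prod_(i < s) q i)%N ->
  digits q s j = digits q s l -> j = l.
Proof.
elim: s j l => [|s IH] j l; first by rewrite big_ord0 !ltnS !leqn0 => /eqP -> /eqP ->.
rewrite big_ord_recr /= => lt_j lt_l; rewrite !digitsS => /rcons_inj[E1 E2].
have q0 : (0 < q s)%N by case: (q s) lt_j; rewrite ?muln0.
by rewrite (divn_eq j (q s)) (divn_eq l (q s)) E2 (IH _ _ _ _ E1) // ltn_divLR.
Qed.

End Digits.

(** * Coset representatives along the subgroup chain *)

Section SubgroupChain.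
Variables (gT : finGroupType) (H : {group gT}) (x : nat -> gT) (r : nat) (q : nat -> nat).
Hypothesis gT_abelian : forall g h : gT, commute g h.
Hypothesis hq : forall i, (i < r)%N -> least_power_in (subgroup_chain H x i) (x i) (q i).

Lemma chain_group_set i : group_set (subgroup_chain H x i).
Proof. by case: i => [|i] /=; apply: groupP. Qed.

Canonical chain_group i := Group (chain_group_set i).

Lemma chain_sub i (A : {group gT}) : H \subset A ->
  (forall j, (j < i)%N -> x j \in A) -> subgroup_chain H x i \subset A.
Proof.
move=> sHA; elim: i => //= i IH xA; rewrite gen_subG finset.subUset cycle_subG xA // andbT.
by apply: IH => j lt_ji; apply/xA/ltnW.
Qed.

Lemma chain_subS i : subgroup_chain H x i \subset subgroup_chain H x i.+1.
Proof. exact: joing_subl. Qed.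

Lemma chain_mem i j : (j < i)%N -> x j \in subgroup_chain H x i.
Proof.
elim: i => // i IH; rewrite ltnS leq_eqVlt => /predU1P[->|/IH xj].
  by apply: mem_gen; rewrite finset.inE cycle_id orbT.
exact: (fintype.subsetP (chain_subS i)).
Qed.

Lemma chain_H i : H \subset subgroup_chain H x i.
Proof.
elim: i => [|i IH]; first exact: subxx.
exact: fintype.subset_trans IH (chain_subS i).
Qed.

Lemma least_power_dvd i a : (i < r)%N -> (x i ^+ a)%g \in subgroup_chain H x i -> (q i %| a)%N.
Proof.
move=> lt_ir xa; have [q0 xq min_q] := hq lt_ir.
rewrite /dvdn -leqn0 leqNgt; apply/negP => mod_gt0.
suff /(min_q _ mod_gt0) : (x i ^+ (a %% q i))%g \in subgroup_chain H x i.
  by rewrite leqNgt ltn_mod q0.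
have xd : (x i ^+ (a %/ q i * q i))%g \in chain_group i by rewrite mulnC expgM groupX.
by rewrite -(groupMl _ xd) -expgD -divn_eq.
Qed.

Definition coset_rep (m : seq nat) (i : nat) : gT := (\prod_(j < i) x j ^+ nth 0%N m j)%g.

Lemma coset_repS m i : coset_rep m i.+1 = (coset_rep m i * x i ^+ nth 0%N m i)%g.
Proof. exact: big_ord_recr. Qed.

Lemma eq_coset_rep m m' i : (forall j, (j < i)%N -> nth 0%N m j = nth 0%N m' j) ->
  coset_rep m i = coset_rep m' i.
Proof. by move=> E; apply: eq_bigr => j _; rewrite E. Qed.

(** The last exponent is reduced modulo [q i]; the part removed is a power of [x i] in the preceding
    subgroup. *)
Lemma chain_surj i g : (i <= r)%N -> g \in subgroup_chain H x i ->
  exists m h, [/\ size m = i, forall j, (j < i)%N -> (nth 0%N m j < q j)%N,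
    h \in H & g = (coset_rep m i * h)%g].
Proof.
elim: i g => [|i IH] g lt_ir gC.
  by exists [::], g; split=> //; rewrite /coset_rep big_ord0 mul1g.
have : g \in (chain_group i <*> <[x i]>)%G by [].
have cent : <[x i]>%g \subset ('C(chain_group i))%g.
  by apply/centsP => a _ b _; apply: gT_abelian.
rewrite /= cent_joinEr // => /mulsgP[c _ cC /cycleP[a ->] gE].
have [q0 xq _] := hq lt_ir.
have ca : (c * x i ^+ (a %/ q i * q i))%g \in chain_group i.
  by rewrite groupM // mulnC expgM groupX.
have [m [h [sz_m lt_m hH cE]]] := IH _ (ltnW lt_ir) ca.
exists (rcons m (a %% q i)%N), h; split=> //.
- by rewrite size_rcons sz_m.
- move=> j; rewrite ltnS leq_eqVlt nth_rcons sz_m => /predU1P[->|lt_ji].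
    by rewrite ltnn eqxx ltn_mod.
  by rewrite lt_ji lt_m.
rewrite coset_repS nth_rcons sz_m ltnn eqxx.
rewrite (@eq_coset_rep (rcons m _) m) => [|j lt_ji]; last by rewrite nth_rcons sz_m lt_ji.
rewrite gE {1}(divn_eq a (q i)) expgD mulgA cE -!mulgA; congr (_ * _)%g.
exact: gT_abelian.
Qed.

(** The difference of the last exponents gives a power of [x i] in the preceding subgroup, so it is
    a multiple of [q i]; both exponents being less than [q i], they agree. *)
Lemma chain_inj i m m' h : (i <= r)%N ->
  (forall j, (j < i)%N -> (nth 0%N m j < q j)%N) ->
  (forall j, (j < i)%N -> (nth 0%N m' j < q j)%N) ->
  h \in H -> coset_rep m i = (coset_rep m' i * h)%g ->
  forall j, (j < i)%N -> nth 0%N m j = nth 0%N m' j.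
Proof.
elim: i h => // i IH h lt_ir lt_m lt_m' hH E.
have rep_mem n : coset_rep n i \in chain_group i.
  by apply: group_prod => j _; rewrite groupX // chain_mem.
have hC : h \in chain_group i := fintype.subsetP (chain_H i) h hH.
have le_mm n n' (h' : gT) : h' \in H -> (nth 0%N n i < q i)%N ->
    (nth 0%N n i >= nth 0%N n' i)%N ->
    coset_rep n i.+1 = (coset_rep n' i.+1 * h')%g -> nth 0%N n i = nth 0%N n' i.
  move=> h'H lt_n le_n E'; apply/eqP; rewrite eqn_leq le_n andbT -subn_eq0.
  have /(least_power_dvd lt_ir) : (x i ^+ (nth 0%N n i - nth 0%N n' i))%g \in subgroup_chain H x i.
    have -> : (x i ^+ (nth 0%N n i - nth 0%N n' i) = (coset_rep n i)^-1 * coset_rep n' i * h')%g.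
      move: E'; rewrite !coset_repS -{1}(subnK le_n) expgD -!mulgA => E'.
      apply: (mulgI (coset_rep n i)); rewrite mulKVg.
      apply: (mulIg (x i ^+ nth 0%N n' i)%g); rewrite -mulgA E' -!mulgA.
      by congr (_ * _)%g; rewrite gT_abelian.
    rewrite -[subgroup_chain H x i]/(gval (chain_group i)).
    by rewrite !groupM ?groupV // (fintype.subsetP (chain_H i)).
  by move=> /dvdnP[[|d] dE]; rewrite dE // in lt_n *; move: lt_n; rewrite -(subnK le_n) dE; lia.
have Ei : nth 0%N m i = nth 0%N m' i.
  case: (leqP (nth 0%N m' i) (nth 0%N m i)) => [le_m|/ltnW le_m].
    by apply: (le_mm _ _ h) => //; apply: lt_m.
  by apply/esym/(le_mm _ _ h^-1%g); rewrite ?groupV ?lt_m' // E mulgK.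
move=> j; rewrite ltnS leq_eqVlt => /predU1P[->//|]; move: j.
apply: (IH h) => //; try exact: ltnW.
- by move=> j lt_ji; apply/lt_m/ltnW.
- by move=> j lt_ji; apply/lt_m'/ltnW.
move: E; rewrite !coset_repS Ei -!mulgA [(_ * h)%g]gT_abelian !mulgA.
exact: mulIg.
Qed.

End SubgroupChain.

(** * Decomposition along the subgroup chain *)

Section Tower.
Variables (K : closedFieldType) (charK : [pchar K] =i pred0).
Variables (eps : nat -> K) (heps : compatible_roots eps).
Variables (O : comUnitAlgType K) (gT : finGroupType).
Variables (act : gT -> {lrmorphism O -> O}) (hact : group_action act).
Variables (r : nat) (p q : nat -> nat) (x : nat -> gT) (H : {group gT}).
Hypothesis p_gt0 : forall i, (i < r)%N -> (0 < p i)%N.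
Hypothesis ord_x : forall i, (i < r)%N -> #[x i]%g = p i.
Hypothesis gT_abelian : forall g h : gT, commute g h.
Hypothesis hq : forall i, (i < r)%N -> least_power_in (subgroup_chain H x i) (x i) (q i).
Variables (F0 : O) (chi : gT -> K).
Hypothesis F0_eigen : forall g, g \in H -> act g F0 = chi g *: F0.
Implicit Types (l m : seq nat).

Let act1 z : act 1%g z = z. Proof. by case: hact. Qed.
Let actM g h z : act (g * h)%g z = act g (act h z).
Proof. by case: hact => _; apply. Qed.

Let q_gt0 i : (i < r)%N -> (0 < q i)%N. Proof. by move=> /hq[]. Qed.

Lemma least_power_dvd_order i : (i < r)%N -> (q i %| p i)%N.
Proof.
move=> lt_ir; apply: (least_power_dvd hq lt_ir).
by rewrite -(ord_x lt_ir) expg_order; apply: (group1 (chain_group H x i)).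
Qed.

(** Since [eps (p i) ^+ q i] is a primitive root of order [p i %/ q i], the eigenvalue of
    [x i ^+ q i] determines [c] below this bound when [z] is nonzero. These [c] are the integers
    gamma_i. *)
Definition eigexp_spec i (z : O) (c : nat) : Prop :=
  (c < p i %/ q i)%N /\ act (x i ^+ q i)%g z = eps (p i) ^+ (q i * c) *: z.

(* 0 when x_i^q_i does not act on z by a power of eps (p i)^q_i. *)
Definition eigexp i (z : O) : nat :=
  if pselect (exists c, eigexp_spec i z c) is left h then projT1 (cid h) else 0%N.

Lemma quo_gt0 i : (i < r)%N -> (0 < p i %/ q i)%N.
Proof.
by move=> lt_ir; rewrite divn_gt0 ?q_gt0 // dvdn_leq ?p_gt0 ?least_power_dvd_order.
Qed.

Lemma eigexp_lt i z : (i < r)%N -> (eigexp i z < p i %/ q i)%N.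
Proof.
move=> lt_ir; rewrite /eigexp; case: pselect => [h|_]; last exact: quo_gt0.
by case: (cid h) => c [].
Qed.

Lemma eigexpE i z lam : (i < r)%N -> act (x i ^+ q i)%g z = lam *: z ->
  act (x i ^+ q i)%g z = eps (p i) ^+ (q i * eigexp i z) *: z.
Proof.
move=> lt_ir xz; rewrite /eigexp; case: pselect => [h|nh]; first by case: (cid h) => c [].
exfalso; apply: nh; have [->|z0] := eqVneq z 0.
  by exists 0%N; split; rewrite ?quo_gt0 // scaler0 raddf0.
pose d := (p i %/ q i)%N; have d0 : (0 < d)%N by apply: quo_gt0.
have actX b : act (x i ^+ (q i * b))%g z = lam ^+ b *: z.
  elim: b => [|b IH]; first by rewrite muln0 expg0 act1 scale1r.
  by rewrite mulnS expgD actM IH linearZ /= xz scalerA exprSr.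
have lam1 : lam ^+ d = 1.
  have := actX d; rewrite mulnC divnK ?least_power_dvd_order //.
  rewrite -(ord_x lt_ir) expg_order act1 => /eqP.
  rewrite -{1}[z]scale1r -subr_eq0 -scalerBl scaler_eq0 (negPf z0) orbF subr_eq0.
  by move=> /eqP.
have [c cE] := prim_rootP (eps_prim heps d0) lam1.
have epsd : eps (p i) ^+ q i = eps d.
  rewrite -{1}(divnK (least_power_dvd_order lt_ir)).
  by case: heps => _; apply=> //; apply: q_gt0.
by exists c; split=> //; rewrite xz cE -epsd -exprM.
Qed.

(** For [a] below [q i], these are the [q i]-th roots of the eigenvalue of [x i ^+ q i] on [z]. *)
Definition eigval i (z : O) (a : nat) : K := eps (p i) ^+ eigexp i z * eps (q i) ^+ a.

(** A tree of vectors with root [F0]: a vertex at level [i] depends only on the first [i] entries of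
    [l], and entry [i] selects the eigenvalue of [x i] among its children. *)
Fixpoint tower (i : nat) (l : seq nat) : O :=
  if i is i'.+1 then
    eigproj act (x i') (q i') (eigval i' (tower i' l) (nth 0%N l i')) (tower i' l)
  else F0.

Lemma eq_tower i l l' : (forall j, (j < i)%N -> nth 0%N l j = nth 0%N l' j) ->
  tower i l = tower i l'.
Proof.
elim: i => //= i IH E; rewrite E // (IH) // => j lt_ji.
by apply: E; apply: ltnW.
Qed.

Lemma eigval_neq0 i z a : (i < r)%N -> eigval i z a != 0.
Proof. by move=> lt_ir; rewrite mulf_neq0 // expf_neq0 // eps_neq0 ?p_gt0 ?q_gt0. Qed.

Lemma eigval_expq i z a : (i < r)%N -> eigval i z a ^+ q i = eps (p i) ^+ (q i * eigexp i z).
Proof.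
move=> lt_ir; rewrite exprMn -!exprM mulnC [(a * _)%N]mulnC [X in _ * X]exprM.
by rewrite (prim_expr_order (eps_prim heps (q_gt0 lt_ir))) expr1n mulr1.
Qed.

Lemma tower_H i l g : g \in H -> act g (tower i l) = chi g *: tower i l.
Proof.
by move=> gH; elim: i => [|i IH] /=; [exact: F0_eigen | exact: eigproj_comm].
Qed.

(** Joint induction. The [i]-th subgroup, which contains [x i ^+ q i], acts on level [i] by scalars,
    so the projection gives an eigenvector of [x i]. The elements acting by scalars form a group
    [E], which then contains the next subgroup. *)
Lemma tower_eigen i l : (i <= r)%N ->
  (forall g, g \in subgroup_chain H x i -> exists lam : K, act g (tower i l) = lam *: tower i l) /\
  (forall j, (j < i)%N ->
     act (x j) (tower i l) = eigval j (tower j l) (nth 0%N l j) *: tower i l).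
Proof.
elim: i => [|i IH] lt_ir; first by split=> // g gH; exists (chi g); apply: F0_eigen.
have [gen_i eig_i] := IH (ltnW lt_ir).
have eig j : (j < i.+1)%N ->
    act (x j) (tower i.+1 l) = eigval j (tower j l) (nth 0%N l j) *: tower i.+1 l.
  rewrite ltnS leq_eqVlt => /predU1P[->|lt_ji]; last exact/eigproj_comm/eig_i.
  apply: eigprojE => //; [exact: q_gt0 | exact: eigval_neq0 |].
  have [_ xq _] := hq lt_ir; have [lam xlam] := gen_i _ xq.
  by rewrite eigval_expq // (eigexpE lt_ir xlam).
split=> //.
pose E : {set gT} :=
  finset (fun g => `[< exists lam : K, act g (tower i.+1 l) = lam *: tower i.+1 l >]).
have EP g : g \in E <-> exists lam : K, act g (tower i.+1 l) = lam *: tower i.+1 l.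
  by rewrite inE; split=> /asboolP.
have Egrp : group_set E.
  apply/group_setP; split; first by apply/EP; exists 1; rewrite act1 scale1r.
  move=> g h /EP[lam gl] /EP[mu hm]; apply/EP; exists (mu * lam).
  by rewrite actM hm linearZ /= gl scalerA.
have sub : subgroup_chain H x i.+1 \subset Group Egrp.
  apply: chain_sub => [|j lt_j].
    by apply/fintype.subsetP => g gH; apply/EP; exists (chi g); apply: tower_H.
  by apply/EP; exists (eigval j (tower j l) (nth 0%N l j)); apply: eig.
by move=> g /(fintype.subsetP sub)/EP.
Qed.

Lemma tower_ideal (I : set O) i l : is_ideal I -> (forall g w, I w -> I (act g w)) ->
  I F0 -> I (tower i l).
Proof. by move=> Iid Iact I0; elim: i => //= i IH; apply: eigproj_ideal. Qed.

(** The children of a vertex add up to it, and they are consecutive in lexicographic rank: the sum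
    is cut into blocks of length [q i]. *)
Lemma tower_sum i : (i <= r)%N ->
  \sum_(j < \prod_(i' < i) q i') tower i (digits q i j) = F0.
Proof.
elim: i => [|i IH] lt_ir; first by rewrite big_ord0 big_ord1.
rewrite -[RHS](IH (ltnW lt_ir)) big_ord_recr /=.
set Q := (\prod_(i' < i) q i')%N; have qi0 := q_gt0 lt_ir.
pose term j := eigproj act (x i) (q i)
  (eigval i (tower i (digits q i.+1 j)) (nth 0%N (digits q i.+1 j) i))
  (tower i (digits q i.+1 j)).
rewrite -(big_mkord predT term).
rewrite mulnC; elim: Q => [|Q IHQ]; first by rewrite muln0 big_geq // big_ord0.
rewrite mulnS addnC (big_cat_nat (n := (q i * Q)%N)) ?leq_addr //= IHQ big_ord_recr /=.
congr (_ + _); rewrite -{1}[(q i * Q)%N]add0n big_addn addKn big_mkord.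
rewrite -[RHS](eigproj_sum charK hact (x i)
  (eps (p i) ^+ eigexp i (tower i (digits q i Q))) _ qi0 (eps_prim heps qi0)).
apply: eq_bigr => a _; rewrite /term.
have E : digits q i.+1 (a + q i * Q) = rcons (digits q i Q) a.
  rewrite digitsS addnC mulnC divnMDl // divn_small ?ltn_ord // addn0.
  by rewrite modnMDl modn_small ?ltn_ord.
have -> : tower i (digits q i.+1 (a + q i * Q)) = tower i (digits q i Q).
  by apply: eq_tower => j lt_ji; rewrite E nth_rcons size_digits lt_ji.
by rewrite E nth_rcons size_digits ltnn eqxx.
Qed.

(** The coefficient is the eigenvalue of the representative: its factor of index [i] is the
    eigenvalue of [x i] raised to entry [i] of [m]. *)
Lemma coset_rep_tower m l :
  act (coset_rep x m r) (tower r l) =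
  crossing_coef eps p q (fun i l => eigexp i (tower i l)) r m l *: tower r l.
Proof.
suff: forall i, (i <= r)%N -> act (coset_rep x m i) (tower r l) =
    crossing_coef eps p q (fun i l => eigexp i (tower i l)) i m l *: tower r l.
  by apply.
elim=> [|i IH] lt_ir; first by rewrite /crossing_coef /coset_rep !big_ord0 act1 scale1r.
rewrite coset_repS /crossing_coef big_ord_recr /= actM; set th := eps (p i) ^+ _ * _.
have actX b : act (x i ^+ b)%g (tower r l) = eigval i (tower i l) (nth 0%N l i) ^+ b *: tower r l.
  elim: b => [|b IHb]; first by rewrite expg0 act1 scale1r.
  have [_ eig] := tower_eigen l (leqnn r).
  by rewrite expgS actM IHb linearZ /= eig // scalerA exprSr.
rewrite actX linearZ /= IH 1?ltnW // scalerA mulrC; congr (_ * _ *: _).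
have -> : th = (eps (p i) ^+ (nth 0%N m i * eigexp i (tower i (take i l)))%N *
    eps (q i) ^+ (nth 0%N m i * nth 0%N l i)%N) by [].
rewrite (@eq_tower i (take i l) l) => [|j lt_ji]; last by rewrite nth_take.
by rewrite exprMn -!exprM mulnC [(nth 0%N l i * _)%N]mulnC.
Qed.

End Tower.

Lemma bigdprod_abelian (gT : finGroupType) (I : Type) (s : seq I) (A : I -> {group gT})
    (G : {group gT}) :
  (\big[dprod/1]_(i <- s) A i)%g = G -> (forall i, abelian (A i)) -> abelian G.
Proof.
move=> + Aab; elim: s G => [|i s IH] G; first by rewrite big_nil => <-; apply: abelian1.
rewrite big_cons => /dprodP[[L M EL EM] <- cLM _].
have cM : abelian M by apply: IH; rewrite EM.
by rewrite EM abelianM Aab cM -EM.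
Qed.

(** * Extension of independent families *)

Section ExtendFree.
Variables (K : fieldType) (n : nat) (T : Type) (t0 : T) (phi : T -> 'rV[K]_n) (S : set T).

(** Families are sequences and scalars are indexed by [nat], so that a family can grow without a
    change of type. *)
Definition lin_free (s : seq T) : Prop := forall v : nat -> K,
  \sum_(i < size s) v i *: phi (nth t0 s i) = 0 -> forall i, (i < size s)%N -> v i = 0.

Lemma lin_free_row_free s :
  lin_free s -> row_free (\matrix_(i < size s) phi (nth t0 s i)).
Proof.
move=> sfree; apply: inj_row_free => v vM; apply/rowP => i; rewrite [RHS]mxE.
have := sfree (fun j => if insub j is Some j' then v 0 j' else 0) _ i (ltn_ord i).
rewrite insubT ?ltn_ord //= => lt_i; rewrite (_ : Sub _ _ = i); last exact: val_inj.
apply; rewrite -[RHS]vM mulmx_sum_row; apply: eq_bigr => j _.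
by rewrite rowK valK.
Qed.

Lemma lin_free_extend s :
  (forall A : 'M[K]_n, (forall t, S t -> (phi t <= A)%MS) -> row_full A) ->
  lin_free s -> exists s', [/\ forall i, (i < size s')%N -> S (nth t0 s' i),
    size (s ++ s') = n & lin_free (s ++ s')].
Proof.
move=> Sspan; have [d] := ubnP (n - size s); elim: d s => // d IH s le_d sfree.
have /eqP rk := lin_free_row_free sfree.
have [ssp|nsp] := pselect (forall t, S t ->
    (phi t <= \matrix_(i < size s) phi (nth t0 s i))%MS).
  exists [::]; rewrite cats0; split=> //.
  have /eqP : row_full <<\matrix_(i < size s) phi (nth t0 s i)>>%MS.
    by apply: Sspan => t /ssp; rewrite genmxE.
  by rewrite genmxE rk.
have [t St nt] : exists2 t, S t & ~ (phi t <= \matrix_(i < size s) phi (nth t0 s i))%MS.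
  by apply: contrapT => h; apply: nsp => t St; apply: contrapT => nt; apply: h; exists t.
have sfree' : lin_free (rcons s t).
  move=> v; rewrite size_rcons big_ord_recr /= nth_rcons ltnn eqxx.
  have -> : \sum_(i < size s) v i *: phi (nth t0 (rcons s t) i) =
      \sum_(i < size s) v i *: phi (nth t0 s i).
    by apply: eq_bigr => i _; rewrite nth_rcons ltn_ord.
  have [v0|v0] := eqVneq (v (size s)) 0.
    rewrite v0 scale0r addr0 => /sfree vs i.
    by rewrite ltnS leq_eqVlt => /predU1P[-> |/vs].
  move/eqP; rewrite addrC addr_eq0 => /eqP E; case: nt.
  rewrite -(eqmx_scale _ v0) E eqmx_opp summx_sub // => i _.
  apply: scalemx_sub; have := row_sub i (\matrix_(i < size s) phi (nth t0 s i)).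
  by rewrite rowK.
have lt_sn : (size s < n)%N.
  rewrite ltnNge; apply/negP => le_ns; apply: nt; apply: submx_full.
  by rewrite -col_leq_rank rk.
have [|s' [Ss' sz s'free]] := IH (rcons s t) _ sfree'; first by rewrite size_rcons; lia.
exists (t :: s'); rewrite -cat_rcons; split=> // -[|i] //=; exact: Ss'.
Qed.

End ExtendFree.

(** * The factors as one orbit, and the coefficient matrix *)

Section TransitiveFactors.
Variables (K : closedFieldType) (charK : [pchar K] =i pred0).
Variables (eps : nat -> K) (heps : compatible_roots eps).
Variables (O : comUnitAlgType K) (Oloc : local_alg O).
Hypothesis Oprime : forall u a b : O, nonunits u -> ~ nonunits_sq u ->
  (exists q, a * b = u * q) -> (exists q, a = u * q) \/ (exists q, b = u * q).
Variables (gT : finGroupType) (r : nat) (p q : nat -> nat) (x : nat -> gT).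
Hypothesis p_gt0 : forall i, (i < r)%N -> (0 < p i)%N.
Hypothesis ord_x : forall i, (i < r)%N -> #[x i]%g = p i.
Hypothesis prod_x : (\big[dprod/1]_(i < r) <[x i]>)%g = finset.setT.
Variables (act : gT -> {lrmorphism O -> O}) (hact : group_action act).
Variables (k : nat) (f : 'I_k -> O) (z0 : 'I_k).
Hypothesis f_vanish : forall j, nonunits (f j).
Hypothesis f_free : gradients_free f.
Hypothesis I_inv : G_invariant act (ideal_gen [set \prod_j f j]).
Hypothesis I_nosplit : ~ splits act (\prod_j f j).
Hypothesis hq : forall i, (i < r)%N ->
  least_power_in (subgroup_chain (ideal_stab act (f z0)) x i) (x i) (q i).

Let act1 z : act 1%g z = z. Proof. by case: hact. Qed.
Let actM g h z : act (g * h)%g z = act g (act h z).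
Proof. by case: hact => _; apply. Qed.

Let fp := fperm Oprime hact f_vanish f_free I_inv.
Let fpM g h j : fp (g * h)%g j = fp g (fp h j). Proof. exact: fpermM. Qed.
Let fp1 j : fp 1%g j = j. Proof. exact: fperm1. Qed.
Let fp_stab g : (g \in ideal_stab act (f z0)) = (fp g z0 == z0).
Proof. exact: fperm_stab. Qed.

Lemma dprod_cycles_abelian (g h : gT) : commute g h.
Proof.
have /centsP cGG : abelian [set: gT]%G.
  apply: (@bigdprod_abelian _ _ _ (fun i : 'I_r => <[x i]>%G) [set: gT]%G prod_x) => i.
  exact: cycle_abelian.
by apply: cGG; rewrite finset.in_setT.
Qed.

Lemma ideal_stab_group_set : group_set (ideal_stab act (f z0)).
Proof.
apply/group_setP; split=> [|g h]; rewrite !fp_stab ?fp1 //.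
by move=> /eqP gz /eqP hz; rewrite fpM hz gz.
Qed.

Let H := Group ideal_stab_group_set.

Let hqH i : (i < r)%N -> least_power_in (subgroup_chain H x i) (x i) (q i).
Proof. exact: hq. Qed.

Lemma chain_top g : g \in subgroup_chain H x r.
Proof.
have : g \in (\prod_(i < r) <[x i]>)%g by rewrite (bigdprodW prod_x) finset.in_setT.
case/prodsgP => c hc ->; rewrite -[subgroup_chain H x r]/(gval (chain_group H x r)).
apply: group_prod => i _.
have xr : x i \in chain_group H x r by apply: chain_mem.
by have : <[x i]>%g \subset chain_group H x r; [rewrite cycle_subG | move/fintype.subsetP; apply; apply: hc].
Qed.

Let rep (j : nat) : gT := coset_rep x (digits q r j) r.

Lemma rep_inj (j l : nat) : (j < \prod_(i < r) q i)%N -> (l < \prod_(i < r) q i)%N ->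
  fp (rep j) z0 = fp (rep l) z0 -> j = l.
Proof.
move=> lt_j lt_l E; apply: (digits_inj lt_j lt_l).
have q0 i : (i < r)%N -> (0 < q i)%N by case/hq.
have hH : ((rep l)^-1 * rep j)%g \in H by rewrite /= fp_stab fpM E -fpM mulVg fp1.
apply: (@eq_from_nth _ 0%N); rewrite ?size_digits // => i lt_i.
apply: (chain_inj dprod_cycles_abelian hqH (leqnn r) _ _ hH) => //.
- by move=> i' lt_i'; apply: digits_lt.
- by move=> i' lt_i'; apply: digits_lt.
- by rewrite mulKVg.
Qed.

Lemma rep_surj l : exists2 j, (j < \prod_(i < r) q i)%N & fp (rep j) z0 = l.
Proof.
have [g gl] := fperm_transitive Oloc Oprime hact f_vanish f_free I_inv I_nosplit z0 l.
have [m [h [sz_m lt_m hH gE]]] := chain_surj dprod_cycles_abelian hqH (leqnn r) (chain_top g).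
have [j lt_j jE] := digits_surj sz_m lt_m; exists j => //.
rewrite -gl -/fp gE fpM /rep jE; congr fp.
by apply/esym/eqP; rewrite -fp_stab.
Qed.

(** Orbit and stabilizer: the [rep j] meet each coset of [H] exactly once, and cosets correspond to
    factors. *)
Lemma card_factors : k = (\prod_(i < r) q i)%N.
Proof.
set Q := (\prod_(i < r) q i)%N; apply/eqP; rewrite eqn_leq; apply/andP; split.
  have /choice[h hh] l : exists j : 'I_Q, fp (rep j) z0 = l.
    by have [j lt_j jl] := rep_surj l; exists (Ordinal lt_j).
  have h_inj : injective h by move=> l l' E; rewrite -(hh l) E hh.
  by have := leq_card h h_inj; rewrite !card_ord.
have h_inj : injective (fun j : 'I_Q => fp (rep j) z0).
  by move=> j l /rep_inj E; apply/val_inj/E.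
by have := leq_card _ h_inj; rewrite !card_ord.
Qed.

(** Row [j] of the matrix belongs to the factor [f (sg j)], not to [f j]; the product is insensitive
    to this reindexing. *)
Let sg (j : 'I_k) := fp (rep j) z0.

Let sg_inj : injective sg.
Proof.
by move=> j l E; apply/val_inj/(rep_inj _ _ E); rewrite -card_factors.
Qed.

(** The fibres of the orbit map of [z0] are cosets of [H], so [H] has index [k], and it is normal
    because the group is abelian. *)
Lemma expg_stab g : (g ^+ k)%g \in H.
Proof.
have nH : (H <| [set: gT]%G)%g.
  rewrite -sub_abelian_normal ?finset.subsetT //.
  by apply/centsP => a _ b _; apply: dprod_cycles_abelian.
have index_k : #|[set: gT]%G : H|%g = k.
  rewrite -divgS ?finset.subsetT //.
  have -> : #|[set: gT]%G| = (k * #|H|)%N.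
    rewrite -sum1_card (partition_big (fun g => fp g z0) predT) //=.
    rewrite -[k in RHS]card_ord -sum_nat_const; apply: eq_bigr => l _.
    have [g0 gl] := fperm_transitive Oloc Oprime hact f_vanish f_free I_inv I_nosplit z0 l.
    rewrite -(card_lcoset H g0) -sum1_card; apply: eq_bigl => a.
    rewrite finset.in_setT mem_lcoset /= fp_stab fpM -gl -/fp.
    apply/eqP/eqP => [->|E]; first by rewrite -fpM mulVg fp1.
    by rewrite -[in RHS]E -fpM mulgV fp1.
  by rewrite mulnK ?cardG_gt0.
have gN : g \in ('N(H))%g by apply: (fintype.subsetP (normal_norm nH)); rewrite finset.in_setT.
apply: coset_idr; first by rewrite groupX.
rewrite morphX // -index_k -card_quotient ?normal_norm //.
by apply: expg_cardG; apply: mem_quotient; rewrite finset.in_setT.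
Qed.

Section EigenGenerator.
Variables (w : O) (chi : gT -> K).
Hypothesis w_unit : w \is a GRing.unit.
Let F0 := w * f z0.
Hypothesis F0_eigen : forall g, g \in H -> act g F0 = chi g *: F0.

Let tow := tower eps act p q x F0.
Let gam i l := eigexp eps act p q x i (tow i l).
Let y (l : nat) : O := tow r (digits q r l).
Let F (j : nat) : O := act (rep j) F0.
Let M (j l : nat) : K := crossing_coef eps p q gam r (digits q r j) (digits q r l).

Lemma rep_eigen j l : act (rep j) (y l) = M j l *: y l.
Proof. exact: (coset_rep_tower heps hact p_gt0 ord_x dprod_cycles_abelian hqH F0_eigen). Qed.

Lemma factor_sum j : F j = \sum_(l < k) M j l *: y l.
Proof.
rewrite /F -[F0](tower_sum charK heps hact p hqH F0 (leqnn r)).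
rewrite -card_factors raddf_sum; apply: eq_bigr => l _; exact: rep_eigen.
Qed.

Lemma tower_eigenvector l : eigenvector act r x (y l).
Proof.
move=> i lt_ir; have [_ eig] := tower_eigen heps hact p_gt0 ord_x
  dprod_cycles_abelian hqH F0_eigen (digits q r l) (leqnn r).
by eexists; apply: eig.
Qed.

Lemma tower_nonunits l : nonunits (y l).
Proof.
apply: tower_ideal; [exact: nonunits_ideal | by move=> g z /(act_nonunits hact) |].
exact: nonunitsM.
Qed.

Lemma factor_unit (j : 'I_k) : exists2 u, u \is a GRing.unit & F j = u * f (sg j).
Proof.
have [u uu E] := fperm_unit Oloc Oprime hact f_vanish f_free I_inv (rep j) z0.
exists (act (rep j) w * u); first by rewrite unitrM act_unit // w_unit.
by rewrite /F rmorphM /= E mulrA.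
Qed.

Lemma factor_ideal : ideal_gen [set \prod_(j < k) F j] = ideal_gen [set \prod_j f j].
Proof.
have /choice[u hu] (j : 'I_k) : exists u, u \is a GRing.unit /\ F j = u * f (sg j).
  by have [u uu E] := factor_unit j; exists u.
rewrite (eq_bigr (fun j => u j * f (sg j))) => [|j _]; last by case: (hu j).
have fE : \prod_(j < k) f (sg j) = \prod_j f j by apply/esym/(reindex_inj sg_inj).
rewrite big_split /= fE assoc_ideal //.
by apply: rpred_prod => j _; case: (hu j).
Qed.

Lemma sg_surj l : exists j, sg j = l.
Proof. by exists (invF sg_inj l); apply: f_invF. Qed.

(** One inclusion inverts the units in the [F j]. For the other, the ideal of the factors is stable
    under the group, and the tower never leaves a stable ideal. This makes the coordinates adapted
    to S. *)
Lemma tower_ideal_gen : ideal_gen (range f) = ideal_gen (range (fun l : 'I_k => y l)).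
Proof.
have fid := ideal_gen_ideal (range f).
have yid := ideal_gen_ideal (range (fun l : 'I_k => y l)).
apply/seteqP; split; apply: ideal_gen_min => // _ [l _ <-].
  have [j <-] := sg_surj l; have [u uu E] := factor_unit j.
  have [_ _ yM] := yid; rewrite -[f _](mulKr uu) -E; apply: yM.
  rewrite factor_sum; apply: ideal_sum => // i _; apply: idealZ => //.
  by apply: sub_ideal_gen; exists i.
have [_ _ fM] := fid; apply: tower_ideal => //; last first.
  by apply: fM; apply: sub_ideal_gen; exists z0.
move=> g; apply: ideal_gen_min => [|_ [j _ <-]].
  split=> [|z z' Iz Iz'|a z Iz] /=; rewrite ?raddf0; first by case: fid.
    by rewrite raddfD; case: fid => _ fD _; apply: fD.
  by rewrite rmorphM; apply: fM.
have [u _ ->] := fperm_unit Oloc Oprime hact f_vanish f_free I_inv g j.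
by apply: fM; apply: sub_ideal_gen; eexists.
Qed.

(** The gradients of the [F j] are nonzero multiples of those of the factors, hence of rank [k], and
    combinations of the [k] gradients of the [y l]; so the latter have rank [k] and the same
    span. *)
Lemma tower_gradients n (lin : {linear O -> 'rV[K]_n}) :
  (forall z, nonunits_sq z -> lin z = 0) ->
  row_free (\matrix_j lin (f j)) ->
  row_free (\matrix_(l < k) lin (y l)) /\
  (\matrix_(l < k) lin (y l) <= \matrix_j lin (f j))%MS.
Proof.
move=> lin_sq; set Lf := \matrix_j _; set Ly := \matrix_(l < k) _ => Lf_free.
pose LF := \matrix_(j < k) lin (F j).
have LFE : LF = (\matrix_(j < k, l < k) M j l) *m Ly.
  apply/row_matrixP => j; rewrite rowK row_mul mulmx_sum_row factor_sum raddf_sum.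
  by apply: eq_bigr => l _; rewrite rowK !mxE /= linearZ.
have linF (j : 'I_k) : exists2 c : K, c != 0 & lin (F j) = c *: lin (f (sg j)).
  have [u uu ->] := factor_unit j; have [c nu] := Oloc.2 u.
  exists c; first by apply/(unit_residue Oloc nu).
  exact: gradient_mul.
have LF_f : (LF <= Lf)%MS.
  apply/row_subP => j; rewrite rowK; have [c _ ->] := linF j.
  by apply: scalemx_sub; have := row_sub (sg j) Lf; rewrite rowK.
have f_LF : (Lf <= LF)%MS.
  apply/row_subP => l; rewrite rowK; have [j <-] := sg_surj l.
  have [c c0 E] := linF j; rewrite -(eqmx_scale _ c0) -E.
  by have := row_sub j LF; rewrite rowK.
have rkF : \rank LF = k.
  by rewrite -[RHS](eqP Lf_free); apply/eqP; rewrite eqn_leq !mxrankS.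
have rkFy : (LF <= Ly)%MS by rewrite LFE submxMl.
have rky : \rank Ly = k.
  by apply/eqP; rewrite eqn_leq rank_leq_row -{1}rkF mxrankS.
split; first exact/eqP.
apply: submx_trans LF_f.
by have := mxrank_leqif_sup rkFy => -[_ <-]; rewrite rkF rky.
Qed.

Let act_expg g (b : nat) z (lam : K) : act g z = lam *: z ->
  act (g ^+ b)%g z = lam ^+ b *: z.
Proof.
move=> gz; elim: b => [|b IH]; first by rewrite expg0 act1 scale1r.
by rewrite expgS actM IH linearZ /= gz scalerA exprSr.
Qed.

(** [rep j ^+ k] lies in [H], which acts on every [y l] by the same character [chi]. What matters is
    that the right side does not involve [l]. *)
Lemma coef_expk j l : y l != 0 -> M j l ^+ k = chi (rep j ^+ k)%g.
Proof.
move=> yl0; apply/eqP; rewrite -subr_eq0; apply/eqP.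
have : (M j l ^+ k - chi (rep j ^+ k)%g) *: y l == 0.
  rewrite scalerBl -(act_expg k (rep_eigen j l)) subr_eq0.
  apply/eqP; apply: (tower_H _ hact _ _ _ dprod_cycles_abelian F0_eigen).
  exact: expg_stab.
by rewrite scaler_eq0 (negPf yl0) orbF => /eqP.
Qed.

Lemma coef_order j l : y l != 0 -> M j l ^+ #|gT| = 1.
Proof.
move=> yl0; apply/eqP; rewrite -subr_eq0; apply/eqP.
have : (M j l ^+ #|gT| - 1) *: y l == 0.
  rewrite scalerBl -(act_expg #|gT| (rep_eigen j l)) scale1r subr_eq0.
  by rewrite -finset.cardsT (expg_cardG (G := [set: gT]%G)) ?act1 ?finset.in_setT.
by rewrite scaler_eq0 (negPf yl0) orbF => /eqP.
Qed.

Lemma coef_ratio j l l' : (0 < k)%N -> y l != 0 -> y l' != 0 ->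
  exists b : nat, M j l = eps k ^+ b * M j l'.
Proof.
move=> k0 yl yl'.
have M0 : M j l' != 0.
  apply/eqP => M0; have := coef_order j yl'.
  rewrite M0 expr0n.
  have -> : (#|gT| == 0%N) = false.
    by apply/negbTE; rewrite -lt0n; apply/card_gt0P; exists 1%g.
  by move/esym/eqP; rewrite oner_eq0.
have ratio : (M j l / M j l') ^+ k = 1.
  by rewrite expr_div_n !coef_expk // divff // -(coef_expk j yl') expf_neq0.
have [b bE] := prim_rootP (eps_prim heps k0) ratio.
by exists b; rewrite -bE divfK.
Qed.

End EigenGenerator.

End TransitiveFactors.

(** * Adapted coordinates *)

Section AdaptedCoordinates.
Variables (K : closedFieldType) (charK : [pchar K] =i pred0).
Variables (eps : nat -> K) (heps : compatible_roots eps).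
Variables (O : comUnitAlgType K) (Oloc : local_alg O).
Variables (gT : finGroupType) (r : nat) (p : nat -> nat) (x : nat -> gT).
Hypothesis p_gt0 : forall i, (i < r)%N -> (0 < p i)%N.
Hypothesis ord_x : forall i, (i < r)%N -> #[x i]%g = p i.
Hypothesis comm_x : forall i j, (i < r)%N -> (j < r)%N -> commute (x i) (x j).
Variables (act : gT -> {lrmorphism O -> O}) (hact : group_action act).
Variables (n : nat) (y0 : 'I_n -> O) (lin : {linear O -> 'rV[K]_n}).
Hypothesis y0c : coordinates y0.
Hypothesis lin_sq : forall z, nonunits_sq z -> lin z = 0.
Hypothesis sq_lin : forall z, nonunits z -> lin z = 0 -> nonunits_sq z.
Hypothesis lin_y0 : forall j, lin (y0 j) = delta_mx 0 j.

Lemma extend_eigen_coordinates k t (Y : 'I_k -> O) (e : 'I_t -> O) :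
  (forall l, nonunits (Y l) /\ eigenvector act r x (Y l)) ->
  (forall i, nonunits (e i) /\ eigenvector act r x (e i)) ->
  row_free (col_mx (\matrix_l lin (Y l)) (\matrix_i lin (e i))) ->
  exists (k_le_n : (k <= n)%N) (y : 'I_n -> O),
    [/\ coordinates y, forall l, y (widen_ord k_le_n l) = Y l,
        forall i, exists j, y j = e i & forall j, eigenvector act r x (y j)].
Proof.
move=> hY he YE_free.
pose S := [set z | nonunits z /\ eigenvector act r x z].
(* The [Y l] come first because they must be the coordinates of index less than [k]. *)
pose s := [seq Y l | l <- enum 'I_k] ++ [seq e i | i <- enum 'I_t].
have sz_s : size s = (k + t)%N by rewrite size_cat (size_map Y) (size_map e) !size_enum_ord.
have sY (l : 'I_k) s' : nth 0 (s ++ s') l = Y l.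
  rewrite -catA nth_cat size_map size_enum_ord ltn_ord (nth_map l) ?size_enum_ord //.
  by rewrite nth_ord_enum.
have sE (i : 'I_t) s' : nth 0 (s ++ s') (k + i) = e i.
  rewrite -catA nth_cat size_map size_enum_ord ltnNge leq_addr /= addKn.
  rewrite nth_cat size_map size_enum_ord ltn_ord (nth_map i) ?size_enum_ord //.
  by rewrite nth_ord_enum.
have sfree : lin_free 0 lin s.
  move=> v; rewrite -(big_mkord predT (fun i => v i *: lin (nth 0 s i))) sz_s big_mkord.
  rewrite big_split_ord /= => E.
  have : row_mx (\row_(l < k) v l) (\row_(i < t) v (k + i)%N) *m
      col_mx (\matrix_l lin (Y l)) (\matrix_i lin (e i)) = 0.
    rewrite mul_row_col -[RHS]E !mulmx_sum_row; congr (_ + _).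
      by apply: eq_bigr => l _; rewrite rowK mxE -[s]cats0 sY.
    by apply: eq_bigr => i _; rewrite rowK mxE -[s]cats0 sE.
  move/eqP; rewrite (mulmx_free_eq0 _ YE_free) row_mx_eq0 => /andP[/eqP/rowP v1 /eqP/rowP v2].
  move=> i lt_i; case: (ltnP i k) => [lt_ik|le_ki].
    by have := v1 (Ordinal lt_ik); rewrite !mxE.
  have lt_it : (i - k < t)%N by rewrite ltn_subLR.
  by have := v2 (Ordinal lt_it); rewrite !mxE /= subnKC.
have Sspan (A : 'M[K]_n) : (forall z, S z -> (lin z <= A)%MS) -> row_full A.
  move=> SA; rewrite -sub1mx; apply/row_subP => j; rewrite row1 -lin_y0.
  have [ny0 _] := y0c.
  have [d [-> hd]] := eigen_decomposition charK hact heps p_gt0 ord_x comm_x Oloc (ny0 j).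
  rewrite raddf_sum big_seq; apply: summx_sub => z zd; exact/SA/hd.
have [s' [Ss' sz_n sfree']] := lin_free_extend Sspan sfree.
have k_le_n : (k <= n)%N by rewrite -sz_n size_cat sz_s -addnA leq_addr.
have SS i : (i < n)%N -> S (nth 0 (s ++ s') i).
  move=> lt_in; case: (ltnP i (k + t)) => [lt_i|le_i]; last first.
    rewrite nth_cat sz_s ltnNge le_i /=; apply: Ss'.
    by rewrite -sz_n size_cat sz_s in lt_in; rewrite ltn_subLR.
  case: (ltnP i k) => [lt_ik|le_ki]; first by rewrite (sY (Ordinal lt_ik)).
  have lt_it : (i - k < t)%N by rewrite ltn_subLR.
  by rewrite -(subnKC le_ki) (sE (Ordinal lt_it)).
exists k_le_n, (fun j => nth 0 (s ++ s') j); split=> //.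
- apply: (nakayama Oloc y0c lin_sq sq_lin) => [j|]; first by case: (SS j (ltn_ord j)).
  rewrite -row_free_unit; apply: inj_row_free => v vM; apply/rowP => j; rewrite [RHS]mxE.
  have := sfree' (fun i => if insub i is Some i' then v 0 i' else 0) _ j.
  rewrite sz_n ltn_ord => /(_ _ isT); rewrite valK; apply.
  rewrite -[RHS]vM mulmx_sum_row; apply: eq_bigr => i _.
  by rewrite rowK valK.
- by move=> l; apply: sY.
- move=> i; have lt_i : (k + i < n)%N.
    by rewrite -sz_n size_cat sz_s -addnA ltn_add2l ltn_addr.
  by exists (Ordinal lt_i); apply: sE.
by move=> j; case: (SS j (ltn_ord j)).
Qed.

End AdaptedCoordinates.

(** * Transversality as independence of gradients *)

Section Transversality.
Variables (K : closedFieldType) (O : comUnitAlgType K) (Oloc : local_alg O).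
Variables (n : nat) (lin : {linear O -> 'rV[K]_n}).
Hypothesis lin1 : lin 1 = 0.
Hypothesis lin_sq : forall z, nonunits_sq z -> lin z = 0.
Hypothesis sq_lin : forall z, nonunits z -> lin z = 0 -> nonunits_sq z.

Lemma gradients_row_free k (f : 'I_k -> O) : (forall j, nonunits (f j)) ->
  gradients_free f -> row_free (\matrix_j lin (f j)).
Proof.
move=> nf ffree; apply: inj_row_free => v vM; apply/rowP => j; rewrite [RHS]mxE.
apply: ffree j; apply: sq_lin.
  by apply: ideal_sum => [|i _]; [exact: nonunits_ideal | exact: nonunitsZ].
rewrite raddf_sum -[RHS]vM mulmx_sum_row; apply: eq_bigr => i _.
by rewrite rowK /= linearZ.
Qed.

(** A covector in both spans vanishes on T_a S and on the tangent space of the intersection of all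
    components, hence on their sum T_a Z. The functionals [V] that test it are the coordinates of
    the gradient. *)
Lemma transverse_capmx k t (f : 'I_k -> O) (e : 'I_t -> O) :
  (forall j, nonunits (f j)) -> (forall i, nonunits (e i)) -> transverse f e ->
  (\matrix_j lin (f j) :&: \matrix_i lin (e i))%MS = 0.
Proof.
move=> nf ne tr; have mid := nonunits_ideal Oloc.
apply/eqP; rewrite -submx0; apply/rV_subP => om; rewrite sub_capmx.
case/andP => /submxP[a aE] /submxP[b bE]; rewrite submx0; apply/eqP/rowP => j.
pose zf := \sum_i a 0 i *: f i; pose ze := \sum_i b 0 i *: e i.
have lzf : lin zf = om.
  rewrite aE mulmx_sum_row raddf_sum; apply: eq_bigr => i _.
  by rewrite rowK /= linearZ.
have lze : lin ze = om.
  rewrite bE mulmx_sum_row raddf_sum; apply: eq_bigr => i _.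
  by rewrite rowK /= linearZ.
have sqz : nonunits_sq (zf - ze).
  apply: sq_lin; last by rewrite raddfB /= lzf lze subrr.
  by apply: idealB => //; apply: ideal_sum => // i _; apply: nonunitsZ.
pose v z : K^o := lin z 0 j.
have v_linear : linear v by move=> c z z'; rewrite /v linearP !mxE.
pose V : {linear O -> K^o} := HB.pack v (GRing.isLinear.Build _ _ _ _ _ v_linear).
have tV : tangent V.
  by split=> [|z /lin_sq z0] /=; rewrite /v ?lin1 ?z0 mxE.
have [v1 [v2 [[[_ t1] v1f] [[_ t2] v2e] VE]]] := tr [set: 'I_t]%SET V tV.
rewrite [RHS]mxE -lzf -[LHS]/(V zf) VE.
have -> : v1 zf = 0.
  by rewrite raddf_sum big1 // => i _ /=; rewrite linearZ /= v1f scaler0.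
rewrite add0r -[zf](subrK ze) raddfD /= t2 // add0r.
by rewrite raddf_sum big1 // => i _ /=; rewrite linearZ /= v2e ?scaler0 // finset.in_setT.
Qed.

End Transversality.

Theorem theorem5p4
  (K : closedFieldType) (charK : [pchar K] =i pred0)
  (eps : nat -> K) (heps : compatible_roots eps)
  (* the local ring of Z at a *)
  (n : nat) (O : comUnitAlgType K) (hO : smooth_germ O n)
  (* the group G, an internal direct product of cyclic groups *)
  (gT : finGroupType) (r : nat) (p : nat -> nat) (x : nat -> gT)
  (p_gt0 : forall i, (i < r)%N -> (0 < p i)%N)
  (ord_x : forall i, (i < r)%N -> #[x i]%g = p i)
  (prod_x : (\big[dprod/1]_(i < r) <[x i]>)%g = finset.setT)
  (act : gT -> {lrmorphism O -> O}) (hact : group_action act)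
  (* the ideal I = (f_1 ... f_k) *)
  (k : nat) (k_gt0 : (0 < k)%N) (f : 'I_k -> O)
  (f_vanish : forall j, nonunits (f j))
  (f_free : gradients_free f)
  (I_inv : G_invariant act (ideal_gen [set \prod_j f j]))
  (I_nosplit : ~ splits act (\prod_j f j))
  (* the components of E at a *)
  (t : nat) (e : 'I_t -> O) (E_snc : snc n e)
  (E_inv : forall i, G_invariant act (ideal_gen [set e i]))
  (ES_transverse : transverse f e)
  (q : nat -> nat)
  (hq : forall i, (i < r)%N ->
     least_power_in
       (subgroup_chain (ideal_stab act (f (Ordinal k_gt0))) x i) (x i) (q i)) :
  exists (k_le_n : (k <= n)%N) (y : 'I_n -> O) (c : nat -> 'I_n -> int)
         (beta : 'I_k -> 'I_k -> int)
         (s : nat) (gamma : nat -> seq nat -> nat),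
  [/\ coordinates y,
      (* y is adapted to E and to S *)
      (forall i, exists j, ideal_gen [set e i] = ideal_gen [set y j]) /\
      (exists J : set 'I_n, ideal_gen (range f) = ideal_gen (y @` J)),
      (* G is diagonal with respect to y *)
      forall i j, (i < r)%N -> act (x i) (y j) = eps (p i) ^ c i j *: y j,
      (forall j, beta j (Ordinal k_gt0) = 0) /\
      ideal_gen [set \prod_j f j] =
        ideal_gen [set \prod_(j < k) \sum_(l < k)
                         eps k ^ beta j l *: y (widen_ord k_le_n l)] &
      [/\ (s <= r)%N,
          k = (\prod_(i < s) q i)%N,
          forall i (l : seq nat), (i < s)%N -> size l = i ->
            (forall i', (i' < i)%N -> (nth 0 l i' < q i')%N) ->
            (gamma i l < p i %/ q i)%N &
          (* the coefficients of row j, up to a root of unity *)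
          forall j : 'I_k, exists2 w : K,
            exists2 N : nat, (0 < N)%N & w ^+ N = 1 &
            forall l : 'I_k,
              eps k ^ beta j l =
              w * crossing_coef eps p q gamma s (digits q s j) (digits q s l)]].
Proof.
have [Oloc Oreg] := smooth_germ_regular hO.
have [y0 [s0 [y0c s0_inj eE]]] := E_snc; have [y0free Oprime] := Oreg y0 y0c.
have [lin [lin1 lin_sq sq_lin liny0]] := linear_gradient Oloc y0c y0free.
pose z0 := Ordinal k_gt0.
have gT_ab := dprod_cycles_abelian prod_x.
pose H := Group (ideal_stab_group_set Oloc Oprime hact z0 f_vanish f_free I_inv).
have hqH : forall i, (i < r)%N -> least_power_in (subgroup_chain H x i) (x i) (q i) by [].
have [w [chi [w_unit F0_eigen]]] : exists w (chi : gT -> K), w \is a GRing.unit /\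
    forall g, g \in H -> act g (w * f z0) = chi g *: (w * f z0).
  apply: semi_invariant => //; first exact: free_neq0.
  by move=> g; rewrite inE => /asboolP; rewrite act_ideal1.
have kQ := card_factors Oloc Oprime prod_x hact f_vanish f_free I_inv I_nosplit hq.
pose F0 := w * f z0; pose tow := tower eps act p q x F0.
pose gam i l := eigexp eps act p q x i (tow i l).
pose Y (l : nat) : O := tow r (digits q r l).
pose M (j l : nat) : K := crossing_coef eps p q gam r (digits q r j) (digits q r l).
have lin0 i : lin (y0 i) != 0.
  rewrite liny0; apply/eqP => /rowP/(_ i)/eqP.
  by rewrite !mxE !eqxx oner_eq0.
have /choice[v hv] i : exists v, v \is a GRing.unit /\ e i = v * y0 (s0 i).
  have [|v vu E] := ideal_assoc Oloc _ (eE i); last by exists v.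
  by apply: contraNneq (lin0 (s0 i)) => ->; rewrite raddf0.
have ne i : nonunits (e i).
  by have [_ ->] := hv i; apply: nonunitsM; case: y0c.
have lin_e i : exists2 c : K, c != 0 & lin (e i) = c *: delta_mx 0 (s0 i).
  have [vu ->] := hv i; have [c nv] := Oloc.2 (v i); exists c.
    exact/(unit_residue Oloc nv).
  by rewrite (gradient_mul lin_sq (y0c.1 _) nv) liny0.
have e0 i : e i != 0.
  have [c c0 E] := lin_e i; apply/eqP => e0; move: E; rewrite e0 raddf0.
  by move/rowP/(_ (s0 i))/eqP; rewrite !mxE !eqxx mulr1 eq_sym (negPf c0).
have /choice[u /choice[chi' hu]] i : exists v (chi : gT -> K), v \is a GRing.unit /\
    forall g, act g (v * e i) = chi g *: (v * e i).
  have [|a [psi [au ha]]] := semi_invariant charK hact (A := [set: gT]%G) Oloc (e0 i).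
    by move=> g _; rewrite -act_ideal1 // E_inv.
  by exists a, psi; split=> // g; apply: ha; rewrite finset.in_setT.
pose e' i := u i * e i.
pose Lf := \matrix_j lin (f j); pose LY := \matrix_(l < k) lin (Y l).
pose Le := \matrix_i lin (e i); pose Le' := \matrix_i lin (e' i).
have Lf_free : row_free Lf by apply: gradients_row_free.
have [LY_free LY_f] : row_free LY /\ (LY <= Lf)%MS.
  exact: (tower_gradients charK heps p_gt0 ord_x prod_x I_nosplit hq w_unit F0_eigen lin_sq).
have Le'_e : (Le' <= Le)%MS.
  apply/row_subP => i; rewrite rowK; have [c nu] := Oloc.2 (u i).
  rewrite (gradient_mul lin_sq (ne i) nu); apply: scalemx_sub.
  by have := row_sub i Le; rewrite rowK.
have Le'_free : row_free Le'.
  apply: inj_row_free => b bL; apply/rowP => i; rewrite [RHS]mxE.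
  have /rowP/(_ (s0 i)) := bL; rewrite mulmx_sum_row summxE (bigD1 i) //= big1 => [|j ne_ji].
    rewrite addr0 rowK; have [c nu] := Oloc.2 (u i); have [uu _] := hu i.
    rewrite (gradient_mul lin_sq (ne i) nu); have [d d0 ->] := lin_e i.
    rewrite !mxE !eqxx mulr1 => /eqP.
    by rewrite !mulf_eq0 (negPf d0) (negPf ((unit_residue Oloc nu).1 uu)) !orbF => /eqP.
  rewrite rowK; have [c nu] := Oloc.2 (u j).
  rewrite (gradient_mul lin_sq (ne j) nu); have [d d0 ->] := lin_e j.
  rewrite !mxE eqxx; case: eqP => [/s0_inj E|_]; last by rewrite !mulr0.
  by rewrite E eqxx in ne_ji.
(* The two spans of rows lie in those of the gradients of the [f j] and of the [e i], which meet
   only in zero, so the ranks add up. *)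
have YE_free : row_free (col_mx LY Le').
  rewrite /row_free -addsmxE mxrank_disjoint_sum; first by rewrite (eqP LY_free) (eqP Le'_free).
  apply/eqP; rewrite -submx0; apply: submx_trans (capmxS LY_f Le'_e) _.
  by rewrite (transverse_capmx Oloc lin1 lin_sq sq_lin).
have Y_eig l : nonunits (Y l) /\ eigenvector act r x (Y l).
  split; first exact: tower_nonunits.
  exact: (tower_eigenvector heps p_gt0 ord_x prod_x hq F0_eigen).
have e'_eig i : nonunits (e' i) /\ eigenvector act r x (e' i).
  split; first exact: nonunitsM.
  by move=> a _; have [_ he] := hu i; exists (chi' i (x a)).
have [||k_le_n [y [yc yY ye y_eig]]] := extend_eigen_coordinates charK heps Oloc
    p_gt0 ord_x _ hact y0c lin_sq sq_lin liny0 (fun l : 'I_k => Y_eig l) e'_eig.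
- by move=> i j _ _; apply: gT_ab.
- exact: YE_free.
have Y_neq0 (l : 'I_k) : Y l != 0.
  apply/eqP => Yl0; have : delta_mx 0 l *m LY == 0 :> 'rV_n.
    by rewrite -rowE rowK Yl0 raddf0.
  rewrite (mulmx_free_eq0 _ LY_free) => /eqP/rowP/(_ l)/eqP.
  by rewrite !mxE !eqxx oner_eq0.
have /choice[b0 hb0] (jl : nat * 'I_k) :
    exists b : nat, M jl.1 jl.2 = eps k ^+ b * M jl.1 z0.
  exact: (coef_ratio heps p_gt0 ord_x prod_x I_nosplit hq F0_eigen jl.1 k_gt0
    (Y_neq0 jl.2) (Y_neq0 z0)).
have M_order (j : nat) (l : 'I_k) : M j l ^+ #|gT| = 1.
  exact: (coef_order heps p_gt0 ord_x prod_x hq F0_eigen j (Y_neq0 l)).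
have gT_gt0 : (0 < #|gT|)%N by apply/card_gt0P; exists 1%g.
have M_neq0 (j : nat) (l : 'I_k) : M j l != 0.
  apply/eqP => M0; have := M_order j l; rewrite M0 expr0n gtn_eqF // => /esym/eqP.
  by rewrite oner_eq0.
(* In the first column the exponent has to be the integer 0, whereas [b0] is determined only modulo
   [k]. *)
pose beta (j l : 'I_k) : int := if l == z0 then 0 else (b0 (j : nat, l))%:Z.
have betaE j l : eps k ^ beta j l = (M j z0)^-1 * M j l.
  rewrite /beta; case: eqP => [->|_]; first by rewrite expr0z mulVf.
  by rewrite (hb0 (j : nat, l)) mulrCA mulVf // mulr1.
have /choice[c hc] (ij : nat * 'I_n) : exists a : int, (ij.1 < r)%N ->
    act (x ij.1) (y ij.2) = eps (p ij.1) ^ a *: y ij.2.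
  have [lt_ir|le_ri] := ltnP ij.1 r; last by exists 0.
  have [lam yl] := y_eig ij.2 ij.1 lt_ir.
  by have [a E] := eigenvalue_root hact heps p_gt0 ord_x lt_ir yl; exists (a%:Z).
(* Here [s] is [r]: when [x i] lies in the preceding subgroup, [q i = 1] and its digit is always
   0. *)
exists k_le_n, y, (fun i j => c (i, j)), beta, r, gam; split=> //.
- split.
    move=> i; have [j yE] := ye i; exists j; rewrite yE.
    by have [uu _] := hu i; rewrite assoc_ideal.
  exists (range (widen_ord k_le_n)); rewrite image_comp.
  rewrite (tower_ideal_gen charK heps p_gt0 ord_x prod_x I_nosplit hq w_unit F0_eigen).
  congr ideal_gen; apply/seteqP; split=> _ [l _ <-]; exists l => //=; by rewrite yY.
- by move=> i j lt_ir; apply: (hc (i, j)).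
- split; first by move=> j; rewrite /beta (_ : Ordinal k_gt0 = z0) // eqxx.
  rewrite -(factor_ideal Oloc Oprime prod_x hact f_vanish f_free I_inv I_nosplit hq w_unit).
  (* Each row has been divided by its first entry, which changes the product only by a nonzero
     scalar. *)
  have -> : \prod_(j < k) \sum_(l < k) eps k ^ beta j l *: y (widen_ord k_le_n l) =
      (\prod_(j < k) (M j z0)^-1)%:A *
      \prod_(j < k) act (coset_rep x (digits q r j) r) (w * f z0).
    rewrite mulr_algl -scaler_prod; apply: eq_bigr => j _.
    rewrite (factor_sum charK heps p_gt0 ord_x prod_x I_nosplit hq F0_eigen) scaler_sumr.
    by apply: eq_bigr => l _; rewrite betaE yY scalerA.
  rewrite assoc_ideal //; rewrite -in_algE rmorph_unit // unitfE.
  by apply/prodf_neq0 => j _; rewrite invr_eq0.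
split=> //.
  by move=> i l lt_ir _ _; apply: (eigexp_lt _ _ p_gt0 ord_x hqH).
(* The first entry of a row is an eigenvalue of a group element, hence a root of unity of order
   dividing [#|gT|]. *)
move=> j; exists (M j z0)^-1; last by move=> l; apply: betaE.
by exists #|gT| => //; rewrite exprVn M_order invr1.
Qed.
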